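(* For every positive integer $t$ there exist an irrational number $\lambda_t\in(0,1/6)$, $3$-graphs $\mathcal{G}_1,\ldots,\mathcal{G}_t$ with $v(\mathcal{G}_i)=3t+5$ for every $i\in\{1,\ldots,t\}$, and a finite family $\mathcal{M}_t$ of $3$-graphs with the following properties. (a) $\pi(\mathcal{M}_t)=6\lambda_t$. (b) There exist constants $\epsilon=\epsilon(t)>0$ and $N_0=N_0(t)$ such that for every integer $n\ge N_0$, every $n$-vertex $\mathcal{M}_t$-free $3$-graph with minimum degree at least $(3\lambda_t-\epsilon)n^2$ is $\mathcal{G}_i$-colorable for some $i\in\{1,\ldots,t\}$. (c) $\xi(\mathcal{M}_t)=t$.
   Context: For an integer $r\ge 2$, an $r$-graph $\mathcal{H}$ is a collection of $r$-element subsets (edges) of a finite vertex set $V(\mathcal{H})$; $\mathcal{H}$ is identified with its edge set, $|\mathcal{H}|$ is the number of edges and $v(\mathcal{H})=|V(\mathcal{H})|$. The degree of a vertex is the number of edges containing it, and the minimum degree is the minimum over all vertices. Given a family $\mathcal{F}$ of $r$-graphs, $\mathcal{H}$ is $\mathcal{F}$-free if it contains no member of $\mathcal{F}$ as a (not necessarily induced) subgraph. $\mathrm{ex}(n,\mathcal{F})$ is the maximum number of edges of an $\mathcal{F}$-free $r$-graph on $n$ vertices, and the Turán density is $\pi(\mathcal{F})=\lim_{n\to\infty}\mathrm{ex}(n,\mathcal{F})/\binom{n}{r}$. An $r$-graph $\mathcal{H}$ is $\mathcal{G}$-colorable, for an $r$-graph $\mathcal{G}$, if there is a map $\phi\colon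 V(\mathcal{H})\to V(\mathcal{G})$ with $\phi(E)\in\mathcal{G}$ for all $E\in\mathcal{H}$. Stability number: for an integer $s\ge 1$, a family $\mathcal{F}$ of $r$-graphs is $s$-stable if for every $m\in\mathbb{N}$ there exist $r$-graphs $\mathcal{S}_1(m),\ldots,\mathcal{S}_s(m)$ on $m$ vertices such that the following holds: for every $\delta>0$ there exist $\epsilon>0$ and $N_0$ such that for all $n\ge N_0$, if $\mathcal{H}$ is an $\mathcal{F}$-free $r$-graph on $n$ vertices with $|\mathcal{H}|>(1-\epsilon)\,\mathrm{ex}(n,\mathcal{F})$, then $\mathcal{H}$ can be transformed into (an isomorphic copy of) some $\mathcal{S}_i(n)$ by adding and removing at most $\delta n^r$ edges. The stability number $\xi(\mathcal{F})$ is the minimum integer $s$ such that $\mathcal{F}$ is $s$-stable, and $\xi(\mathcal{F})=\infty$ if there is no such $s$. *)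

(* Defs.v *)
From HB Require Import structures.
From mathcomp Require Import all_boot all_order all_algebra.
From mathcomp Require Import all_classical all_reals all_analysis.

Set Implicit Arguments.
Unset Strict Implicit.
Unset Printing Implicit Defensive.

Import Order.TTheory GRing.Theory Num.Theory.
Import numFieldNormedType.Exports.

Local Open Scope ring_scope.

(* An r-graph whose vertex set is 'I_n; isolated vertices are allowed. *)
Record hypergraph (r n : nat) := Hypergraph {
  edges :> {set {set 'I_n}};
  edges_uniform : [forall e in edges, #|e| == r] }.

HB.instance Definition _ r n := [isSub for @edges r n].
HB.instance Definition _ r n := [Countable of hypergraph r n by <:].
HB.instance Definition _ r n := [Finite of hypergraph r n by <:].

Section Hypergraphs.
Variable r : nat.

Definition degree n (H : hypergraph r n) (v : 'I_n) : nat :=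
  #|[set e in edges H | v \in e]|.

(* Every degree is at most #|edges H|, so for n > 0 the default value of the
   iterated minimum does not affect the result. *)
Definition min_degree n (H : hypergraph r n) : nat :=
  \big[minn/#|edges H|]_(v < n) degree H v.

Definition subgraph m n (K : hypergraph r m) (H : hypergraph r n) : Prop :=
  exists2 f : 'I_m -> 'I_n,
    injective f & forall e : {set _}, e \in edges K -> f @: e \in edges H.

Definition isomorphic m n (K : hypergraph r m) (H : hypergraph r n) : Prop :=
  exists2 f : 'I_m -> 'I_n,
    bijective f & forall e : {set _}, (f @: e \in edges H) = (e \in edges K).

Definition colorable m n (G : hypergraph r m) (H : hypergraph r n) : Prop :=
  exists phi : 'I_n -> 'I_m, forall e : {set _}, e \in edges H -> phi @: e \in edges G.

Definition hfamily := set {n : nat & hypergraph r n}.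

Definition hfamily_free (F : hfamily) n (H : hypergraph r n) : Prop :=
  forall K, F K -> ~ subgraph (projT2 K) H.

Definition ex_number (n : nat) (F : hfamily) : nat :=
  \max_(H : hypergraph r n | `[< hfamily_free F H >]) #|edges H|.

Definition edit_distance n (H K : hypergraph r n) : nat :=
  #|edges H :\: edges K| + #|edges K :\: edges H|.

Variable R : realType.

(* Stated as convergence rather than through the total operator [lim], whose
   value is arbitrary on divergent sequences. *)
Definition is_turan_density (F : hfamily) (p : R) : Prop :=
  ((fun n : nat => (ex_number n F)%:R / 'C(n, r)%:R : R) @ \oo --> p)%classic.

Definition s_stable (s : nat) (F : hfamily) : Prop :=
  exists S : forall m : nat, 'I_s -> hypergraph r m,
  forall delta : R, 0 < delta ->
  exists2 eps : R, 0 < eps & exists N0 : nat,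
  forall n : nat, (N0 <= n)%N ->
  forall H : hypergraph r n, hfamily_free F H ->
    (1 - eps) * (ex_number n F)%:R < #|edges H|%:R ->
  exists (i : 'I_s) (K : hypergraph r n),
    isomorphic (S n i) K /\ (edit_distance H K)%:R <= delta * n%:R ^+ r.

(* [None] stands for infinity. *)
Definition stability_number (F : hfamily) : option nat :=
  match pselect (exists s, `[< (1 <= s)%N /\ s_stable s F >]) with
  | left h => Some (ex_minn h)
  | right _ => None
  end.

End Hypergraphs.

Arguments stability_number {r} R F.
Arguments s_stable {r} R s F.

(* Main.v *)
Require Import Defs.
From mathcomp Require Import all_boot all_order all_algebra fingroup perm.
From mathcomp Require Import all_classical all_reals all_analysis.
From mathcomp Require Import ring lra zify.

Set Implicit Arguments.
Unset Strict Implicit.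
Unset Printing Implicit Defensive.

Import Order.TTheory GRing.Theory Num.Theory.
Import numFieldNormedType.Exports.

Local Open Scope ring_scope.

(** The forbidden family consists of all 3-graphs K of bounded order that are
    colorable by none of t fixed 3-graphs, the patterns. If the order bound N
    is large enough, this finite family behaves like the infinite family of all
    non-colorable 3-graphs: a 3-graph that avoids it has all its N-element
    vertex sets colorable ([locally_colorable]), and with enough edges it turns
    out to be globally colorable up to few vertices.

    The patterns have vertex set A + B with |A| = m = 3t + 1 and |B| = 4. All
    triples are edges except that every a in A is assigned one of two perfect
    matchings of B and misses the two triples formed by a and a matching edge;
    in the i-th pattern (i < t) the first i + 1 vertices of A get the first
    matching. With the weights on A and on B equalized, the kept part
    of the link of a inside B contributes exactly the square of half the weight
    of B, whichever matching a was assigned. So all patterns have the same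
    Lagrangian, and it is the maximum over alpha, the weight of A, of one cubic
    polynomial [profile] (lemmas [deficitE] and [pattern_unique]).
    The critical point involves the square root of m^2 - 3m + 3, which lies
    strictly between (m - 2)^2 and (m - 1)^2, whence the irrationality.
    The numbers i + 1 and m - (i + 1) of vertices with the two matchings can be
    recovered from the pattern, and i + 1 <= t < m - (j + 1) for all i and j, so
    that no homomorphism joins two different patterns ([pattern_hom_index]).

    From these patterns the theorem uses only what [extremal_patterns] records:
    any two vertices lie in an edge, a homomorphism between patterns forces
    equality of indices, and the Lagrangians share one maximum L, attained at a
    single weighting, which is positive everywhere.

    Let h be locally colorable on n vertices. Shifting weight between two
    vertices that lie in no common edge shows that the Lagrange polynomial of h
    is at most L times the cube of the total weight ([lagrangian_le]); this
    gives the Turan density. For stability, h is transformed by Zykov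
    symmetrization, one cloned vertex at a time, into a 3-graph in which
    non-adjacent vertices are twins; such a 3-graph is colorable
    ([symmetrized_colorable]). The number of edges never drops, hence at every
    stage all but few vertices have nearly maximal degree ([few_low_degree]).
    Colorability of the high-degree part is transported back along the chain:
    consecutive stages differ in one vertex, and the few missing vertices are
    added again one by one ([extension], [rich_colorable]). A vertex v can be
    added because otherwise each color a would be refuted by an edge v y z; the
    at most 2k vertices y, z, a transversal copy of the pattern to which they are
    attached as their colors demand, and v itself would form a bounded
    non-colorable configuration.

    A nearly extremal 3-graph is therefore close to a blowup of a pattern with
    part sizes close to the optimal weights, which yields t-stability
    ([t_stable]). If fewer than t graphs sufficed, two different blowups would
    be close to each other up to isomorphism, and a transversal surviving the
    few edits would be a homomorphism between two different patterns
    ([not_stable]). *)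

(** * Triple systems and their Lagrange polynomials *)

(** Relations on ordered triples, instead of sets of 3-sets, turn the Lagrange
    polynomial into a trilinear form that can be handled one variable at a time. *)
Definition triple_system (V : Type) (h : V -> V -> V -> bool) : Prop :=
  [/\ forall u v w, h u v w = h v u w,
      forall u v w, h u v w = h u w v
    & forall u v, h u u v = false].

Definition adjacent (V : finType) (h : V -> V -> V -> bool) (u v : V) : bool :=
  [exists w, h u v w].

Definition pull (V C : Type) (phi : V -> C) (h : C -> C -> C -> bool) u v w :=
  h (phi u) (phi v) (phi w).

Lemma triple_system_pull (V C : Type) (phi : V -> C) h :
  triple_system h -> triple_system (pull phi h).
Proof. by case=> h1 h2 h3; split=> *; rewrite /pull ?h3. Qed.

Section TripleSystem.
Variables (V : Type) (h : V -> V -> V -> bool).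
Hypothesis hT : triple_system h.

Lemma ts12 u v w : h u v w = h v u w. Proof. by case: hT. Qed.
Lemma ts23 u v w : h u v w = h u w v. Proof. by case: hT. Qed.
Lemma ts13 u v w : h u v w = h w v u. Proof. by rewrite ts12 ts23 ts12. Qed.
Lemma tsxx u v : h u u v = false. Proof. by case: hT. Qed.
Lemma tsxyx u v : h u v u = false. Proof. by rewrite ts23 tsxx. Qed.
Lemma tsyxx u v : h v u u = false. Proof. by rewrite ts12 tsxyx. Qed.

End TripleSystem.

Lemma ts_neq (V : eqType) (h : V -> V -> V -> bool) u v w :
  triple_system h -> h u v w -> [/\ u != v, u != w & v != w].
Proof.
move=> hT huvw; split; apply/eqP => e; move: huvw; rewrite e.
- by rewrite (tsxx hT).
- by rewrite (tsxyx hT).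
- by rewrite (tsyxx hT).
Qed.

Section Lagrangian.
Variables (R : realType) (V : finType).
Implicit Types (h : V -> V -> V -> bool) (x : V -> R).

Definition codeg_form h x u v : R := \sum_w x w * (h u v w)%:R.
Definition link_form h x u : R := \sum_v x v * codeg_form h x u v.
(** Every edge is counted in its six orders, so this is six times the usual
    Lagrange polynomial, and its value at the constant weight 1 is six times the
    number of edges. *)
Definition lagrangian h x : R := \sum_u x u * link_form h x u.

Definition push (C : finType) (phi : V -> C) x (a : C) : R :=
  \sum_(u | phi u == a) x u.

Lemma sum_push (C : finType) (phi : V -> C) x (F : C -> R) :
  \sum_a push phi x a * F a = \sum_u x u * F (phi u).
Proof.
rewrite [RHS](partition_big phi predT) //=; apply: eq_bigr => a _.
by rewrite mulr_suml; apply: eq_bigr => u /eqP ->.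
Qed.

Lemma total_push (C : finType) (phi : V -> C) x :
  \sum_a push phi x a = \sum_u x u.
Proof. by rewrite [RHS](partition_big phi predT). Qed.

Lemma push_ge0 (C : finType) (phi : V -> C) x a :
  (forall u, 0 <= x u) -> 0 <= push phi x a.
Proof. by move=> x0; apply: sumr_ge0. Qed.

Lemma lagrangianE h x :
  lagrangian h x = \sum_u \sum_v \sum_w x u * x v * x w * (h u v w)%:R.
Proof.
apply: eq_bigr => u _; rewrite mulr_sumr; apply: eq_bigr => v _.
by rewrite mulrA mulr_sumr; apply: eq_bigr => w _; rewrite mulrA.
Qed.

Lemma link_formE h x u :
  link_form h x u = \sum_v \sum_w x v * x w * (h u v w)%:R.
Proof.
by apply: eq_bigr => v _; rewrite mulr_sumr; apply: eq_bigr => w _; rewrite mulrA.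
Qed.

Lemma ler_lagrangian h h' x x' :
  (forall u, 0 <= x u) -> (forall u, x u <= x' u) ->
  (forall u v w, 0 < x u -> 0 < x v -> 0 < x w -> h u v w -> h' u v w) ->
  lagrangian h x <= lagrangian h' x'.
Proof.
move=> x0 xx' hh'; rewrite !lagrangianE.
have x'0 u : 0 <= x' u by exact: le_trans (x0 u) (xx' u).
apply: ler_sum => u _; apply: ler_sum => v _; apply: ler_sum => w _.
have [xu|] := boolP (0 < x u); last first.
  by rewrite lt0r x0 andbT negbK => /eqP ->; rewrite !mul0r !mulr_ge0.
have [xv|] := boolP (0 < x v); last first.
  by rewrite lt0r x0 andbT negbK => /eqP ->; rewrite !(mulr0,mul0r) !mulr_ge0.
have [xw|] := boolP (0 < x w); last first.
  by rewrite lt0r x0 andbT negbK => /eqP ->; rewrite !(mulr0,mul0r) !mulr_ge0.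
apply: ler_pM; rewrite ?mulr_ge0 //.
  by rewrite !ler_pM ?mulr_ge0.
by rewrite ler_nat; move: (hh' _ _ _ xu xv xw); case: (h u v w) => // ->.
Qed.

Lemma lagrangianZ h x c : lagrangian h (fun u => c * x u) = c ^+ 3 * lagrangian h x.
Proof.
rewrite !lagrangianE mulr_sumr; apply: eq_bigr => u _.
rewrite mulr_sumr; apply: eq_bigr => v _.
by rewrite mulr_sumr; apply: eq_bigr => w _; ring.
Qed.

Lemma link_formZ h x c u : link_form h (fun u => c * x u) u = c ^+ 2 * link_form h x u.
Proof.
rewrite !link_formE mulr_sumr; apply: eq_bigr => v _.
by rewrite mulr_sumr; apply: eq_bigr => w _; ring.
Qed.

Lemma eq_lagrangian h x x' : x =1 x' -> lagrangian h x = lagrangian h x'.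
Proof. by move=> /funext ->. Qed.

Definition shift x (s : R) (u v y : V) : R :=
  x y + s * ((y == u)%:R - (y == v)%:R).

Lemma sum_shift x s u v (F : V -> R) :
  \sum_y shift x s u v y * F y = \sum_y x y * F y + s * (F u - F v).
Proof.
have pick z : \sum_y (y == z)%:R * F y = F z.
  by rewrite (bigD1 z) //= eqxx mul1r big1 ?addr0 // => y /negPf->; rewrite mul0r.
under eq_bigr do rewrite /shift mulrDl.
rewrite big_split /=; congr (_ + _).
under eq_bigr do rewrite -mulrA mulrBl.
by rewrite -mulr_sumr sumrB !pick.
Qed.

Lemma total_shift x s u v : \sum_y shift x s u v y = \sum_y x y.
Proof.
have := sum_shift x s u v (fun=> 1); rewrite subrr mulr0 addr0.
by under eq_bigr do rewrite mulr1; under [X in _ = X -> _]eq_bigr do rewrite mulr1.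
Qed.

Lemma codeg_formC h x u v : triple_system h ->
  codeg_form h x u v = codeg_form h x v u.
Proof. by move=> hT; apply: eq_bigr => w _; rewrite (ts12 hT). Qed.

Lemma codeg_form0 h x u v : ~~ adjacent h u v -> codeg_form h x u v = 0.
Proof.
move/existsPn => huv; rewrite /codeg_form big1 // => w _.
by rewrite (negPf (huv w)) mulr0.
Qed.

(** The second and third order terms in s carry a factor h a b c with two of a, b,
    c in {u, v}; they vanish since u and v lie in no common edge. *)
Lemma lagrangian_shift h x s u v : triple_system h -> ~~ adjacent h u v ->
  lagrangian h (shift x s u v) =
  lagrangian h x + 3 * s * (link_form h x u - link_form h x v).
Proof.
move=> hT nuv.
have uu y : codeg_form h x y y = 0.
  by apply: codeg_form0; apply/existsPn => w; rewrite (tsxx hT).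
have cuv := codeg_form0 x nuv.
have cvu : codeg_form h x v u = 0 by rewrite codeg_formC.
have huv a : h a u v = false.
  by apply: negbTE; rewrite (ts12 hT) (ts23 hT); exact: (existsPn nuv).
have hvu a : h a v u = false by rewrite (ts23 hT).
have co a b : codeg_form h (shift x s u v) a b =
    codeg_form h x a b + s * ((h a b u)%:R - (h a b v)%:R).
  by rewrite /codeg_form sum_shift.
have cx a b : \sum_y x y * (h a y b)%:R = codeg_form h x a b.
  by apply: eq_bigr => y _; rewrite (ts23 hT).
have li a : link_form h (shift x s u v) a =
    link_form h x a + 2 * s * (codeg_form h x a u - codeg_form h x a v).
  rewrite /link_form sum_shift !co huv hvu !(tsyxx hT) subrr mulr0 !addr0.
  under eq_bigr do rewrite co mulrDr mulrCA mulrBr.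
  by rewrite big_split /= -mulr_sumr sumrB !cx; ring.
have lx a : \sum_y x y * codeg_form h x y a = link_form h x a.
  by apply: eq_bigr => y _; rewrite codeg_formC.
rewrite {1}/lagrangian sum_shift !li cuv cvu !uu.
under eq_bigr do rewrite li mulrDr mulrCA mulrBr.
by rewrite big_split /= -mulr_sumr sumrB !lx /lagrangian; ring.
Qed.

End Lagrangian.

Lemma link_form_push (R : realType) (V C : finType) (phi : V -> C) h (x : V -> R) u :
  link_form h (push phi x) (phi u) = link_form (pull phi h) x u.
Proof.
rewrite /link_form sum_push; apply: eq_bigr => v _; congr (_ * _).
by rewrite /codeg_form sum_push.
Qed.

(** The Lagrange polynomial of a blowup depends only on the total weights of the
    parts. *)
Lemma lagrangian_push (R : realType) (V C : finType) (phi : V -> C) h (x : V -> R) :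
  lagrangian h (push phi x) = lagrangian (pull phi h) x.
Proof.
rewrite /lagrangian sum_push; apply: eq_bigr => u _; congr (_ * _).
exact: link_form_push.
Qed.

(** * Local colorability and the Motzkin-Straus argument *)

Lemma adjacentC (V : finType) (h : V -> V -> V -> bool) u v :
  triple_system h -> adjacent h u v = adjacent h v u.
Proof. by move=> hT; apply: eq_existsb => w; rewrite (ts12 hT). Qed.

Section Coloring.
Variables (J : Type) (C : finType) (g : J -> C -> C -> C -> bool).

Definition colors (V : finType) (h : V -> V -> V -> bool) (W : {set V})
    (j : J) (phi : V -> C) :=
  forall u v w, u \in W -> v \in W -> w \in W ->
    h u v w -> g j (phi u) (phi v) (phi w).

Definition colorable_on (V : finType) (h : V -> V -> V -> bool) (W : {set V}) :=
  exists j phi, colors h W j phi.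

(** This is the only consequence of avoiding the forbidden family that is used
    about a 3-graph; unlike freeness it is visibly inherited by blowups. *)
Definition locally_colorable (N : nat) (V : finType) (h : V -> V -> V -> bool) :=
  forall S : {set V}, (#|S| <= N)%N -> colorable_on h S.

Lemma locally_colorable_pull N (V U : finType) (p : V -> U) h :
  locally_colorable N h -> locally_colorable N (pull p h).
Proof.
move=> hL S SN; have [|j [phi hphi]] := hL (p @: S).
  exact: leq_trans (leq_imset_card _ _) SN.
by exists j, (phi \o p) => u v w uS vS wS; apply: hphi; exact: imset_f.
Qed.

Hypothesis gT : forall j, triple_system (g j).

(** One more vertex than colors, together with one further vertex for every
    ordered pair of them to complete an edge. *)
Definition local_size := (#|C|.+1 * #|C|.+2)%N.

Section Local.
Variables (V : finType) (h : V -> V -> V -> bool).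
Hypothesis hT : triple_system h.
Hypothesis hL : locally_colorable local_size h.

(** Inside a colored set, two vertices in a common edge get different colors; a
    clique with one vertex more than there are colors, with witnessing edges for
    all its pairs, is small enough to be colored. *)
Lemma clique_le (S : {set V}) :
  (forall u v, u \in S -> v \in S -> u != v -> adjacent h u v) ->
  (#|S| <= #|C|)%N.
Proof.
move=> Sadj; rewrite leqNgt; apply/negP => ltS.
have [S' [S'S cS']] : exists S' : {set V}, S' \subset S /\ #|S'| = #|C|.+1.
  exists [set x in take #|C|.+1 (enum S)]; split.
    by apply/fintype.subsetP => x; rewrite inE => /mem_take; rewrite mem_enum.
  have /card_uniqP e : uniq (take #|C|.+1 (enum S)) by rewrite take_uniq ?enum_uniq.
  by rewrite cardsE e size_takel // -cardE.
pose wit u v := odflt u [pick w | h u v w].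
have [|j [phi hphi]] := hL (S := S' :|: [set wit p.1 p.2 | p in finset.setX S' S']).
  apply: leq_trans (leq_card_setU _ _) _.
  apply: leq_trans (leq_add (leqnn _) (leq_imset_card _ _)) _.
  by rewrite cardsX cS' -mulnS leqnn.
have inj : {in S' &, injective phi}.
  move=> u v uS vS e; apply/eqP; apply/negPn/negP => uv.
  have /existsP [w0 hw0] : adjacent h u v.
    by apply: Sadj => //; exact: (fintype.subsetP S'S).
  have hw : h u v (wit u v).
    by rewrite /wit; case: pickP => [//|/(_ w0)]; rewrite hw0.
  have := hphi _ _ _ _ _ _ hw; rewrite e (tsxx (gT j)) !inE uS vS.
  have -> : wit u v \in [set wit p.1 p.2 | p in finset.setX S' S'].
    by apply/imsetP; exists (u, v); rewrite // !inE uS vS.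
  by rewrite orbT => /(_ isT isT isT).
have := max_card (mem (phi @: S')); rewrite card_in_imset // cS'.
by rewrite ltnn.
Qed.

Lemma local_size_ge n : (n <= #|C|)%N -> (n <= local_size)%N.
Proof. by rewrite /local_size => ?; nia. Qed.

Section Bound.
Variables (R : realType) (L : R).
Hypothesis gL : forall j (x : C -> R), (forall a, 0 <= x a) ->
  lagrangian (g j) x <= L * (\sum_a x a) ^+ 3.

(** Motzkin-Straus: along the direction of two vertices in no common edge the form
    is affine, so all the weight can be moved to one of them without loss. When no
    such pair is left, the support is a clique, hence colorable, and the bound is
    that of a pattern. *)
Lemma lagrangian_le (x : V -> R) : (forall u, 0 <= x u) ->
  lagrangian h x <= L * (\sum_u x u) ^+ 3.
Proof.
have [n] := ubnP #|[set u | 0 < x u]|; elim: n x => // n IH x.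
rewrite ltnS => xn x0.
have [/existsP[u /existsP[v /and4P[xu xv uv nuv]]]|/existsPn cl] :=
  boolP [exists u, exists v, [&& 0 < x u, 0 < x v, u != v & ~~ adjacent h u v]].
  wlog le_vu : u v xu xv uv nuv / link_form h x v <= link_form h x u.
    move=> H; have [le|/ltW le] := lerP (link_form h x v) (link_form h x u).
      exact: (H u v).
    by apply: (H v u) => //; [rewrite eq_sym | rewrite adjacentC].
  have x'v : shift x (x v) u v v = 0.
    by rewrite /shift eqxx eq_sym (negPf uv) sub0r mulrN1 subrr.
  have x'0 y : 0 <= shift x (x v) u v y.
    have [->|yv] := eqVneq y v; first by rewrite x'v.
    by rewrite /shift (negPf yv) subr0 addr_ge0 // mulr_ge0 // ltW.
  have := IH _ _ x'0; rewrite total_shift lagrangian_shift // => IH'.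
  apply: le_trans (IH' _); last first.
    apply: leq_trans xn; apply: proper_card; apply/properP; split.
      apply/fintype.subsetP => y; rewrite !inE.
      have [->|yv] := eqVneq y v; first by rewrite x'v ltxx.
      have [->|yu] := eqVneq y u; first by rewrite xu.
      by rewrite /shift (negPf yv) (negPf yu) subr0 mulr0 addr0.
    by exists v; rewrite inE ?xv // x'v ltxx.
  by rewrite lerDl mulr_ge0 ?subr_ge0 // mulr_ge0 // ltW.
have [|j [phi hphi]] := hL (S := [set u | 0 < x u]).
  apply: local_size_ge; apply: clique_le => u v; rewrite !inE => xu xv uv.
  by apply: contraT => nuv; move: (cl u) => /existsPn/(_ v); rewrite xu xv uv nuv.
apply: le_trans (_ : lagrangian (pull phi (g j)) x <= _).
  by apply: ler_lagrangian => // u v w xu xv xw; apply: hphi; rewrite inE.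
rewrite -lagrangian_push -(total_push phi); apply: gL => a.
exact: push_ge0.
Qed.

End Bound.

Definition symmetrized := forall u v, ~~ adjacent h u v ->
  forall y z, h u y z = h v y z.

(** Being non-adjacent is now an equivalence relation; a system of
    representatives is a clique, hence small, and its coloring is pulled back. *)
Lemma symmetrized_colorable : symmetrized -> colorable_on h finset.setT.
Proof.
move=> hS.
pose e u v := (u == v) || ~~ adjacent h u v.
have e_link u v : e u v -> forall y z, h u y z = h v y z.
  by case/orP => [/eqP ->|/hS].
have nadj u : ~~ adjacent h u u by apply/existsPn => w; rewrite (tsxx hT).
have eE u v : e u v = ~~ adjacent h u v.
  by rewrite /e; case: eqVneq => // ->; rewrite nadj.
have e_linkE u v : e u v -> forall w, e u w = e v w.
  by move=> euv w; rewrite !eE /adjacent; congr (~~ _); apply: eq_existsb => z; rewrite (e_link _ _ euv).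
pose rep u := odflt u [pick v | e u v].
have rep_e u : e u (rep u).
  by rewrite /rep; case: pickP => [//|/(_ u)]; rewrite eE nadj.
have rep_eq u v : e u v -> rep u = rep v.
  move=> euv; rewrite /rep.
  have -> : [pick w | e u w] = [pick w | e v w].
    by apply: eq_pick => w /=; exact: e_linkE.
  by case: pickP => [//|/(_ v)]; rewrite eE nadj.
have rep_id u : rep (rep u) = rep u by exact/esym/rep_eq/rep_e.
pose T := rep @: finset.setT.
have TN : (#|T| <= #|C|)%N.
  apply: clique_le => _ _ /imsetP[u _ ->] /imsetP[v _ ->] uv.
  apply: contraNT uv; rewrite -eE => euv; apply/eqP.
  by rewrite -(rep_id u) -(rep_id v); exact: rep_eq.
have [j [phi hphi]] := hL (local_size_ge TN).
exists j, (phi \o rep) => u v w _ _ _ huvw.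
apply: hphi; try exact: imset_f.
rewrite -(e_link _ _ (rep_e u)) (ts12 hT) -(e_link _ _ (rep_e v)) (ts13 hT).
by rewrite -(e_link _ _ (rep_e w)) (ts12 hT) (ts23 hT).
Qed.

End Local.
End Coloring.

(** * Zykov symmetrization and vertices of low degree *)

Section Counting.
Variables (R : realType) (V : finType).
Implicit Types h : V -> V -> V -> bool.

Definition size3 h : R := lagrangian h (fun=> 1).
Definition deg2 h u : R := link_form h (fun=> 1) u.

Lemma size3_sum h : size3 h = \sum_u deg2 h u.
Proof. by apply: eq_bigr => u _; rewrite mul1r. Qed.

Lemma deg2E h u : deg2 h u = \sum_v \sum_w (h u v w)%:R.
Proof. by rewrite /deg2 link_formE; do 2!apply: eq_bigr => ? _; rewrite !mul1r. Qed.

Lemma size3E h : size3 h = \sum_u \sum_v \sum_w (h u v w)%:R.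
Proof. by rewrite size3_sum; apply: eq_bigr => u _; rewrite deg2E. Qed.

Definition clone (u v : V) h := pull (fun y => if y == v then u else y) h.

Lemma size3_clone h u v : triple_system h -> u != v -> ~~ adjacent h u v ->
  size3 (clone u v h) = size3 h + 3 * (deg2 h u - deg2 h v).
Proof.
move=> hT uv nuv; rewrite /size3 /clone -lagrangian_push.
rewrite [LHS](_ : _ = lagrangian h (shift (fun=> 1) 1 u v)).
  by rewrite lagrangian_shift // mulr1.
apply: eq_lagrangian => a; rewrite /push /shift mul1r.
have [->|av] := eqVneq a v.
  rewrite eq_sym (negPf uv) sub0r subrr big1 // => y /= /eqP.
  by case: (eqVneq y v) => /= [_ e|yv e]; [rewrite e eqxx in uv | rewrite e eqxx in yv].
have [->|au] := eqVneq a u.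
  rewrite subr0 (bigD1 u) /=; last by rewrite (negPf uv).
  rewrite (big_pred1 v) // => y /=; have [->|yv] := eqVneq y v.
    by rewrite /= eqxx eq_sym uv.
  by case: (eqVneq y u).
rewrite subrr addr0 (big_pred1 a) // => y /=; case: (eqVneq y v) => // ->.
by rewrite eq_sym (negPf au) eq_sym (negPf av).
Qed.

Definition twins h x y := [forall b, forall c, h x b c == h y b c].
(** The second coordinate of the termination measure: among 3-graphs with equally
    many edges, symmetrization proceeds by enlarging classes of twins. *)
Definition num_twins h : nat := (\sum_x \sum_y twins h x y)%N.

Lemma twinsP h x y : reflect (forall b c, h x b c = h y b c) (twins h x y).
Proof.
apply: (iffP forallP) => [H b c|H b]; first by move: (H b) => /forallP/(_ c)/eqP.
by apply/forallP => c; apply/eqP.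
Qed.

Lemma twinsC h x y : twins h x y = twins h y x.
Proof. by apply: eq_forallb => b; apply: eq_forallb => c; rewrite eq_sym. Qed.

(** Vertex v leaves its class of twins and joins that of u, which is at least as
    large; all other pairs of twins survive. *)
Lemma num_twins_clone h u v : u != v ->
  ~~ twins h u v -> (\sum_y twins h y v <= \sum_y twins h y u)%N ->
  (num_twins h < num_twins (clone u v h))%N.
Proof.
move=> uv ntw le_c.
(* The contribution of v is separated from the pairs avoiding v. *)
have split k : num_twins k = (twins k v v + (\sum_(y | y != v) twins k y v) * 2 +
    \sum_(x | x != v) \sum_(y | y != v) twins k x y)%N.
  rewrite /num_twins (bigD1 v) //= (bigD1 v) //=.
  have -> : (\sum_(x | x != v) \sum_y twins k x y =
      \sum_(x | x != v) twins k x v +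
      \sum_(x | x != v) \sum_(y | y != v) twins k x y)%N.
    by rewrite -big_split; apply: eq_bigr => x _; rewrite (bigD1 v).
  have -> : (\sum_(i | i != v) twins k v i = \sum_(i | i != v) twins k i v)%N.
    by apply: eq_bigr => i _; rewrite twinsC.
  lia.
have tvv k : twins k v v by apply/twinsP.
have old : (\sum_(x | x != v) \sum_(y | y != v) twins h x y <=
    \sum_(x | x != v) \sum_(y | y != v) twins (clone u v h) x y)%N.
  apply: leq_sum => x xv; apply: leq_sum => y yv.
  case: (twinsP h x y) => // t; rewrite (_ : twins _ _ _ = true) //.
  by apply/twinsP => b c; rewrite /clone /pull (negPf xv) (negPf yv).
have new : (\sum_y twins h y u <= \sum_(y | y != v) twins (clone u v h) y v)%N.
  rewrite (bigD1 v) //= twinsC (negPf ntw) add0n.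
  apply: leq_sum => y yv; case: (twinsP h y u) => // t.
  rewrite (_ : twins _ _ _ = true) //.
  by apply/twinsP => b c; rewrite /clone /pull (negPf yv) eqxx.
rewrite !split !tvv.
move: le_c; rewrite [X in (X <= _)%N](bigD1 v) //= tvv.
lia.
Qed.

End Counting.

Arguments size3 R {V} h.
Arguments deg2 R {V} h u.

Section Symmetrization.
Variables (R : realType) (V : finType) (P : (V -> V -> V -> bool) -> Prop).
Variable (good : (V -> V -> V -> bool) -> Prop).
Hypothesis good_clone : forall h u v, good h -> good (clone u v h).
Hypothesis good_ts : forall h, good h -> triple_system h.
Hypothesis P_symm : forall h, good h -> symmetrized h -> P h.
Hypothesis P_clone : forall h u v, good h -> u != v -> ~~ adjacent h u v ->
  deg2 R h v <= deg2 R h u -> P (clone u v h) -> P h.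

(** Induction along Zykov symmetrization. For two non-adjacent vertices that are
    not twins, cloning the one of larger degree gains edges; for equal degrees,
    cloning into the larger class of twins keeps the edges and creates new twins.
    Cloning single vertices, rather than whole classes, keeps consecutive stages
    equal outside one vertex. *)
Lemma symmetrization_ind h : good h -> P h.
Proof.
pose T (k : V -> V -> V -> bool) : nat := (\sum_(u : V) \sum_(v : V) \sum_(w : V) k u v w)%N.
have TE k : size3 R k = (T k)%:R.
  rewrite size3E /T natr_sum; apply: eq_bigr => u _.
  by rewrite natr_sum; apply: eq_bigr => v _; rewrite natr_sum.
have sum_le (F : V -> nat) m : (forall v, (F v <= m)%N) -> (\sum_v F v <= #|V| * m)%N.
  by move=> H; rewrite -sum_nat_const; apply: leq_sum => v _; exact: H.
have Tle k : (T k <= #|V| * (#|V| * #|V|))%N.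
  apply: (sum_le) => u; apply: (sum_le) => v; rewrite -[leqRHS]muln1.
  by apply: (sum_le) => w; exact: leq_b1.
have Wle (k : V -> V -> V -> bool) : (num_twins k <= #|V| * #|V|)%N.
  rewrite /num_twins; apply: (sum_le) => u; rewrite -[leqRHS]muln1.
  by apply: (sum_le) => w; exact: leq_b1.
pose M (k : V -> V -> V -> bool) := ((#|V| * (#|V| * #|V|) - T k) * (#|V| * #|V|).+1 +
             (#|V| * #|V| - num_twins k))%N.
have [n] := ubnP (M h); elim: n h => // n IH h; rewrite ltnS => hM hg.
have hT := good_ts hg.
have [symm|] := pselect (symmetrized h); first exact: P_symm.
move/existsNP => [u /existsNP[v /not_implyP[nuv ntw]]].
have {}ntw : ~~ twins h u v by apply/negP => /twinsP.
wlog {ntw} [ntw le_d] : u v nuv {ntw} / ~~ twins h u v /\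
    ((deg2 R h v < deg2 R h u) \/ (deg2 R h v = deg2 R h u /\
      (\sum_y twins h y v <= \sum_y twins h y u)%N)).
  have nvu : ~~ adjacent h v u by rewrite adjacentC.
  have ntw' : ~~ twins h v u by rewrite twinsC.
  move=> H; have [lt|lt|e] := ltgtP (deg2 R h v) (deg2 R h u).
  - by apply: (H u v) => //; split=> //; left.
  - apply: (H v u) => //.
    by split=> //; left.
  - have [le|/ltnW le] := leqP (\sum_y twins h y v) (\sum_y twins h y u).
      by apply: (H u v) => //; split=> //; right.
    apply: (H v u) => //.
    by split=> //; right.
have uv : u != v by apply: contraNneq ntw => ->; apply/twinsP.
apply: (P_clone (u := u) (v := v)) => //.
  by case: le_d => [/ltW//|[-> _]].
apply: IH; last exact: good_clone.
apply: leq_trans hM.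
have := size3_clone R hT uv nuv; rewrite !TE => cE.
have Tle' := Tle (clone u v h); have Wle' := Wle (clone u v h).
have Tle0 := Tle h; have Wle0 := Wle h.
rewrite /M; case: le_d => [lt|[e le_c]].
  have : (T h < T (clone u v h))%N by rewrite -(ltr_nat R) cE; lra.
  move: Tle' => /[swap] lt_T le_K; apply: (@leq_trans
    ((#|V| * (#|V| * #|V|) - T h) * (#|V| * #|V|).+1)%N); last exact: leq_addr.
  apply: (@leq_trans (((#|V| * (#|V| * #|V|) - T (clone u v h)).+1) *
    (#|V| * #|V|).+1)%N); last by rewrite leq_mul2r ltn_sub2l ?orbT // (leq_trans lt_T).
  by rewrite mulSn addnC ltn_add2r ltnS leq_subr.
have <- : T h = T (clone u v h) by apply/eqP; rewrite -(eqr_nat R) cE e; lra.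
rewrite ltn_add2l ltn_sub2l //; last exact: num_twins_clone.
exact: leq_trans (num_twins_clone uv ntw le_c) Wle'.
Qed.

End Symmetrization.

Section LowDegree.
Variables (R : realType) (V : finType) (h : V -> V -> V -> bool).
Hypothesis hT : triple_system h.

(** All second and third order terms in p are nonnegative when p does not change
    sign. *)
Lemma lagrangian_tangent (x p : V -> R) :
  (forall u, 0 <= x u) -> (forall u, 0 <= x u + p u) ->
  (forall u v, 0 <= p u * p v) ->
  lagrangian h x + 3 * (\sum_u p u * link_form h x u) <=
  lagrangian h (fun u => x u + p u).
Proof.
move=> x0 xp0 pp.
pose F u v w := p u * x v * x w * (h u v w)%:R.
have s1 : \sum_u p u * link_form h x u = \sum_u \sum_v \sum_w F u v w.
  apply: eq_bigr => u _; rewrite link_formE mulr_sumr; apply: eq_bigr => v _.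
  by rewrite mulr_sumr; apply: eq_bigr => w _; rewrite !mulrA.
have s2 : \sum_u p u * link_form h x u = \sum_u \sum_v \sum_w F v u w.
  by rewrite s1 exchange_big.
have s3 : \sum_u p u * link_form h x u = \sum_u \sum_v \sum_w F w u v.
  by rewrite s2; apply: eq_bigr => u _; rewrite exchange_big.
rewrite [3 * _](_ : _ = \sum_u p u * link_form h x u +
  \sum_u p u * link_form h x u + \sum_u p u * link_form h x u); last by ring.
rewrite {1}s1 {1}s2 s3 !lagrangianE -!big_split /=.
apply: ler_sum => u _; rewrite -!big_split /=.
apply: ler_sum => v _; rewrite -!big_split /=.
apply: ler_sum => w _; rewrite /F (ts12 hT v) (ts12 hT w) (ts23 hT u w).
case: (h u v w); rewrite !(mulr0, mulr1, addr0) // -subr_ge0.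
have -> : (x u + p u) * (x v + p v) * (x w + p w) -
   (x u * x v * x w + (p u * x v * x w + p v * x u * x w + p w * x u * x v)) =
   p u * p v * (x w + p w) + p u * p w * x v + p v * p w * x u by ring.
by rewrite !addr_ge0 // mulr_ge0.
Qed.

Variable (L tau : R).
Hypotheses (L0 : 0 <= L) (L1 : L <= 1) (tau0 : 0 < tau).
Hypothesis hL : forall x : V -> R, (forall u, 0 <= x u) ->
  lagrangian h x <= L * (\sum_u x u) ^+ 3.

(** With more low-degree vertices than claimed, scaling down their weights so as to
    remove total weight exactly tau n / 3 would leave a value of the form above the
    bound for the smaller total weight. Scaling, unlike deleting vertices, needs no
    rounding. *)
Lemma few_low_degree :
  (L - tau ^+ 2 / 2) * #|V|%:R ^+ 3 <= size3 R h ->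
  #|[set u | deg2 R h u < (L - tau) * #|V|%:R ^+ 2]|%:R <= tau / 3 * #|V|%:R.
Proof.
move=> big; set Z := [set u | _]; rewrite leNgt; apply/negP => ltZ.
have n0 : 0 < #|V|%:R :> R.
  rewrite ltr0n lt0n; apply: contraTneq ltZ => V0.
  have -> : #|Z| = 0%N by apply/eqP; rewrite -leqn0 -V0 max_card.
  by rewrite V0 mulr0 ltxx.
set n := #|V|%:R in n0 ltZ big; set z := #|Z|%:R in ltZ.
have z0 : 0 < z by apply: le_lt_trans ltZ; rewrite !mulr_ge0 // ltW.
pose s := tau / 3 * n / z.
have s0 : 0 < s by rewrite divr_gt0 // !mulr_gt0.
have s1 : s < 1 by rewrite ltr_pdivrMr // mul1r.
have sz : s * z = tau / 3 * n by rewrite /s divfK // gt_eqF.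
pose p u := s * (u \in Z)%:R.
have p01 u : 0 <= p u <= 1.
  by rewrite /p; case: (u \in Z); rewrite ?mulr1 ?mulr0 ?lexx ?ler01 // (ltW s0) (ltW s1).
have sumZ (F : V -> R) : \sum_u p u * F u = s * \sum_(u in Z) F u.
  rewrite [X in _ * X]big_mkcond mulr_sumr; apply: eq_bigr => u _.
  by rewrite /p; case: ifP; rewrite ?mulr1 // !mulr0 mul0r.
have le1 : size3 R h - 3 * (s * \sum_(u in Z) deg2 R h u) <=
    lagrangian h (fun u => 1 - p u).
  have := @lagrangian_tangent (fun=> 1) (fun u => - p u).
  under eq_bigr do rewrite mulNr; rewrite sumrN mulrN sumZ; apply=> [//|u|u v].
    by rewrite subr_ge0; case/andP: (p01 u).
  by rewrite mulrNN mulr_ge0 //; [case/andP: (p01 u)|case/andP: (p01 v)].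
have le2 : \sum_(u in Z) deg2 R h u <= z * ((L - tau) * n ^+ 2).
  rewrite /z -sum1_card natr_sum mulr_suml; apply: ler_sum => u.
  by rewrite inE mul1r => /ltW.
have sp : \sum_u (1 - p u) = n - tau / 3 * n.
  rewrite sumrB sumr_const -/n.
  have := sumZ (fun=> 1); under eq_bigr do rewrite mulr1.
  by rewrite sumr_const -/z sz => ->.
have := hL (x := fun u => 1 - p u); rewrite sp => le3.
have {}le3 := le_trans le1 (le3 _).
have {le3} : size3 R h - 3 * (s * \sum_(u in Z) deg2 R h u) <= L * (n - tau / 3 * n) ^+ 3.
  by apply: le3 => u; rewrite subr_ge0; case/andP: (p01 u).
have le4 : s * \sum_(u in Z) deg2 R h u <= tau / 3 * n * ((L - tau) * n ^+ 2).
  by rewrite -sz -mulrA ler_wpM2l // ltW.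
have -> : L * (n - tau / 3 * n) ^+ 3 =
  L * n ^+ 3 - L * tau * n ^+ 3 + L * (tau ^+ 2 / 3 - tau ^+ 3 / 27) * n ^+ 3.
  by field.
have le5 : L * (tau ^+ 2 / 3 - tau ^+ 3 / 27) * n ^+ 3 <= tau ^+ 2 / 3 * n ^+ 3.
  rewrite ler_pM2r ?exprn_gt0 //.
  have : 0 <= L * tau ^+ 3 by rewrite mulr_ge0 // exprn_ge0 // ltW.
  have : L * tau ^+ 2 <= tau ^+ 2 by rewrite ler_piMl // exprn_ge0 // ltW.
  by lra.
have : 0 < tau ^+ 2 * n ^+ 3 by rewrite mulr_gt0 // exprn_gt0.
move: big le4 le5.
have -> : tau / 3 * n * ((L - tau) * n ^+ 2) = (L * tau * n ^+ 3 - tau ^+ 2 * n ^+ 3) / 3.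
  by field.
rewrite mulrBl.
lra.
Qed.

End LowDegree.

(** * Transversals by counting *)

Section Selection.
Variables (R : realType) (V C : finType).

(** A uniform random function takes independent uniform values at three distinct
    arguments. Clearing the denominator avoids the exponent #|C| - 3. *)
Lemma sum_ffun_at3 (a b d : C) (F : V -> V -> V -> R) :
  a != b -> a != d -> b != d ->
  (\sum_(f : {ffun C -> V}) F (f a) (f b) (f d)) * #|V|%:R ^+ 3 =
  #|V|%:R ^+ #|C| * \sum_u \sum_v \sum_w F u v w.
Proof.
move=> ab ad bd.
pose K (u v w : V) (x : C) (y : V) : R := if x == a then (y == u)%:R else
  if x == b then (y == v)%:R else if x == d then (y == w)%:R else 1.
have pick (z : V) (G : V -> R) : \sum_y (y == z)%:R * G y = G z.
  by rewrite (bigD1 z) //= eqxx mul1r big1 ?addr0 // => y /negPf->; rewrite mul0r.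
have pick1 (z : V) : \sum_y (y == z)%:R = 1 :> R.
  by rewrite -[RHS](pick z (fun=> 1)); apply: eq_bigr => y _; rewrite mulr1.
have KE u v w (f : {ffun C -> V}) : \prod_x K u v w x (f x) =
    (f a == u)%:R * ((f b == v)%:R * (f d == w)%:R).
  rewrite (bigD1 a) //= {1}/K eqxx; congr (_ * _).
  rewrite (bigD1 b) /=; last by rewrite eq_sym.
  rewrite {1}/K [b == a]eq_sym (negPf ab) eqxx; congr (_ * _).
  rewrite (bigD1 d) /=; last by rewrite ![d == _]eq_sym ad bd.
  rewrite {1}/K ![d == _]eq_sym (negPf ad) (negPf bd) eqxx big1 ?mulr1 //.
  by move=> x /andP[/andP[xa xb] xd]; rewrite /K (negPf xa) (negPf xb) (negPf xd).
have cS : #|[set a; b; d]| = 3%N.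
  by rewrite finset.setUC cardsU1 cards2 !inE ![d == _]eq_sym (negPf ad) (negPf bd) ab.
have KS u v w : (\sum_(f : {ffun C -> V}) \prod_x K u v w x (f x)) * #|V|%:R ^+ 3
    = #|V|%:R ^+ #|C|.
  rewrite -bigA_distr_bigA /=.
  have -> : \prod_x \sum_y K u v w x y = \prod_(x in ~: [set a; b; d]) #|V|%:R.
    rewrite [RHS]big_mkcond; apply: eq_bigr => x _; rewrite !inE /K.
    case: (x == a) => /=; first exact: pick1.
    case: (x == b) => /=; first exact: pick1.
    case: (x == d) => /=; first exact: pick1.
    by rewrite sumr_const.
  by rewrite prodr_const -exprD -cS addnC cardsC.
transitivity (\sum_u \sum_v \sum_w F u v w *
    ((\sum_(f : {ffun C -> V}) \prod_x K u v w x (f x)) * #|V|%:R ^+ 3)).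
  under [RHS]eq_bigr do under eq_bigr do under eq_bigr do rewrite mulrA mulr_sumr.
  under [RHS]eq_bigr do under eq_bigr do rewrite -mulr_suml.
  under [RHS]eq_bigr do rewrite -mulr_suml.
  rewrite -mulr_suml; congr (_ * _).
  under [RHS]eq_bigr do under eq_bigr do rewrite exchange_big.
  under [RHS]eq_bigr do rewrite exchange_big.
  rewrite exchange_big; apply: eq_bigr => f _ /=.
  symmetry; transitivity (\sum_u (u == f a)%:R * (\sum_v (v == f b)%:R *
      (\sum_w (w == f d)%:R * F u v w))); last by rewrite !pick.
  apply: eq_bigr => u _; rewrite mulr_sumr; apply: eq_bigr => v _.
  rewrite !mulr_sumr; apply: eq_bigr => w _.
  by rewrite KE !(eq_sym (f _)) mulrC !mulrA.
rewrite mulr_sumr; apply: eq_bigr => u _; rewrite mulr_sumr; apply: eq_bigr => v _.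
by rewrite mulr_sumr; apply: eq_bigr => w _; rewrite KS mulrC.
Qed.

(** A union bound: a random function with values in A a at a violates a given
    constraint with probability at most theta, relative to all functions, and
    there are at most #|C| ^ 3 constraints. Multiplying out the sizes of the A a
    shows that a larger proportion of all functions is admissible. *)
Lemma transversal (A : C -> {set V}) (B : C -> C -> C -> V -> V -> V -> bool)
    (c theta : R) :
  (0 < #|V|)%N -> 0 <= c -> 0 <= theta ->
  (forall a, c * #|V|%:R <= #|A a|%:R) ->
  (forall a b d, a != b -> a != d -> b != d ->
    \sum_u \sum_v \sum_w (B a b d u v w)%:R <= theta * #|V|%:R ^+ 3 :> R) ->
  #|C|%:R ^+ 3 * theta < c ^+ #|C| ->
  exists f : C -> V, (forall a, f a \in A a) /\
    (forall a b d, a != b -> a != d -> b != d -> ~~ B a b d (f a) (f b) (f d)).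
Proof.
move=> V0 c0 th0 hA hB small.
have [[f [fA fB]]|no] := pselect (exists f : {ffun C -> V},
  (forall a, f a \in A a) /\ (forall a b d, a != b -> a != d -> b != d ->
   ~~ B a b d (f a) (f b) (f d))); first by exists f.
exfalso; move: small; apply/negP; rewrite -leNgt.
set n : R := #|V|%:R.
have n0 : 0 < n by rewrite ltr0n.
pose dist a b d : bool := [&& a != b :> C, a != d & b != d].
have le1 (f : {ffun C -> V}) : \prod_a (f a \in A a)%:R <=
    \sum_a \sum_b \sum_d (dist a b d && B a b d (f a) (f b) (f d))%:R :> R.
  have nn a b d : 0 <= (dist a b d && B a b d (f a) (f b) (f d))%:R :> R by [].
  have [/forallP fA|/forallPn[a fa]] := boolP [forall a, f a \in A a]; last first.
    rewrite (bigD1 a) //= (negPf fa) mul0r.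
    by do 3!(apply: sumr_ge0 => ? _).
  rewrite big1 => [|a _]; last by rewrite fA.
  have : exists a b d, dist a b d && B a b d (f a) (f b) (f d).
    apply: contrapT => H; apply: no; exists f; split=> // a b d ab ad bd.
    by apply/negP => hb; apply: H; exists a, b, d; rewrite /dist ab ad bd.
  move=> [a [b [d H]]].
  rewrite (bigD1 a) //= (bigD1 b) //= (bigD1 d) //= H.
  rewrite -!addrA lerDl !addr_ge0 //; do 3?(apply: sumr_ge0 => ? _) => //.
have : \sum_(f : {ffun C -> V}) \prod_a (f a \in A a)%:R <= \sum_(f : {ffun C -> V})
    \sum_a \sum_b \sum_d (dist a b d && B a b d (f a) (f b) (f d))%:R :> R.
  by apply: ler_sum => f _; exact: le1.
have -> : \sum_(f : {ffun C -> V}) \prod_a (f a \in A a)%:R =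
    \prod_a \sum_(y in V) (y \in A a)%:R :> R.
  by rewrite bigA_distr_bigA.
move=> le2.
have le3 : (c * n) ^+ #|C| <= \prod_a \sum_(y in V) (y \in A a)%:R.
  rewrite -[X in _ ^+ X]cardsT -prodr_const.
  rewrite [X in X <= _](eq_bigl predT); last by move=> x; rewrite inE.
  apply: ler_prod => a _; rewrite mulr_ge0 ?(ltW n0) //=.
  apply: le_trans (hA a) _; rewrite -sum1_card natr_sum [leLHS]big_mkcond.
  by apply: ler_sum => y _ /=; case: (y \in A a).
have {le2 le3} := le_trans le3 le2.
rewrite exchange_big /=; under eq_bigr do rewrite exchange_big /=.
under eq_bigr do under eq_bigr do rewrite exchange_big /=.
move=> le4.
have : (c * n) ^+ #|C| * n ^+ 3 <= \sum_(a : C) \sum_(b : C) \sum_(d : C)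
    theta * n ^+ 3 * n ^+ #|C|.
  have {}le4 := ler_wpM2r (ltW (exprn_gt0 3 n0)) le4; apply: le_trans le4 _.
  rewrite mulr_suml; apply: ler_sum => a _; rewrite mulr_suml; apply: ler_sum => b _.
  rewrite mulr_suml; apply: ler_sum => d _.
  have [/and3P[ab ad bd]|nd] := boolP (dist a b d); last first.
    rewrite big1 ?mul0r; last by move=> f _.
    by rewrite !mulr_ge0 // exprn_ge0 // ltW.
  rewrite /= (sum_ffun_at3 (fun u v w => (B a b d u v w)%:R)) // mulrC.
  by rewrite ler_pM2r ?exprn_gt0 //; exact: hB.
rewrite !sumr_const exprMn -!mulrnA -[in leRHS]mulr_natl mulrAC.
rewrite [leRHS](_ : _ = #|C|%:R ^+ 3 * theta * n ^+ 3 * n ^+ #|C|); last first.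
  by rewrite !natrM; ring.
rewrite ler_pM2r ?exprn_gt0 // ler_pM2r ?exprn_gt0 //.
Qed.

End Selection.

(** * Extremal families of patterns *)

Lemma le_of_eq (R : realType) (x y : R) : x = y -> x <= y.
Proof. by move->. Qed.

Section Rigid.
Variables (C : finType) (g : C -> C -> C -> bool).
Hypothesis gT : triple_system g.
Hypothesis gcov : forall a b, a != b -> adjacent g a b.

(** Two adjacent vertices cannot have the same image, and any two distinct
    vertices are adjacent. *)
Lemma hom_inj (U : Type) (q : U -> U -> U -> bool) (s : C -> U) :
  (forall b d, q b b d = false) ->
  (forall a b d, g a b d -> q (s a) (s b) (s d)) -> injective s.
Proof.
move=> qxx hs a b e; apply/eqP/negPn/negP => ab.
by have /existsP[d /hs] := gcov ab; rewrite e qxx.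
Qed.

(** An injective map of the finite set of edges into itself is onto. *)
Lemma endo_auto (s : C -> C) :
  (forall a b d, g a b d -> g (s a) (s b) (s d)) ->
  forall a b d, g (s a) (s b) (s d) = g a b d.
Proof.
move=> hs a b d; apply/idP/idP; last exact: hs.
have sI : injective s by apply: hom_inj hs => *; exact: (tsxx gT).
pose E := [set p : C * C * C | g p.1.1 p.1.2 p.2].
pose s3 (p : C * C * C) := (s p.1.1, s p.1.2, s p.2).
have s3I : injective s3 by move=> [[? ?] ?] [[? ?] ?] [] /sI-> /sI-> /sI->.
have sE : s3 @: E \subset E.
  by apply/fintype.subsetP => _ /imsetP[p pE ->]; move: pE; rewrite !inE; exact: hs.
have /eqP eE : s3 @: E == E by rewrite eqEcard sE card_imset /=.
move=> gs; have : s3 (a, b, d) \in s3 @: E by rewrite eE inE.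
by rewrite mem_imset // inE.
Qed.

End Rigid.

(** The field [ep_le] is homogeneous of degree three, so that it applies to
    weightings of any total weight; [ep_modulus] is the quantitative form of the
    uniqueness of the maximizer and allows total weight below 1, because
    color classes of a partially colored 3-graph do not exhaust its vertices. *)
Record extremal_patterns (R : realType) (J : Type) (C : finType)
    (g : J -> C -> C -> C -> bool) (L : R) (xs : J -> C -> R) : Prop := {
  ep_ts : forall j, triple_system (g j);
  ep_cover : forall j a b, a != b -> adjacent (g j) a b;
  ep_hom : forall i j (s : C -> C),
    (forall a b d, g i a b d -> g j (s a) (s b) (s d)) -> i = j;
  ep_L : 0 < L <= 1;
  ep_le : forall j (x : C -> R), (forall a, 0 <= x a) ->
    lagrangian (g j) x <= L * (\sum_a x a) ^+ 3;
  ep_pos : exists2 c : R, 0 < c & forall j a, c <= xs j a;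
  ep_sum : forall j, \sum_a xs j a = 1;
  ep_opt : forall j, lagrangian (g j) (xs j) = L;
  ep_modulus : forall eta : R, 0 < eta -> exists2 eps : R, 0 < eps &
    forall j (x : C -> R), (forall a, 0 <= x a) -> \sum_a x a <= 1 ->
    L - eps <= lagrangian (g j) x -> forall a, `|x a - xs j a| <= eta }.

Section Stability.
Variables (R : realType) (J : Type) (C : finType) (g : J -> C -> C -> C -> bool).
Variables (L : R) (xs : J -> C -> R).
Hypothesis gP : extremal_patterns g L xs.

Let gT := ep_ts gP.
Let L0 : 0 <= L. Proof. by case/andP: (ep_L gP) => /ltW. Qed.
Let L1 : L <= 1. Proof. by case/andP: (ep_L gP). Qed.
Let gL := ep_le gP.
Let xs_sum := ep_sum gP.
Let xs_opt := ep_opt gP.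

Lemma xs_ge0 j a : 0 <= xs j a.
Proof. by case: (ep_pos gP) => c c0 /(_ j a); apply: le_trans; exact: ltW. Qed.

Lemma le_total (x : C -> R) a : (forall a, 0 <= x a) -> x a <= \sum_b x b.
Proof. by move=> x0; rewrite (bigD1 a) //= lerDl sumr_ge0. Qed.

(** Otherwise increasing the weight of a would beat the homogeneous bound, as
    the form is affine in a single weight. *)
Lemma link_opt j a : link_form (g j) (xs j) a <= L.
Proof.
apply/ler_addgt0Pr => e e0.
pose s := Num.min 1 e / 2.
have [m0 m1 me] : [/\ 0 < Num.min 1 e, Num.min 1 e <= 1 & Num.min 1 e <= e].
  by rewrite lt_min ltr01 e0 !ge_min !lexx orbT.
have s0 : 0 < s by rewrite divr_gt0.
have sE : 2 * s = Num.min 1 e by rewrite /s; field.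
clearbody s.
pose p b := s * (b == a)%:R.
have p0 b : 0 <= p b by rewrite mulr_ge0 // ltW.
have pick (F : C -> R) : \sum_b p b * F b = s * F a.
  rewrite (bigD1 a) //= /p eqxx mulr1 big1 ?addr0 // => b /negPf->.
  by rewrite mulr0 mul0r.
have le1 : L + 3 * (s * link_form (g j) (xs j) a) <=
    lagrangian (g j) (fun b => xs j b + p b).
  rewrite -pick -[X in X + _](xs_opt j).
  apply: (lagrangian_tangent (gT j) (xs_ge0 j)) => [b|b d].
    by rewrite addr_ge0 ?xs_ge0.
  by rewrite mulr_ge0.
have := gL j (x := fun b => xs j b + p b).
have -> : \sum_b (xs j b + p b) = 1 + s.
  rewrite big_split /= xs_sum; congr (_ + _).
  by rewrite -[RHS]mulr1 -(pick (fun=> 1)); apply: eq_bigr => b _; rewrite mulr1.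
move=> le2.
have {le2} le3 : L + 3 * (s * link_form (g j) (xs j) a) <= L * (1 + s) ^+ 3.
  by apply: le_trans le1 _; apply: le2 => b; rewrite addr_ge0 ?xs_ge0.
have s1 : s <= 1 by lra.
have : s * (link_form (g j) (xs j) a - L) <= s * (s + s ^+ 2 / 3).
  have : L * (3 * s ^+ 2 + s ^+ 3) <= 3 * s ^+ 2 + s ^+ 3.
    have s0' := ltW s0.
    by rewrite ler_piMl // addr_ge0 ?mulr_ge0 ?exprn_ge0.
  move: le3; have -> : L * (1 + s) ^+ 3 =
    L + 3 * (L * s) + L * (3 * s ^+ 2 + s ^+ 3) by ring.
  move=> le3 le4; have -> : s * (s + s ^+ 2 / 3) = (3 * s ^+ 2 + s ^+ 3) / 3 by field.
  by rewrite mulrBr; lra.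
rewrite ler_pM2l // => le4.
have : s ^+ 2 <= s by rewrite expr2 ler_piMl // ltW.
by lra.
Qed.

Lemma link_near j (x : C -> R) (eta : R) a : (forall b, 0 <= x b) -> \sum_b x b <= 1 ->
  0 <= eta -> (forall b, `|x b - xs j b| <= eta) ->
  link_form (g j) x a <= L + 2 * #|C|%:R ^+ 2 * eta.
Proof.
move=> x0 x1 eta0 xn; apply: (@le_trans _ _ (link_form (g j) (xs j) a +
    \sum_(b : C) \sum_(d : C) 2 * eta)); last first.
  rewrite !sumr_const lerD ?link_opt // -mulrnA -[leLHS]mulr_natl natrM.
  by apply: le_of_eq; ring.
rewrite !link_formE -big_split; apply: ler_sum => b _ /=.
rewrite -big_split; apply: ler_sum => d _ /=.
case: (g j a b d); rewrite !(mulr1, mulr0) ?add0r ?mulr_ge0 // -lerBlDl.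
have -> : x b * x d - xs j b * xs j d = x b * (x d - xs j d) + xs j d * (x b - xs j b).
  by ring.
have xb1 : x b <= 1 by apply: le_trans x1; exact: le_total.
have xd1 : xs j d <= 1 by rewrite -(xs_sum j); apply: le_total; exact: xs_ge0.
have bnd y z : 0 <= y -> y <= 1 -> `|z| <= eta -> y * z <= eta.
  move=> y0 y1 zeta; apply: le_trans (_ : `|z| <= _) => //.
  apply: le_trans (ler_norm _) _; rewrite normrM ger0_norm //.
  by rewrite ler_piMl.
have -> : 2 * eta = eta + eta by ring.
by rewrite lerD ?bnd ?xs_ge0.
Qed.

Section Vertices.
Variables (V : finType) (h : V -> V -> V -> bool).
Hypothesis hT : triple_system h.
Hypothesis hL : locally_colorable g (local_size C) h.

Let n : R := #|V|%:R.

Definition indic (W : {set V}) (u : V) : R := (u \in W)%:R.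

Lemma sum_indic W : \sum_u indic W u = #|W|%:R.
Proof.
rewrite -sum1_card natr_sum [RHS]big_mkcond.
by apply: eq_bigr => u _; rewrite /indic; case: (u \in W).
Qed.

Lemma card_setC_R (W : {set V}) : #|W|%:R = n - #|~: W|%:R :> R.
Proof. by rewrite /n -(cardsC W) natrD addrK. Qed.

Lemma link_indic_ge W u :
  deg2 R h u - 2 * #|~: W|%:R * n <= link_form h (indic W) u.
Proof.
have s1 : \sum_v \sum_(w : V) indic (~: W) v = #|~: W|%:R * n.
  by under eq_bigr do rewrite sumr_const -mulr_natr; rewrite -mulr_suml sum_indic.
have s2 : \sum_(v : V) \sum_w indic (~: W) w = #|~: W|%:R * n.
  by rewrite exchange_big.
rewrite [2 * _ * _](_ : _ = #|~: W|%:R * n + #|~: W|%:R * n); last by ring.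
rewrite -{1}s1 -s2 deg2E link_formE -!big_split -sumrB; apply: ler_sum => v _ /=.
rewrite -big_split -sumrB; apply: ler_sum => w _ /=.
rewrite /indic !inE; case: (v \in W); case: (w \in W); case: (h u v w) => /=; lra.
Qed.

Section Class.
Variables (W : {set V}) (j : J) (phi : V -> C) (tau : R).
Hypotheses (n0 : 0 < n) (tau0 : 0 < tau).
Hypothesis Wdeg : forall u, u \in W -> (L - tau) * n ^+ 2 <= deg2 R h u.
Hypothesis Wbig : #|~: W|%:R <= tau * n.
Hypothesis Wcol : colors g h W j phi.

Definition class_weight (a : C) : R := n^-1 * push phi (indic W) a.

Lemma class_weight_ge0 a : 0 <= class_weight a.
Proof. by rewrite mulr_ge0 ?invr_ge0 ?push_ge0 // ltW. Qed.

Lemma class_weight_sum : \sum_a class_weight a <= 1.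
Proof.
rewrite -mulr_sumr total_push sum_indic mulrC ler_pdivrMr // mul1r ler_nat.
exact: max_card.
Qed.

Lemma link_indic_deg u : u \in W ->
  (L - 3 * tau) * n ^+ 2 <= link_form h (indic W) u.
Proof.
move=> uW; apply: le_trans (link_indic_ge W u); have := Wdeg uW.
have : #|~: W|%:R * n <= tau * n * n by rewrite ler_pM2r.
by rewrite expr2; lra.
Qed.

(** Few vertices are uncolored and the colored ones have almost maximal degree,
    so the colored part has almost the maximal number of edges. *)
Lemma class_weight_opt : L - 4 * tau <= lagrangian (g j) class_weight.
Proof.
rewrite lagrangianZ lagrangian_push exprVn ler_pdivlMl ?exprn_gt0 //.
apply: le_trans (_ : lagrangian h (indic W) <= _); last first.
  apply: ler_lagrangian => // u v w; rewrite /indic !ltr0n !lt0b.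
  exact: Wcol.
apply: le_trans (_ : \sum_u indic W u * ((L - 3 * tau) * n ^+ 2) <= _); last first.
  apply: ler_sum => u _; rewrite /indic; case: (boolP (u \in W)) => uW.
    by rewrite !mul1r link_indic_deg.
  by rewrite !mul0r.
rewrite -mulr_suml sum_indic card_setC_R mulrA.
have -> : n ^+ 3 * (L - 4 * tau) = n * (L - 4 * tau) * n ^+ 2 by ring.
rewrite ler_pM2r ?exprn_gt0 //.
have [pos|neg] := lerP 0 (L - 3 * tau).
  apply: le_trans (_ : (n - tau * n) * (L - 3 * tau) <= _).
    have : tau * n * L <= tau * n by rewrite ler_piMr // mulr_ge0 // ltW.
    have : 0 <= tau * tau * n by rewrite !mulr_ge0 // ltW.
    by lra.
  by rewrite ler_wpM2r // lerD2l lerN2.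
apply: le_trans (_ : n * (L - 3 * tau) <= _).
  by rewrite ler_pM2l // lerD2l lerN2 ler_pM2r // ler_nat.
by rewrite ler_wnM2r ?(ltW neg) // gerDl oppr_le0.
Qed.

Definition missing u v w := [&& v \in W, w \in W, g j (phi u) (phi v) (phi w) & ~~ h u v w].

(** The pattern allows at most about L n^2 ordered pairs in the link of u, since
    the class weights are nearly optimal, and nearly all of these must be present
    to reach the degree of u. *)
Lemma few_missing (eta : R) u : u \in W -> 0 <= eta ->
  (forall a, `|class_weight a - xs j a| <= eta) ->
  \sum_v \sum_w (missing u v w)%:R <=
    (2 * #|C|%:R ^+ 2 * eta + 3 * tau) * n ^+ 2.
Proof.
move=> uW eta0 near.
have := link_near (phi u) class_weight_ge0 class_weight_sum eta0 near.
rewrite link_formZ link_form_push exprVn mulrC ler_pdivrMr ?exprn_gt0 // => le1.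
have -> : \sum_v \sum_w (missing u v w)%:R =
    link_form (pull phi (g j)) (indic W) u - link_form h (indic W) u.
  rewrite !link_formE -sumrB; apply: eq_bigr => v _; rewrite -sumrB.
  apply: eq_bigr => w _; rewrite /missing /indic /pull.
  case: (boolP (v \in W)) => vW; last by rewrite !mul0r subrr.
  case: (boolP (w \in W)) => wW; last by rewrite mulr0 !mul0r subrr.
  have := Wcol uW vW wW; rewrite !mul1r.
  by case: (h u v w) => [->//|_]; rewrite /= ?subrr ?subr0 ?andbT.
by have := link_indic_deg uW; rewrite !mulrDl in le1 *; rewrite mulNr; lra.
Qed.

End Class.
End Vertices.
End Stability.

(** * Extending a coloring by one vertex *)

Section Extension.
Variables (R : realType) (J : Type) (C : finType) (g : J -> C -> C -> C -> bool).
Variables (L : R) (xs : J -> C -> R).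
Hypothesis gP : extremal_patterns g L xs.

(** The set S colors by some pattern i; restricted to the copy f of pattern j this
    is a homomorphism, hence i = j and it is an automorphism, which can be undone.
    A vertex y attached to the whole link of b then cannot have a color d <> b,
    because b and d lie in a common edge of the pattern, which would force an edge
    through d twice. *)
Lemma core_forces_color (V : finType) (h : V -> V -> V -> bool) (S : {set V})
    (j : J) (f : C -> V) :
  colorable_on g h S -> (forall a, f a \in S) ->
  (forall a b d, g j a b d -> h (f a) (f b) (f d)) ->
  exists2 psi : V -> C, forall u v w, u \in S -> v \in S -> w \in S ->
      h u v w -> g j (psi u) (psi v) (psi w)
    & forall y b, y \in S -> (forall a d, g j b a d -> h y (f a) (f d)) ->
      psi y = b.
Proof.
have gT := ep_ts gP; have gcov := ep_cover gP.
move=> [i [psi col]] fS fh.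
have shom a b d : g j a b d -> g i (psi (f a)) (psi (f b)) (psi (f d)).
  by move/fh; apply: col.
have ij := ep_hom gP shom; subst i.
have sinj : injective (psi \o f).
  by apply: (hom_inj (gcov j)) shom => b d; exact: (tsxx (gT j)).
have sauto := endo_auto (gT j) (gcov j) (s := psi \o f) shom.
have [t tK Kt] := injF_bij sinj.
have tE a b d : g j (t a) (t b) (t d) = g j a b d by rewrite -sauto !Kt.
exists (t \o psi) => [u v w uS vS wS huvw /=|y b yS hy /=].
  by rewrite tE; exact: col.
apply/eqP/negPn/negP; rewrite eq_sym => nb.
have /existsP[d gd] := gcov j _ _ nb.
have := col _ _ _ yS (fS _) (fS _) (hy _ _ gd).
by have /= -> := Kt (psi y); rewrite (tsxx (gT j)).
Qed.

(** If no color a fits v, choose for each a an edge v y z that refutes it. A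
    transversal copy of the pattern to which all these y and z are attached as
    their colors demand exists by counting missing edges. Coloring this bounded
    configuration gives y and z their old colors and v some color a, against the
    refuting edge for a. *)
Lemma extension : exists2 tau : R, 0 < tau &
  forall (V : finType) (h : V -> V -> V -> bool), triple_system h ->
  locally_colorable g (local_size C) h -> (0 < #|V|)%N ->
  forall (W : {set V}) v j phi, v \notin W ->
  (forall u, u \in W -> (L - tau) * #|V|%:R ^+ 2 <= deg2 R h u) ->
  #|~: W|%:R <= tau * #|V|%:R ->
  colors g h W j phi -> exists phi', colors g h (v |: W) j phi'.
Proof.
have gT := ep_ts gP; have [c c0 cxs] := ep_pos gP.
set k : R := #|C|%:R.
have k0 : 0 <= k by [].
have kp m : 0 < 4 * (k + 1) ^+ m by rewrite mulr_gt0 // exprn_gt0 // ltr_wpDl.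
(* Two families of constraints, of total density (2 k + 1) theta for each of the
   at most k ^ 3 triples of colors, must leave a transversal of parts of
   density c / 2. *)
have [theta [theta0 thetaE]] : exists theta, 0 < theta /\
    theta = (c / 2) ^+ #|C| / (4 * (k + 1) ^+ 4).
  exists ((c / 2) ^+ #|C| / (4 * (k + 1) ^+ 4)); split=> //.
  by rewrite divr_gt0 ?kp // exprn_gt0 // divr_gt0.
pose eta : R := Num.min (c / 2) (theta / (4 * (k + 1) ^+ 2)).
have eta0 : 0 < eta.
  by rewrite lt_min (divr_gt0 theta0 (kp 2)) divr_gt0.
have eta_c : eta <= c / 2 by rewrite ge_min lexx.
have eta_th : 2 * k ^+ 2 * eta <= theta / 2.
  have : eta <= theta / (4 * (k + 1) ^+ 2) by rewrite ge_min lexx orbT.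
  rewrite ler_pdivlMr; last exact: kp.
  have : 0 <= eta * (8 * k + 4) by rewrite mulr_ge0 ?addr_ge0 ?mulr_ge0 // (ltW eta0).
  move=> h1 h2; have : eta * (4 * (k + 1) ^+ 2) = 4 * k ^+ 2 * eta + eta * (8 * k + 4) by ring.
  lra.
have [eps eps0 mod] := ep_modulus gP eta0.
pose tau : R := Num.min (theta / 6) (eps / 4).
have tau0 : 0 < tau by rewrite lt_min (divr_gt0 theta0) // divr_gt0.
have tau_th : 3 * tau <= theta / 2.
  by have : tau <= theta / 6; [rewrite ge_min lexx|lra].
have tau_eps : 4 * tau <= eps.
  by have : tau <= eps / 4; [rewrite ge_min lexx orbT|lra].
clearbody eta tau; exists tau => // V h hT hL V0 W v0 j phi v0W Wdeg Wbig Wcol.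
set n : R := #|V|%:R in Wdeg Wbig.
have n0 : 0 < n by rewrite ltr0n.
have near a : `|class_weight R W phi a - xs j a| <= eta.
  apply: mod; [exact: class_weight_ge0 | exact: class_weight_sum |].
  apply: le_trans (class_weight_opt gP n0 tau0 Wdeg Wbig Wcol).
  by rewrite lerD2l lerN2.
have miss u : u \in W -> \sum_v \sum_w (missing g h W j phi u v w)%:R <= theta * n ^+ 2.
  move=> uW; have eta0' := ltW eta0.
  apply: le_trans (few_missing gP n0 Wdeg Wbig Wcol uW eta0' near) _.
  rewrite ler_pM2r ?exprn_gt0 // -/k; lra.
suff [a ha] : exists a, forall y z, y \in W -> z \in W -> h v0 y z -> g j a (phi y) (phi z).
  exists (fun u => if u == v0 then a else phi u) => u1 u2 u3.
  have wv u : u \in W -> (u == v0) = false.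
    by move=> uW; apply: contraNF v0W => /eqP <-.
  rewrite !inE => /predU1P[->|u1W] /predU1P[->|u2W] /predU1P[->|u3W];
    rewrite ?(tsxx hT) ?(tsxyx hT) ?(tsyxx hT) // ?eqxx ?wv //.
  - exact: ha.
  - by rewrite (ts12 hT) (ts12 (gT j)); exact: ha.
  - by rewrite (ts13 hT) (ts13 (gT j)); exact: ha.
  - exact: Wcol.
apply: contrapT => bad.
have {bad} /boolp.choice[Y hY] : forall a, exists p : V * V, [/\ p.1 \in W, p.2 \in W,
    h v0 p.1 p.2 & ~~ g j a (phi p.1) (phi p.2)].
  move=> a; apply: contrapT => H; apply: bad; exists a => y z yW zW hyz.
  by apply: contrapT => /negP ng; apply: H; exists (y, z).
pose mis := missing g h W j phi.
(* The pairs that y and z miss do not involve the third color d; they are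
   constraints on triples all the same, to be treated together with the edges
   that the core itself misses. *)
pose B (a b d : C) u v w := (u \in W) && mis u v w ||
  [exists e, mis (Y e).1 u v || mis (Y e).2 u v].
have [|||a b d _ _ _||f [fW fB]] := @transversal R V C
    (fun a => [set u in W | phi u == a]) B (c / 2) ((2 * k + 1) * theta) V0.
- by rewrite divr_ge0 // ltW.
- by rewrite mulr_ge0 ?addr_ge0 ?mulr_ge0 // (ltW theta0).
- move=> a; have : c / 2 <= class_weight R W phi a.
    have := near a; rewrite ler_norml => /andP[]; have := cxs j a.
    by lra.
  rewrite /class_weight ler_pdivlMl // mulrC => /le_trans; apply.
  rewrite /push -sum1_card natr_sum [leRHS]big_mkcond [leLHS]big_mkcond.
  apply: ler_sum => u _; rewrite inE /indic andbC.
  by case: (phi u == a); case: (u \in W).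
- pose F e u v : R := (mis (Y e).1 u v)%:R + (mis (Y e).2 u v)%:R.
  apply: (@le_trans _ _ (\sum_(u in W) \sum_v \sum_w (mis u v w)%:R +
    \sum_u \sum_v \sum_(w : V) \sum_e F e u v)).
    rewrite [X in _ <= X + _]big_mkcond -big_split; apply: ler_sum => u _ /=.
    rewrite [X in _ <= X + _](_ : _ = \sum_v \sum_w ((u \in W) && mis u v w)%:R); last first.
      by case: (u \in W) => //=; rewrite big1 // => ? _; rewrite big1.
    rewrite -big_split; apply: ler_sum => v _ /=.
    rewrite -big_split; apply: ler_sum => w _ /=.
    rewrite /B; have [//|_] := boolP ((u \in W) && mis u v w).
      by rewrite lerDl sumr_ge0 // => e _; rewrite addr_ge0.
    rewrite orFb -[leLHS]add0r lerD //.
    have [/existsP[e he]|_] := boolP [exists e, mis (Y e).1 u v || mis (Y e).2 u v]; last first.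
      by rewrite sumr_ge0 // => e _; rewrite addr_ge0.
    rewrite (bigD1 e) //=; apply: (@le_trans _ _ (F e u v)).
      by rewrite /F; case/orP: he => ->; rewrite ?lerDl ?lerDr.
    by rewrite lerDl sumr_ge0 // => ? _; rewrite addr_ge0.
  have le1 : \sum_(u in W) \sum_v \sum_w (mis u v w)%:R <= theta * n ^+ 3.
    apply: le_trans (_ : \sum_(u in W) theta * n ^+ 2 <= _).
      by apply: ler_sum => u uW; exact: miss.
    rewrite sumr_const -[leLHS]mulr_natr [n ^+ 3]exprSr [leRHS]mulrA ler_wpM2l //.
      by rewrite mulr_ge0 ?exprn_ge0 ?(ltW theta0).
    by rewrite ler_nat max_card.
  have le2 : \sum_u \sum_v \sum_(w : V) \sum_e F e u v <= 2 * k * theta * n ^+ 3.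
    under eq_bigr do under eq_bigr do rewrite exchange_big /=.
    under eq_bigr do rewrite exchange_big /=.
    rewrite exchange_big /=; apply: (@le_trans _ _ (\sum_(e : C) 2 * theta * n ^+ 3)).
      apply: ler_sum => e _; have [y1 y2 _ _] := hY e.
      under eq_bigr do under eq_bigr do rewrite sumr_const -mulr_natr.
      under eq_bigr do rewrite -mulr_suml big_split.
      rewrite -mulr_suml big_split [n ^+ 3]exprSr [leRHS]mulrA ler_wpM2r //=.
      by have := miss _ y1; have := miss _ y2; rewrite -/mis -mulrA; lra.
    by rewrite sumr_const -[leLHS]mulr_natl; apply: le_of_eq; rewrite /k; ring.
  by rewrite mulrDl mul1r mulrDl; lra.
- rewrite -/k; have -> : k ^+ 3 * ((2 * k + 1) * theta) = (k ^+ 3 * (2 * k + 1)) / (4 * (k + 1) ^+ 4) * (c / 2) ^+ #|C|.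
    by rewrite thetaE; field; rewrite gt_eqF // ltr_wpDl.
  rewrite -[ltRHS]mul1r ltr_pM2r ?exprn_gt0 ?divr_gt0 //.
  rewrite ltr_pdivrMr; last exact: kp.
  rewrite mul1r -subr_gt0.
  have -> : 4 * (k + 1) ^+ 4 - k ^+ 3 * (2 * k + 1) =
     4 + 16 * k + 24 * k ^+ 2 + 15 * k ^+ 3 + 2 * k ^+ 4 by ring.
  by rewrite !ltr_wpDr ?mulr_ge0 ?exprn_ge0.
have fW' a : f a \in W by have := fW a; rewrite inE => /andP[].
have ff a : phi (f a) = a by have := fW a; rewrite inE => /andP[_ /eqP].
have fh a b d : g j a b d -> h (f a) (f b) (f d).
  move=> gabd; have [ab ad bd] := ts_neq (gT j) gabd.
  have := fB _ _ _ ab ad bd; rewrite /B negb_or => /andP[+ _].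
  by rewrite fW' /mis /missing !fW' !ff gabd /= negbK.
(* The color of y serves as the third color; it differs from a and b since the
   triple is an edge of the pattern. *)
have att e y : y = (Y e).1 \/ y = (Y e).2 -> forall a b, g j (phi y) a b -> h y (f a) (f b).
  move=> yE a b gyab; have [ya yb ab] := ts_neq (gT j) gyab.
  have nb : ~~ mis y (f a) (f b).
    have ay : a != phi y by rewrite eq_sym.
    have by' : b != phi y by rewrite eq_sym.
    have := fB a b (phi y) ab ay by'; rewrite /B negb_or => /andP[_].
    by move/existsPn/(_ e); rewrite negb_or => /andP[]; case: yE => ->.
  by move: nb; rewrite /mis /missing !fW' !ff gyab /= negbK.
pose S := v0 |: ((f @: finset.setT) :|: (((fun e => (Y e).1) @: finset.setT) :|:
                ((fun e => (Y e).2) @: finset.setT))).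
have SN : (#|S| <= local_size C)%N.
  have ci (q : C -> V) : (#|q @: finset.setT| <= #|C|)%N.
    by rewrite -[leqRHS]cardsT leq_imset_card.
  apply: leq_trans (leq_card_setU _ _) _; rewrite cards1.
  apply: leq_trans (leq_add (leqnn _) (leq_card_setU _ _)) _.
  apply: leq_trans (leq_add (leqnn _) (leq_add (leqnn _) (leq_card_setU _ _))) _.
  have := ci f; have := ci (fun e => (Y e).1); have := ci (fun e => (Y e).2).
  have : (#|C| * 2 <= #|C| * #|C|.+2)%N by rewrite leq_mul2l orbT.
  by rewrite /local_size mulSn; clear; lia.
have fS a : f a \in S by rewrite !inE imset_f ?orbT.
have Y1S e : (Y e).1 \in S.
  by rewrite !inE (imset_f (fun e => (Y e).1)) ?orbT.
have Y2S e : (Y e).2 \in S.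
  by rewrite !inE (imset_f (fun e => (Y e).2)) ?orbT.
have [psi col fix_psi] := core_forces_color (hL S SN) fS fh.
have [_ _ hv ng] := hY (psi v0).
move/negP: ng; apply.
rewrite -(fix_psi (Y (psi v0)).1 (phi (Y (psi v0)).1)) //; last by apply: att; left.
rewrite -[phi (Y (psi v0)).2](fix_psi (Y (psi v0)).2) //; last by apply: att; right.
by apply: col => //; rewrite !inE eqxx.
Qed.

End Extension.

(** * Coloring the vertices of high degree *)

Section MainStability.
Variables (R : realType) (J : Type) (C : finType) (g : J -> C -> C -> C -> bool).
Variables (L : R) (xs : J -> C -> R).
Hypothesis gP : extremal_patterns g L xs.

(** Degrees are measured in the whole of V, so that membership does not change when
    the colored set grows. *)
Definition rich (V : finType) (h : V -> V -> V -> bool) (tau : R) : {set V} :=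
  [set u | (L - tau) * #|V|%:R ^+ 2 <= deg2 R h u].

Lemma size3_le (V : finType) (h : V -> V -> V -> bool) :
  triple_system h -> locally_colorable g (local_size C) h ->
  size3 R h <= L * #|V|%:R ^+ 3.
Proof.
move=> hT hL; have := lagrangian_le (ep_ts gP) hT hL (ep_le gP) (x := fun=> 1).
by rewrite sumr_const; apply=> u.
Qed.

Lemma few_poor (V : finType) (h : V -> V -> V -> bool) (tau : R) :
  triple_system h -> locally_colorable g (local_size C) h -> 0 < tau ->
  (L - tau ^+ 2 / 2) * #|V|%:R ^+ 3 <= size3 R h ->
  #|~: rich h tau|%:R <= tau / 3 * #|V|%:R.
Proof.
move=> hT hL tau0 big; have /andP[/ltW L0 L1] := ep_L gP.
have -> : ~: rich h tau = [set u | deg2 R h u < (L - tau) * #|V|%:R ^+ 2].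
  by apply/setP => u; rewrite !inE ltNge.
apply: (few_low_degree hT L0 L1 tau0) => // x x0.
exact: (lagrangian_le (ep_ts gP) hT hL (ep_le gP)).
Qed.

(** The symmetrized end of the chain is colorable outright. One step back, the
    rich vertices common to both stages, without the cloned vertex, are colored
    alike; the remaining rich vertices are added one by one. *)
Lemma rich_colorable : exists2 tau1 : R, 0 < tau1 &
  forall (tau : R) (V : finType) (h : V -> V -> V -> bool),
  0 < tau <= tau1 -> 3 <= tau * #|V|%:R ->
  triple_system h -> locally_colorable g (local_size C) h ->
  (L - tau ^+ 2 / 2) * #|V|%:R ^+ 3 <= size3 R h ->
  colorable_on g h (rich h tau).
Proof.
have [tau1 tau10 ext] := extension gP.
exists tau1 => // tau V h0 /andP[tau0 tauLe] n_big hT0 hL0.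
have V0 : (0 < #|V|)%N.
  rewrite lt0n; apply: contraTneq n_big => ->; rewrite mulr0 -ltNge.
  by rewrite ltr0n.
set n : R := #|V|%:R in n_big *.
have n0 : 0 < n by rewrite ltr0n.
pose good (h : V -> V -> V -> bool) := triple_system h /\ locally_colorable g (local_size C) h.
pose P (h : V -> V -> V -> bool) := (L - tau ^+ 2 / 2) * n ^+ 3 <= size3 R h ->
  colorable_on g h (rich h tau).
suff: P h0 by [].
apply: (@symmetrization_ind R V P good); last by split.
- by move=> h u v [hT hL]; split; [exact: triple_system_pull|exact: locally_colorable_pull].
- by move=> h [].
- move=> h [hT hL] hS _.
  have [j [phi col]] := symmetrized_colorable (ep_ts gP) hT hL hS.
  by exists j, phi => u1 u2 u3 _ _ _; apply: col.
move=> h u v [hT hL] uv nuv le_d IH big.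
have hT' : triple_system (clone u v h) by exact: triple_system_pull.
have hL' : locally_colorable g (local_size C) (clone u v h) by exact: locally_colorable_pull.
have big' : (L - tau ^+ 2 / 2) * n ^+ 3 <= size3 R (clone u v h).
  by apply: le_trans big _; rewrite size3_clone // lerDl mulr_ge0 // subr_ge0.
have [j [phi col]] := IH big'.
have few := few_poor hT hL tau0 big; have few' := few_poor hT' hL' tau0 big'.
rewrite -/n in few few'.
pose W0 := (rich h tau :&: rich (clone u v h) tau) :\ v.
have W0col : colors g h W0 j phi.
  move=> u1 u2 u3; rewrite !inE => /and3P[v1 _ r1] /and3P[v2 _ r2] /and3P[v3 _ r3] h123.
  apply: col; rewrite ?inE //.
  by rewrite /clone /pull (negPf v1) (negPf v2) (negPf v3).
have W0few : #|~: W0|%:R <= tau * n.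
  have : (#|~: W0| <= 1 + (#|~: rich h tau| + #|~: rich (clone u v h) tau|))%N.
    have -> : ~: W0 = v |: (~: rich h tau :|: ~: rich (clone u v h) tau).
      by apply/setP => x; rewrite !inE !negb_and negbK.
    apply: leq_trans (leq_card_setU _ _) _; rewrite cards1.
    by rewrite leq_add2l; exact: leq_card_setU.
  rewrite -(ler_nat R) !natrD; lra.
have W0sub : W0 \subset rich h tau by apply/fintype.subsetP => x; rewrite !inE => /and3P[].
move: W0 W0col W0few W0sub {col}; move=> W.
have [m] := ubnP #|rich h tau :\: W|; elim: m W phi => // m IHm W phi; rewrite ltnS => hm.
move=> Wcol Wfew Wsub.
have [e|[x xin]] := finset.set_0Vmem (rich h tau :\: W).
  exists j, phi => u1 u2 u3 r1 r2 r3; apply: Wcol; apply: contraT => nW.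
  - by rewrite -(finset.in_set0 u1) -e finset.in_setD nW.
  - by rewrite -(finset.in_set0 u2) -e finset.in_setD nW.
  - by rewrite -(finset.in_set0 u3) -e finset.in_setD nW.
have /andP[xW xr] : (x \notin W) && (x \in rich h tau) by rewrite -finset.in_setD.
have [y yW||phi' col'] := ext V h hT hL V0 W x j phi xW _ _ Wcol.
- have := fintype.subsetP Wsub y yW; rewrite inE; apply: le_trans.
  by rewrite ler_pM2r ?exprn_gt0 // lerD2l lerN2.
- by apply: le_trans Wfew _; rewrite ler_pM2r.
apply: (IHm (x |: W) phi') => //.
- apply: leq_trans hm; apply: proper_card; apply/properP; split.
    by apply: finset.setDS; exact: subsetU1.
  by exists x; rewrite !inE ?eqxx // xW; move: xr; rewrite inE.
- apply: le_trans Wfew; rewrite ler_nat; apply: subset_leq_card.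
  by rewrite finset.setCS subsetU1.
- by rewrite finset.subUset Wsub finset.sub1set xr.
Qed.

End MainStability.

(** * Hypergraphs as triple systems *)

Definition triples (V : finType) (E : {set {set V}}) (u v w : V) : bool :=
  [set u; v; w] \in E.

Lemma card_set3 (V : finType) (u v w : V) :
  (#|[set u; v; w]| == 3%N) = [&& u != v, u != w & v != w].
Proof.
rewrite finset.setUC cardsU1 cards2 !inE ![w == _]eq_sym.
by case: (u == v); case: (u == w); case: (v == w).
Qed.

Lemma set3C (V : finType) (u v w : V) : [set u; v; w] = [set v; u; w].
Proof. by rewrite (finset.setUC [set u]). Qed.

Lemma set3CA (V : finType) (u v w : V) : [set u; v; w] = [set u; w; v].
Proof. by rewrite -!finset.setUA (finset.setUC [set v]). Qed.

Lemma imset3 (V C : finType) (f : V -> C) u v w :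
  f @: [set u; v; w] = [set f u; f v; f w].
Proof. by rewrite !imsetU !imset_set1. Qed.

(** Fixing one element of a 3-set leaves two ordered ways to name the others, which
    is how degrees and ordered pairs in links are compared. *)
Lemma triple_setE (V : finType) (e : {set V}) u v w : #|e| = 3%N -> u \in e ->
  ([set u; v; w] == e) = (v \in e :\ u) && (w \in e :\ u :\ v).
Proof.
move=> e3 ue; apply/eqP/andP => [eE|[ve we]].
  have : #|[set u; v; w]| == 3%N by rewrite eE e3.
  rewrite card_set3 -eE !inE !eqxx !orbT => /and3P[uv uw vw].
  by rewrite ![_ == u]eq_sym [w == v]eq_sym uv uw vw.
have c1 : #|e :\ u :\ v| = 1%N.
  by move: e3; rewrite (cardsD1 u) ue (cardsD1 v) ve => -[].
have /eqP/cards1P[x ex] := c1.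
move: (we); rewrite ex inE => /eqP ->; rewrite -finset.setUA -ex.
by rewrite (finset.setD1K ve) (finset.setD1K ue).
Qed.

Lemma set3_split (V : finType) (e : {set V}) : #|e| = 3%N ->
  exists u v w, e = [set u; v; w].
Proof.
move=> e3; have /card_gt0P[u ue] : (0 < #|e|)%N by rewrite e3.
have /card_gt0P[v ve] : (0 < #|e :\ u|)%N.
  by move: e3; rewrite (cardsD1 u) ue; lia.
have /card_gt0P[w we] : (0 < #|e :\ u :\ v|)%N.
  by move: e3; rewrite (cardsD1 u) ue (cardsD1 v) ve; lia.
by exists u, v, w; apply/esym/eqP; rewrite triple_setE // ve we.
Qed.

Section Triples.
Variables (R : realType) (V : finType) (E : {set {set V}}).
Hypothesis E3 : forall e, e \in E -> #|e| = 3%N.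

Lemma triples_system : triple_system (triples E).
Proof.
rewrite /triples; split=> [u v w|u v w|u v].
- by rewrite set3C.
- by rewrite set3CA.
- by apply/negP => /E3 /eqP; rewrite card_set3 eqxx.
Qed.

Lemma deg2_triples u : deg2 R (triples E) u = 2 * #|[set e in E | u \in e]|%:R.
Proof.
rewrite deg2E -sum1_card natr_sum mulr_sumr.
transitivity (\sum_(e in [set e in E | u \in e]) \sum_v \sum_w
    ([set u; v; w] == e)%:R : R).
  rewrite [RHS]exchange_big; apply: eq_bigr => v _ /=.
  rewrite [RHS]exchange_big; apply: eq_bigr => w _ /=; rewrite /triples.
  have [uvw|/negPf nuvw] := boolP ([set u; v; w] \in E).
    rewrite (bigD1 [set u; v; w]) /=; last by rewrite !inE uvw eqxx.
    by rewrite eqxx big1 ?addr0 // => e /andP[_ /negPf]; rewrite eq_sym => ->.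
  rewrite big1 // => e; rewrite inE => /andP[eE _].
  by case: eqP => // ee; rewrite ee eE in nuvw.
apply: eq_bigr => e; rewrite inE => /andP[/E3 e3 ue].
under eq_bigr do under eq_bigr do rewrite triple_setE //.
transitivity (\sum_(v in e :\ u) 1 : R); last first.
  rewrite sumr_const; have -> : #|e :\ u| = 2%N; last by rewrite mulr1.
  by move: e3; rewrite (cardsD1 u) ue => -[].
rewrite [RHS]big_mkcond; apply: eq_bigr => v _ /=.
case: ifP => [ve|_]; last by rewrite big1.
have c1 : #|e :\ u :\ v| = 1%N.
  by move: e3; rewrite (cardsD1 u) ue (cardsD1 v) ve => -[].
transitivity (\sum_(w in e :\ u :\ v) 1 : R); last by rewrite sumr_const c1.
by rewrite [RHS]big_mkcond; apply: eq_bigr => w _ /=; case: (w \in _).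
Qed.

Lemma size3_triples : size3 R (triples E) = 6 * #|E|%:R.
Proof.
rewrite size3_sum; under eq_bigr do rewrite deg2_triples.
rewrite -mulr_sumr.
have -> : \sum_u #|[set e in E | u \in e]|%:R = 3 * #|E|%:R :> R; last by ring.
rewrite -natr_sum -natrM; congr (_%:R).
transitivity (\sum_(e in E) #|e|)%N; last first.
  rewrite (eq_bigr (fun=> 3%N)); last by move=> e /E3.
  by rewrite sum_nat_const mulnC.
rewrite (eq_bigr (fun u => \sum_(e in E) (u \in e))%N) => [|u _].
  rewrite exchange_big; apply: eq_bigr => e _ /=.
  by rewrite -sum1_card [RHS]big_mkcond; apply: eq_bigr => u _; case: (u \in e).
rewrite -sum1_card [LHS]big_mkcond [RHS]big_mkcond; apply: eq_bigr => e _.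
by rewrite inE; case: (e \in E); case: (u \in e).
Qed.

End Triples.

Definition triple_edges (V : finType) (h : V -> V -> V -> bool) : {set {set V}} :=
  [set e : {set V} | (#|e| == 3%N) && [exists p : V * V * V,
    h p.1.1 p.1.2 p.2 && (e == [set p.1.1; p.1.2; p.2])]].

Lemma triplesK (V : finType) (h : V -> V -> V -> bool) : triple_system h ->
  triples (triple_edges h) =2 h.
Proof.
move=> hT u v; apply/funext => w; rewrite /triples inE.
apply/idP/idP => [/andP[c3 /existsP[[[a b] c] /= /andP[habc /eqP e]]]|huvw]; last first.
  have [uv uw vw] := ts_neq hT huvw.
  rewrite card_set3 uv uw vw /=; apply/existsP; exists (u, v, w).
  by rewrite /= huvw eqxx.
have [h1 h2 h3] : [/\ h b a c, h a c b & h c b a].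
  by split; [rewrite (ts12 hT) | rewrite (ts23 hT) | rewrite (ts13 hT)].
have [h4 h5] : h b c a /\ h c a b.
  by split; [rewrite (ts23 hT) | rewrite (ts23 hT)].
have : [/\ u \in [set a; b; c], v \in [set a; b; c] & w \in [set a; b; c]].
  by rewrite -e !inE !eqxx !orbT.
rewrite !inE => -[hu hv hw].
move: c3; rewrite card_set3 => /and3P[uv uw vw].
move: hu hv hw uv uw vw => /orP[/orP[]|] /eqP-> /orP[/orP[]|] /eqP-> /orP[/orP[]|] /eqP->;
  by rewrite ?eqxx.
Qed.

Section Hypergraph.
Variable R : realType.

Lemma edges_card3 n (H : hypergraph 3 n) e : e \in edges H -> #|e| = 3%N.
Proof. by move=> eH; apply/eqP; move/forall_inP: (edges_uniform H); exact. Qed.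

Definition htriples n (H : hypergraph 3 n) := triples (edges H).

Lemma htriples_system n (H : hypergraph 3 n) : triple_system (htriples H).
Proof. exact: triples_system (@edges_card3 _ H). Qed.

Lemma triple_edges_uniform n (h : 'I_n -> 'I_n -> 'I_n -> bool) :
  [forall e in triple_edges h, #|e| == 3%N].
Proof. by apply/forall_inP => e; rewrite inE => /andP[]. Qed.

Definition hypergraph_of n h : hypergraph 3 n :=
  Hypergraph (triple_edges_uniform (n := n) h).

Lemma hypergraph_ofK n (h : 'I_n -> 'I_n -> 'I_n -> bool) : triple_system h ->
  htriples (hypergraph_of h) = h.
Proof. by move=> hT; apply/funext => u; apply/funext => v; exact: triplesK. Qed.

Lemma size3_htriples n (H : hypergraph 3 n) :
  size3 R (htriples H) = 6 * #|edges H|%:R.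
Proof. exact: size3_triples (@edges_card3 _ H). Qed.

Lemma deg2_htriples n (H : hypergraph 3 n) v :
  deg2 R (htriples H) v = 2 * (degree H v)%:R.
Proof. exact: deg2_triples (@edges_card3 _ H) _. Qed.

Lemma colorableP m n (G : hypergraph 3 m) (H : hypergraph 3 n) :
  colorable G H <-> exists phi : 'I_n -> 'I_m, forall u v w,
    htriples H u v w -> htriples G (phi u) (phi v) (phi w).
Proof.
split=> -[phi hphi]; exists phi.
  by move=> u v w /hphi; rewrite imset3.
move=> e eH.
have [u [v [w e3]]] := set3_split (edges_card3 eH).
by move: eH; rewrite e3 imset3; exact: hphi.
Qed.

Lemma min_degree_le n (H : hypergraph 3 n) v : (min_degree H <= degree H v)%N.
Proof.
rewrite /min_degree; have : v \in index_enum 'I_n by exact: mem_index_enum.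
elim: (index_enum _) => //= x s IH; rewrite inE big_cons => /predU1P[->|/IH le].
  exact: geq_minl.
exact: leq_trans (geq_minr _ _) le.
Qed.

Section Family.
Variables (J : Type) (k N : nat) (G : J -> hypergraph 3 k).

(** Closed under homomorphic images of the same or smaller order, which is what
    makes freeness invariant under cloning vertices. *)
Definition forbidden : hfamily 3 :=
  [set K : {n : nat & hypergraph 3 n} | (projT1 K <= N)%N /\
     forall j, ~ colorable (G j) (projT2 K)]%classic.

Lemma forbidden_finite : finite_set forbidden.
Proof.
apply: (@sub_finite_set _ _ (\bigcup_(n in `I_N.+1)
   (existT (hypergraph 3) n @` [set: hypergraph 3 n]))%classic).
  by move=> [n H] [/= nN _]; exists n => //=; exists H.
apply: bigcup_finite; first exact: finite_II.
by move=> n _; apply: finite_image; exact: finite_finset.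
Qed.

Lemma colorable_free n (H : hypergraph 3 n) j :
  colorable (G j) H -> hfamily_free forbidden H.
Proof.
move=> [phi hphi] [m K] [/= _ nK] [f _ hf]; apply: (nK j).
by exists (phi \o f) => e eK; rewrite imset_comp; exact/hphi/hf.
Qed.

(** A set S of at most N vertices spans a copy of some 3-graph of order #|S|, which
    is not forbidden. The element of 'I_k serves as color outside S. *)
Lemma free_local n (H : hypergraph 3 n) : 'I_k ->
  hfamily_free forbidden H ->
  locally_colorable (fun j => htriples (G j)) N (htriples H).
Proof.
move=> c0 free S SN.
pose h (a b c : 'I_#|S|) := htriples H (enum_val a) (enum_val b) (enum_val c).
have hT : triple_system h by exact: triple_system_pull (htriples_system H).
have [j /colorableP[psi hpsi]] : exists j, colorable (G j) (hypergraph_of h).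
  apply: contrapT => no; apply: (free (existT _ _ (hypergraph_of h))).
    by split=> //= j cj; apply: no; exists j.
  exists enum_val; first exact: enum_val_inj.
  move=> /= e; rewrite inE => /andP[_ /existsP[[[a b] c] /= /andP[habc /eqP->]]].
  by rewrite imset3.
rewrite hypergraph_ofK // in hpsi.
exists j, (fun u => if [pick a : 'I_#|S| | enum_val a == u] is Some a then psi a else c0).
have pickE u : u \in S -> exists2 a : 'I_#|S|, enum_val a = u &
    (if [pick a : 'I_#|S| | enum_val a == u] is Some a then psi a else c0) = psi a.
  move=> uS; case: pickP => [a /eqP aE|no]; first by exists a.
  by have := no (enum_rank_in uS u); rewrite enum_rankK_in ?eqxx.
move=> u v w /pickE[a <- ->] /pickE[b <- ->] /pickE[c <- ->].
exact: hpsi.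
Qed.

End Family.
End Hypergraph.

(** * Balanced blowups *)

(** A permutation with the fewest disagreements has no pair of disagreeing
    vertices that a transposition would repair; so among the disagreeing vertices
    no color is both wanted and offered, and those wanting color a number exactly
    the excess of that color class. *)
Lemma match_colorings (V C : finType) (phi chi : V -> C) :
  exists rho : {perm V}, (#|[set v | chi (rho v) != phi v]| <=
    \sum_a (#|[set v | phi v == a]| - #|[set v | chi v == a]|))%N.
Proof.
pose dis (rho : {perm V}) := [set v | chi (rho v) != phi v].
case: (@arg_minnP _ (1%g : {perm V}) predT (fun rho => #|dis rho|)) => // rho _ rho_min.
exists rho; rewrite -/(dis rho).
have clash v w : v \in dis rho -> w \in dis rho -> phi v != chi (rho w).
  move=> vD wD; apply/negP => /eqP e.
  have := rho_min (tperm v w * rho)%g isT; rewrite leqNgt => /negP; apply.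
  apply: proper_card; apply/properP; split; last first.
    by exists v => //; rewrite inE permM tpermL -e eqxx.
  apply/fintype.subsetP => u; rewrite inE permM.
  by case: tpermP => [->|->|_ _] //; rewrite inE.
have -> : #|dis rho| = (\sum_a #|[set v in dis rho | phi v == a]|)%N.
  rewrite -sum1_card (partition_big phi predT) //=; apply: eq_bigr => a _.
  by rewrite -sum1_card; apply: eq_bigl => v; rewrite !inE.
apply: leq_sum => a _.
have [->|[v]] := finset.set_0Vmem [set v in dis rho | phi v == a].
  by rewrite cards0.
rewrite inE => /andP[vD /eqP va].
have -> : #|[set w | chi w == a]| = #|[set w | phi w == a] :\: dis rho|.
  rewrite -[RHS](card_imset _ (@perm_inj _ rho)); apply: eq_card => w.
  apply/idP/imsetP => [|[u]]; rewrite !inE; last first.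
    by rewrite negbK => /andP[/eqP e /eqP ua] ->; rewrite e ua.
  move=> /eqP wa; exists (rho^-1%g w); last by rewrite permKV.
  rewrite !inE permKV wa.
  have : rho^-1%g w \notin dis rho.
    apply/negP => wD; have := clash _ _ vD wD.
    by rewrite permKV wa va eqxx.
  by rewrite inE permKV wa negbK => /eqP <-; rewrite eqxx.
rewrite -(cardsID (dis rho) [set w | phi w == a]) addnK.
by apply: subset_leq_card; apply/fintype.subsetP => w; rewrite !inE andbC.
Qed.

Section Balanced.
Variables (R : realType) (C : finType) (x : C -> R).
Hypotheses (x0 : forall a, 0 <= x a) (x1 : \sum_a x a = 1).

Lemma push1E (V : finType) (chi : V -> C) a :
  push chi (fun=> 1) a = #|[set v | chi v == a]|%:R :> R.
Proof. by rewrite /push sumr_const; congr (_ *+ _); apply: eq_card => v; rewrite !inE. Qed.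

Lemma total_push1 (V : finType) (chi : V -> C) :
  \sum_a push chi (fun=> 1) a = #|V|%:R :> R.
Proof. by rewrite total_push sumr_const. Qed.

(** Greedily: the class sizes sum to n, so some class lies below its share of n + 1
    and can receive the next vertex. *)
Lemma balanced_upper n : exists chi : nat -> C, forall a,
  push (fun i : 'I_n => chi i) (fun=> 1) a <= x a * n%:R + 1.
Proof.
have [c0 _] : exists c0 : C, True.
  apply: contrapT => no; have := x1; rewrite big1; first by move/esym/eqP; rewrite oner_eq0.
  by move=> a _; case: no; exists a.
elim: n => [|n [chi IH]].
  by exists (fun=> c0) => a; rewrite /push big_ord0 mulr0 add0r.
have [a ha] : exists a, push (fun i : 'I_n => chi i) (fun=> 1) a < x a * n.+1%:R.
  apply: contrapT => no.
  have : \sum_a x a * n.+1%:R <= \sum_a push (fun i : 'I_n => chi i) (fun=> 1) a.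
    by apply: ler_sum => a _; rewrite leNgt; apply/negP => h; apply: no; exists a.
  by rewrite -mulr_suml x1 mul1r total_push1 card_ord ler_nat ltnn.
exists (fun i => if i == n then a else chi i) => b.
have -> : push (fun i : 'I_n.+1 => if i == n :> nat then a else chi i) (fun=> 1) b =
   push (fun i : 'I_n => chi i) (fun=> 1) b + (a == b)%:R :> R.
  rewrite /push big_mkcond big_ord_recr /= eqxx; congr (_ + _); last by case: (a == b).
  rewrite [RHS]big_mkcond; apply: eq_bigr => i _ /=.
  by rewrite (ltn_eqF (ltn_ord i)).
have := IH b; have [<-|_] := eqVneq a b; rewrite ?addr0; first by move=> _; apply: lerD => //; exact: ltW.
move=> le; apply: le_trans le _.
by rewrite lerD2r ler_wpM2l // ler_nat.
Qed.

Lemma balanced n : exists chi : 'I_n -> C, forall a,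
  `|push chi (fun=> 1) a - x a * n%:R| <= #|C|%:R.
Proof.
have [chi up] := balanced_upper n; exists (fun i : 'I_n => chi i) => a.
have C1 : 1 <= #|C|%:R :> R by rewrite ler1n; apply/card_gt0P; exists a.
rewrite ler_norml; apply/andP; split; last by have := up a; lra.
have := total_push1 (fun i : 'I_n => chi i); rewrite card_ord (bigD1 a) //= => e.
have : \sum_(b | b != a) push (fun i : 'I_n => chi i) (fun=> 1) b <=
    \sum_(b | b != a) (x b * n%:R + 1) by apply: ler_sum => b _; exact: up.
rewrite big_split /= -mulr_suml.
have -> : \sum_(b | b != a) x b = 1 - x a.
  by have := x1; rewrite (bigD1 a) //=; lra.
have : \sum_(b | b != a) 1 <= #|C|%:R :> R.
  by rewrite sumr_const ler_nat max_card.
rewrite mulrBl; lra.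
Qed.

End Balanced.

Section Blowup.
Variables (R : realType) (C : finType) (g : C -> C -> C -> bool).
Variables (L c : R) (x : C -> R).
Hypotheses (c0 : 0 < c) (cx : forall a, c <= x a) (xL : lagrangian g x = L).

Lemma size3_pull (V : finType) (chi : V -> C) :
  size3 R (pull chi g) = lagrangian g (push chi (fun=> 1)).
Proof. by rewrite /size3 lagrangian_push. Qed.

(** Every part has at least (n - k / c) times its optimal weight, and the form is
    monotone and homogeneous. *)
Lemma size3_blowup_ge (V : finType) (chi : V -> C) :
  (forall a, `|push chi (fun=> 1) a - x a * #|V|%:R| <= #|C|%:R) ->
  #|C|%:R / c <= #|V|%:R ->
  L * (#|V|%:R - #|C|%:R / c) ^+ 3 <= size3 R (pull chi g).
Proof.
move=> near big; rewrite size3_pull mulrC -xL -lagrangianZ.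
apply: ler_lagrangian => // a.
  by rewrite mulr_ge0 ?subr_ge0 // (le_trans (ltW c0)).
have := near a; rewrite ler_norml => /andP[lo _].
have : #|C|%:R <= #|C|%:R / c * x a.
  by rewrite mulrAC ler_pdivlMr // ler_wpM2l.
by rewrite mulrBl; lra.
Qed.

End Blowup.

(** * Turan density and degree stability *)

Lemma cube_lower (R : realType) (n m : R) : 0 <= m -> m <= n ->
  n ^+ 3 - 3 * m * n ^+ 2 <= (n - m) ^+ 3.
Proof.
move=> m0 mn; rewrite -subr_ge0.
have -> : (n - m) ^+ 3 - (n ^+ 3 - 3 * m * n ^+ 2) = m ^+ 2 * (n - m) + 2 * m ^+ 2 * n by ring.
by rewrite addr_ge0 ?mulr_ge0 ?exprn_ge0 ?subr_ge0 // (le_trans m0).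
Qed.

Section Density.
Variables (R : realType) (t k : nat) (G : 'I_t -> hypergraph 3 k).
Variables (L : R) (xs : 'I_t -> 'I_k -> R).
Hypothesis t_gt0 : (0 < t)%N.
Hypothesis gP : extremal_patterns (fun i => htriples (G i)) L xs.

Let M := forbidden (local_size 'I_k) G.

Lemma some_color : exists a : 'I_k, True.
Proof.
apply: contrapT => no; have := ep_sum gP (Ordinal t_gt0).
rewrite big1; first by move/esym/eqP; rewrite oner_eq0.
by move=> a _; case: no; exists a.
Qed.

Lemma free_triples n (H : hypergraph 3 n) : hfamily_free M H ->
  locally_colorable (fun i => htriples (G i)) (local_size 'I_k) (htriples H).
Proof. by have [a _] := some_color; exact: free_local a. Qed.

Lemma free_edges_le n (H : hypergraph 3 n) : hfamily_free M H ->
  6 * #|edges H|%:R <= L * n%:R ^+ 3.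
Proof.
move=> /free_triples hL; rewrite -size3_htriples.
by have := size3_le gP (htriples_system H) hL; rewrite card_ord.
Qed.

Lemma ex_number_le n : 6 * (ex_number n M)%:R <= L * n%:R ^+ 3.
Proof.
have /andP[L0 _] := ep_L gP.
rewrite /ex_number; elim/big_ind: _ => [|x y hx hy|H /asboolP hH].
- by rewrite mulr0 mulr_ge0 ?exprn_ge0 // ltW.
- by rewrite /maxn; case: ifP.
- exact: free_edges_le.
Qed.

Lemma ex_number_ge n (H : hypergraph 3 n) : hfamily_free M H ->
  (#|edges H| <= ex_number n M)%N.
Proof. by move=> hH; apply: (leq_bigmax_cond (P := fun H => `[< _ H >])); exact/asboolP. Qed.

Definition blowup n (i : 'I_t) (chi : 'I_n -> 'I_k) : hypergraph 3 n :=
  hypergraph_of (pull chi (htriples (G i))).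

Lemma htriples_blowup n i (chi : 'I_n -> 'I_k) :
  htriples (blowup i chi) = pull chi (htriples (G i)).
Proof. by apply: hypergraph_ofK; exact: triple_system_pull (htriples_system _). Qed.

Lemma blowup_free n i (chi : 'I_n -> 'I_k) : hfamily_free M (blowup i chi).
Proof.
apply: (colorable_free (j := i)); apply/colorableP; exists chi => u v w.
by rewrite htriples_blowup.
Qed.

Lemma balanced_blowups : exists chi : forall n, 'I_t -> 'I_n -> 'I_k,
  forall n i a, `|push (chi n i) (fun=> 1) a - xs i a * n%:R| <= k%:R :> R.
Proof.
have H (p : nat * 'I_t) : exists chi : 'I_p.1 -> 'I_k,
    forall a, `|push chi (fun=> 1) a - xs p.2 a * p.1%:R| <= k%:R :> R.
  have := balanced (xs_ge0 gP p.2) (ep_sum gP p.2) p.1.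
  by rewrite card_ord.
by exists (fun n i => sval (cid (H (n, i)))) => n i; exact: (svalP (cid (H (n, i)))).
Qed.

Lemma blowup_edges : exists2 m : R, 0 <= m &
  forall n i (chi : 'I_n -> 'I_k),
  (forall a, `|push chi (fun=> 1) a - xs i a * n%:R| <= k%:R) ->
  m <= n%:R -> L * (n%:R - m) ^+ 3 <= 6 * #|edges (blowup i chi)|%:R.
Proof.
have [c c0 cx] := ep_pos gP; exists (k%:R / c); first by rewrite divr_ge0 // ltW.
move=> n i chi near big; rewrite -size3_htriples htriples_blowup.
have := @size3_blowup_ge R 'I_k (htriples (G i)) L c (xs i) c0 (cx i) (ep_opt gP i) _ chi.
by rewrite !card_ord; exact.
Qed.

Lemma ex_number_lower : exists2 m : R, 0 <= m &
  forall n, m <= n%:R -> L * (n%:R - m) ^+ 3 <= 6 * (ex_number n M)%:R.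
Proof.
have [m m0 hm] := blowup_edges; have [chi near] := balanced_blowups.
exists m => // n mn; apply: le_trans (hm n (Ordinal t_gt0) _ (near _ _) mn) _.
rewrite ler_pM2l // ler_nat; apply: ex_number_ge; exact: blowup_free.
Qed.

Lemma bin3E n : (2 < n)%N -> 'C(n, 3)%:R = n%:R * (n%:R - 1) * (n%:R - 2) / 6 :> R.
Proof.
move=> n2; have := bin_ffact n 3; rewrite !ffactnS ffactn0 muln1.
rewrite [(3`!)%N](_ : _ = 6%N) // => /(congr1 (fun m => m%:R : R)); rewrite !natrM => e.
have e1 : n.-1%:R = n%:R - 1 :> R by rewrite -subn1 natrB // (leq_trans _ n2).
have e2 : n.-2%:R = n%:R - 2 :> R by rewrite -subn2 natrB // (leq_trans _ n2).
by move: e; rewrite e1 e2 => e; apply: (mulIf (x := 6)) => //; rewrite e divfK // mulrA.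
Qed.

(** The extremal number is L n^3 / 6 up to an error of order n^2, and the binomial
    coefficient is n^3 / 6 up to such an error. *)
Lemma turan_density : is_turan_density M L.
Proof.
have /andP[/ltW L0 L1] := ep_L gP; have [m m0 low] := ex_number_lower.
apply/cvgrPdist_le => e e0.
pose K := 6 + 3 * m.
have K0 : 0 <= K by rewrite addr_ge0 ?mulr_ge0.
exists (maxn 6 (maxn (Num.bound m) (Num.bound (K / e)))) => // n /=.
rewrite !geq_max => /and3P[n6 nm nK].
have {}nm : m <= n%:R.
  apply: ltW; apply: lt_le_trans (archi_boundP m0) _; by rewrite ler_nat.
have {}nK : K / e <= n%:R.
  apply: ltW; apply: lt_le_trans (archi_boundP (divr_ge0 K0 (ltW e0))) _.
  by rewrite ler_nat.
have {}nK : K / n%:R <= e.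
  have n0 : 0 < n%:R :> R by rewrite ltr0n (leq_trans _ n6).
  by rewrite ler_pdivrMr // mulrC -ler_pdivrMr.
apply: le_trans nK.
have {low} := low n nm; have := ex_number_le n.
rewrite bin3E ?(leq_trans _ n6) //; have {}n6 : 6 <= n%:R :> R by rewrite ler_nat.
have : 0 <= (ex_number n M)%:R :> R by [].
move: (ex_number n M)%:R => x x0; move: n%:R n6 nm => {}n n6 nm up low.
have n0 : 0 < n by lra.
set Q := n * (n - 1) * (n - 2).
have Q0 : 0 < Q by rewrite /Q !mulr_gt0 //; lra.
have -> : L - x / (Q / 6) = (L * Q - 6 * x) / Q by field; rewrite gt_eqF.
rewrite normrM normfV (gtr0_norm Q0) ler_pdivrMr // mulrAC ler_pdivlMr //.
rewrite -[X in _ * X <= _](gtr0_norm n0) -normrM ler_norml; apply/andP; split.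
  have n2 : 0 <= (n - 6) * n by rewrite mulr_ge0 ?(ltW n0) // subr_ge0.
  have h1 : L * (3 * n ^+ 2 - 2 * n) <= 1 * (3 * n ^+ 2 - 2 * n).
    by rewrite ler_wpM2r //; lra.
  have h2 : L * n ^+ 3 - L * Q <= 6 * ((n - 1) * (n - 2)).
    have -> : L * n ^+ 3 - L * Q = L * (3 * n ^+ 2 - 2 * n) by rewrite /Q; ring.
    by lra.
  have h3 : 6 * x - L * Q <= K * ((n - 1) * (n - 2)).
    have : 0 <= 3 * m * ((n - 1) * (n - 2)) by rewrite !mulr_ge0 //; lra.
    by rewrite /K mulrDl; lra.
  have : (6 * x - L * Q) * n <= K * ((n - 1) * (n - 2)) * n by rewrite ler_wpM2r ?(ltW n0).
  have -> : K * ((n - 1) * (n - 2)) * n = K * Q by rewrite /Q; ring.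
  by lra.
have h1 : L * n ^+ 3 - L * (3 * m * n ^+ 2) <= 6 * x.
  by apply: le_trans low; rewrite -mulrBr ler_wpM2l // cube_lower.
have h2 : L * (3 * m * n ^+ 2) <= 3 * m * n ^+ 2.
  by rewrite ler_piMl // !mulr_ge0 ?exprn_ge0 ?(ltW n0).
have QE : n ^+ 3 - Q = 2 * n ^+ 2 + n * (n - 2) by rewrite /Q; ring.
have Qn : Q <= n ^+ 3.
  by rewrite -subr_ge0 QE addr_ge0 ?mulr_ge0 ?exprn_ge0 ?subr_ge0 ?(ltW n0) //; lra.
have h3 : (L * n ^+ 3 - L * (3 * m * n ^+ 2)) * n <= 6 * x * n by rewrite ler_wpM2r ?(ltW n0).
have h4 : L * (3 * m * n ^+ 2) * n <= 3 * m * n ^+ 2 * n by rewrite ler_wpM2r ?(ltW n0).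
have h5 : 0 <= 6 * Q by rewrite mulr_ge0 ?(ltW Q0).
have h6 : (L * n - 3 * m) * Q <= 6 * x * n.
  have [neg|/ltW pos] := lerP (L * n - 3 * m) 0.
    apply: (@le_trans _ _ 0); first by rewrite mulr_le0_ge0 ?(ltW Q0).
    by rewrite !mulr_ge0 ?(ltW n0).
  apply: le_trans (ler_wpM2l pos Qn) _; apply: le_trans h3.
  have -> : (L * n - 3 * m) * n ^+ 3 = L * n ^+ 3 * n - 3 * m * n ^+ 2 * n by ring.
  by rewrite mulrBl; lra.
have -> : (L * Q - 6 * x) * n = L * n * Q - 6 * x * n by ring.
by move: h6; rewrite /K mulrBl mulrDl; lra.
Qed.

(** All vertices are rich. *)
Lemma degree_stability : exists (eps : R) (N0 : nat), 0 < eps /\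
  forall n : nat, (N0 <= n)%N -> forall H : hypergraph 3 n, hfamily_free M H ->
  (L / 2 - eps) * n%:R ^+ 2 <= (min_degree H)%:R ->
  exists i : 'I_t, colorable (G i) H.
Proof.
have [tau tau0 hrich] := rich_colorable gP.
pose eps := Num.min tau (tau ^+ 2 / 2) / 2.
have eps0 : 0 < eps by rewrite divr_gt0 // lt_min tau0 divr_gt0 ?exprn_gt0.
have [e1 e2] : 2 * eps <= tau /\ 2 * eps <= tau ^+ 2 / 2.
  by rewrite mulrC divfK // !ge_min !lexx orbT.
have b0 : 0 <= 3 / tau by rewrite divr_ge0 // ltW.
exists eps, (Num.bound (3 / tau)); split=> // n nN H Hfree Hdeg.
have n_big : 3 <= tau * n%:R.
  rewrite mulrC -ler_pdivrMr //; apply: ltW.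
  by apply: lt_le_trans (archi_boundP b0) _; rewrite ler_nat.
have deg_ge u : (L - 2 * eps) * n%:R ^+ 2 <= deg2 R (htriples H) u.
  rewrite deg2_htriples; have := min_degree_le H u; rewrite -(ler_nat R).
  have -> : (L - 2 * eps) * n%:R ^+ 2 = 2 * ((L / 2 - eps) * n%:R ^+ 2) by field.
  by lra.
have := @hrich tau 'I_n (htriples H) _ _ (htriples_system H) (free_triples Hfree).
rewrite !card_ord => /(_ _ n_big) [||i [phi col]].
- by rewrite tau0 lexx.
- rewrite size3_sum.
  apply: (@le_trans _ _ (\sum_(u < n) (L - 2 * eps) * n%:R ^+ 2)).
    rewrite sumr_const card_ord -[leRHS]mulr_natr -mulrA -exprSr.
    by rewrite ler_wpM2r ?exprn_ge0 // lerD2l lerN2.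
  by apply: ler_sum => u _.
exists i; apply/colorableP; exists phi => u v w; apply: col;
  rewrite inE card_ord; apply: le_trans (deg_ge _); rewrite ler_wpM2r ?exprn_ge0 //;
  by rewrite lerD2l lerN2.
Qed.

End Density.

(** * Edit distance and the upper bound on the stability number *)

Lemma natr_subn_le (R : realType) (p q : nat) (X : R) : 0 <= X ->
  p%:R <= q%:R + X -> (p - q)%:R <= X.
Proof.
move=> X0 pq; have [le|/ltnW le] := leqP p q; first by move: le; rewrite /leq => /eqP->.
by rewrite natrB // lerBlDl.
Qed.

Section Edit.
Variable R : realType.

Lemma sum_triples_touching (V : finType) (B : {set V}) (F : V -> V -> V -> bool) :
  (forall u v w, F u v w -> [|| u \in B, v \in B | w \in B]) ->
  \sum_u \sum_v \sum_w (F u v w)%:R <= 3 * #|B|%:R * #|V|%:R ^+ 2 :> R.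
Proof.
move=> FB.
have s1 : \sum_u \sum_(v : V) \sum_(w : V) indic R B u = #|B|%:R * #|V|%:R ^+ 2.
  under eq_bigr do rewrite !sumr_const -mulrnA -mulr_natr natrM -expr2.
  by rewrite -mulr_suml sum_indic.
have s2 : \sum_(u : V) \sum_v \sum_(w : V) indic R B v = #|B|%:R * #|V|%:R ^+ 2.
  by rewrite exchange_big.
have s3 : \sum_(u : V) \sum_(v : V) \sum_w indic R B w = #|B|%:R * #|V|%:R ^+ 2.
  by rewrite -s2; apply: eq_bigr => u _; rewrite exchange_big.
have -> : 3 * #|B|%:R * #|V|%:R ^+ 2 = #|B|%:R * #|V|%:R ^+ 2 + #|B|%:R * #|V|%:R ^+ 2
   + #|B|%:R * #|V|%:R ^+ 2 :> R by ring.
rewrite -{1}s1 -{1}s2 -s3 -!big_split; apply: ler_sum => u _ /=.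
rewrite -!big_split; apply: ler_sum => v _ /=.
rewrite -!big_split; apply: ler_sum => w _ /=.
have := FB u v w; rewrite /indic; case: (F u v w) => [/(_ isT)|_]; last by rewrite !addr_ge0.
by case: (u \in B); case: (v \in B); case: (w \in B) => //= _; lra.
Qed.

Lemma sum_diff n (H K : hypergraph 3 n) :
  \sum_u \sum_v \sum_w (htriples H u v w && ~~ htriples K u v w)%:R =
  6 * #|edges H :\: edges K|%:R :> R.
Proof.
rewrite -size3_triples; last by move=> e; rewrite inE => /andP[_ /edges_card3].
rewrite size3E; apply: eq_bigr => u _; apply: eq_bigr => v _.
by apply: eq_bigr => w _; rewrite /triples inE andbC.
Qed.

Lemma isomorphic_triples n (K H : hypergraph 3 n) (f : 'I_n -> 'I_n) :
  bijective f -> (forall u v w, htriples H (f u) (f v) (f w) = htriples K u v w) ->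
  isomorphic K H.
Proof.
move=> fb fE; exists f => // e.
have [e3|e3] := eqVneq #|e| 3%N.
  by have [u [v [w ->]]] := set3_split e3; rewrite imset3; exact: fE.
transitivity false; last first.
  by apply/esym/negbTE; apply: contra e3 => /edges_card3 ->.
by apply/negbTE; apply: contra e3 => /edges_card3; rewrite card_imset; [move->|exact: bij_inj].
Qed.

Lemma isomorphic_triplesP n (K H : hypergraph 3 n) : isomorphic K H ->
  exists2 f : 'I_n -> 'I_n, bijective f &
    forall u v w, htriples H (f u) (f v) (f w) = htriples K u v w.
Proof. by move=> [f fb fE]; exists f => // u v w; rewrite /htriples /triples -imset3 fE. Qed.

End Edit.

Section StabilityNumber.
Variables (R : realType) (t k : nat) (G : 'I_t -> hypergraph 3 k).
Variables (L : R) (xs : 'I_t -> 'I_k -> R).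
Hypothesis t_gt0 : (0 < t)%N.
Hypothesis gP : extremal_patterns (fun i => htriples (G i)) L xs.

Let M := forbidden (local_size 'I_k) G.

(** After a permutation matching the two colorings up to few vertices, an edge of
    H outside the blowup touches an uncolored or mismatched vertex. The edges of
    the blowup outside H are then few because the blowup has at most L n^3 / 6
    edges and H almost as many. *)
Lemma dist_to_blowup n (H : hypergraph 3 n) (i : 'I_t) (phi chi : 'I_n -> 'I_k)
    (W : {set 'I_n}) (beta gamma zeta : R) :
  colors (fun j => htriples (G j)) (htriples H) W i phi ->
  (L - gamma) * n%:R ^+ 3 <= 6 * #|edges H|%:R ->
  #|~: W|%:R <= beta * n%:R -> 0 <= zeta ->
  (forall a, push phi (fun=> 1) a <= push chi (fun=> 1) a + zeta * n%:R) ->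
  exists2 K, isomorphic (blowup G i chi) K &
    6 * (edit_distance H K)%:R <= (gamma + 6 * (beta + k%:R * zeta)) * n%:R ^+ 3.
Proof.
move=> col big Wfew z0 near; have [rho hrho] := match_colorings phi chi.
pose K := blowup G i (chi \o rho).
have KE u v w : htriples K u v w = htriples (G i) (chi (rho u)) (chi (rho v)) (chi (rho w)).
  by rewrite htriples_blowup.
have few : #|[set v | chi (rho v) != phi v]|%:R <= k%:R * zeta * n%:R :> R.
  apply: (@le_trans _ _ (\sum_(a < k) zeta * n%:R)); last first.
    by rewrite sumr_const card_ord -[leLHS]mulr_natr mulrC mulrA.
  apply: (@le_trans _ _ (\sum_a (#|[set v | phi v == a]| - #|[set v | chi v == a]|)%:R)).
    by rewrite -natr_sum ler_nat.
  apply: ler_sum => a _; apply: natr_subn_le; first by rewrite mulr_ge0.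
  by rewrite -!push1E.
pose B := ~: W :|: [set v | chi (rho v) != phi v].
have Bfew : #|B|%:R <= (beta + k%:R * zeta) * n%:R.
  apply: (@le_trans _ _ (#|~: W|%:R + #|[set v | chi (rho v) != phi v]|%:R)).
    by rewrite -natrD ler_nat leq_card_setU.
  by rewrite mulrDl lerD.
have d1 : 6 * #|edges H :\: edges K|%:R <= 3 * #|B|%:R * n%:R ^+ 2 :> R.
  rewrite -(sum_diff R H K).
  have := @sum_triples_touching R 'I_n B; rewrite card_ord; apply=> u v w.
  move=> /andP[hH]; apply: contraNT; rewrite !inE !negb_or !negbK.
  move=> /and3P[/andP[uW /eqP ua] /andP[vW /eqP va] /andP[wW /eqP wa]].
  by rewrite KE ua va wa; exact: col.
have KL : 6 * #|edges K|%:R <= L * n%:R ^+ 3.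
  by apply: (free_edges_le t_gt0 gP); exact: blowup_free.
exists K.
  apply: (isomorphic_triples (f := rho^-1%g)) => [|u v w].
    by exists rho; [exact: permKV|exact: permK].
  by rewrite KE htriples_blowup !permKV.
have e1 : #|edges K :\: edges H|%:R =
    #|edges K|%:R - #|edges H|%:R + #|edges H :\: edges K|%:R :> R.
  rewrite -(cardsID (edges H) (edges K)) -(cardsID (edges K) (edges H)).
  by rewrite finset.setIC !natrD; ring.
have d2 : 3 * #|B|%:R * n%:R ^+ 2 <= 3 * (beta + k%:R * zeta) * n%:R ^+ 3.
  have -> : 3 * (beta + k%:R * zeta) * n%:R ^+ 3 =
    3 * ((beta + k%:R * zeta) * n%:R) * n%:R ^+ 2 by ring.
  by rewrite ler_wpM2r ?exprn_ge0 // ler_wpM2l.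
rewrite /edit_distance natrD e1; move: d1 d2 KL big; lra.
Qed.

(** The reference 3-graphs are blowups with nearly optimal part sizes. A nearly
    extremal H is colored on its rich vertices, and the near optimality of its
    class weights makes its part sizes nearly equal to those of the blowup. *)
Lemma t_stable : s_stable R t M.
Proof.
have /andP[L0 L1] := ep_L gP.
have [chi near] := balanced_blowups gP.
have [m m0 low] := ex_number_lower t_gt0 gP.
have [tau1 tau10 hrich] := rich_colorable gP.
exists (fun n i => blowup G i (chi n i)) => delta delta0.
have kp : 0 < k%:R + 1 :> R by rewrite ltr_wpDl.
have [eta eta0 etaE] : exists2 eta : R, 0 < eta & (k%:R + 1) * eta = delta / 2.
  exists (delta / 2 / (k%:R + 1)); first by rewrite !divr_gt0.
  by rewrite mulrC divfK // gt_eqF.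
have [eps eps0 mod] := ep_modulus gP eta0.
have [tau [tau0 tau_1 tau_le1 tau_d tau_eps]] : exists tau, [/\ 0 < tau, tau <= tau1,
    tau <= 1, (k%:R + 1) * tau <= delta / 8 & 4 * tau <= eps].
  exists (Num.min (Num.min tau1 1) (Num.min (delta / 8 / (k%:R + 1)) (eps / 4))).
  split.
  - by rewrite !lt_min tau10 ltr01 !divr_gt0.
  - by rewrite !ge_min lexx.
  - by rewrite !ge_min lexx orbT.
  - by rewrite mulrC -ler_pdivlMr // !ge_min lexx !orbT.
  - by rewrite mulrC -ler_pdivlMr // !ge_min lexx !orbT.
(* The four summands are the lower bounds on n that are needed below. *)
pose b : R := 3 / tau + 12 * m / tau ^+ 2 + k%:R / tau + m.
have b3 : 0 <= 3 / tau by rewrite divr_ge0 // ltW.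
have b12 : 0 <= 12 * m / tau ^+ 2 by rewrite divr_ge0 ?mulr_ge0 ?exprn_ge0 // ltW.
have bk : 0 <= k%:R / tau by rewrite divr_ge0 // ltW.
have b0 : 0 <= b by rewrite /b !addr_ge0.
exists (tau ^+ 2 / 4); first by rewrite divr_gt0 ?exprn_gt0.
exists (Num.bound b) => n nN H Hfree Hbig.
have {}nN : b <= n%:R.
  by apply: ltW; apply: lt_le_trans (archi_boundP b0) _; rewrite ler_nat.
have n3 : 3 <= tau * n%:R.
  by rewrite mulrC -ler_pdivrMr //; move: nN; rewrite /b; lra.
have n12 : 12 * m <= tau ^+ 2 * n%:R.
  by rewrite [leRHS]mulrC -ler_pdivrMr ?exprn_gt0 //; move: nN; rewrite /b; lra.
have nk : k%:R <= tau * n%:R.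
  by rewrite mulrC -ler_pdivrMr //; move: nN; rewrite /b; lra.
have nm : m <= n%:R by move: nN; rewrite /b; lra.
have n0 : 0 < n%:R :> R.
  by rewrite lt0r ler0n andbT; apply: contraTneq n3 => ->; rewrite mulr0 -ltNge.
have big : (L - tau ^+ 2 / 2) * n%:R ^+ 3 <= 6 * #|edges H|%:R.
  have tt1 : tau ^+ 2 <= 1 by rewrite expr_le1 // ltW.
  have h0 := cube_lower m0 nm; have h2 := low n nm.
  have h1 : L * (n%:R ^+ 3 - 3 * m * n%:R ^+ 2) <= 6 * (ex_number n M)%:R.
    by apply: le_trans h2; rewrite ler_wpM2l // ltW.
  have {h1} : (1 - tau ^+ 2 / 4) * (L * (n%:R ^+ 3 - 3 * m * n%:R ^+ 2)) <=
      (1 - tau ^+ 2 / 4) * (6 * (ex_number n M)%:R).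
    by rewrite ler_wpM2l //; lra.
  have h3 : 3 * m * n%:R ^+ 2 <= tau ^+ 2 / 4 * n%:R ^+ 3.
    have -> : tau ^+ 2 / 4 * n%:R ^+ 3 = tau ^+ 2 * n%:R / 4 * n%:R ^+ 2 by ring.
    by rewrite ler_wpM2r ?exprn_ge0 ?(ltW n0) //; lra.
  have h4 : (1 - tau ^+ 2 / 4) * L * (3 * m * n%:R ^+ 2) <= 1 * (tau ^+ 2 / 4 * n%:R ^+ 3).
    apply: ler_pM => //; rewrite ?mulr_ge0 ?exprn_ge0 ?(ltW n0) ?(ltW L0) //; try lra.
    have : 0 <= tau ^+ 2 / 4 by rewrite divr_ge0 ?exprn_ge0 // ltW.
    move=> h; rewrite mulrBl mul1r; have : 0 <= tau ^+ 2 / 4 * L by rewrite mulr_ge0 // ltW.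
    by lra.
  have h5 : L * (tau ^+ 2 / 4 * n%:R ^+ 3) <= tau ^+ 2 / 4 * n%:R ^+ 3.
    by rewrite ler_piMl // mulr_ge0 ?divr_ge0 ?exprn_ge0 // ltW.
  have -> : (1 - tau ^+ 2 / 4) * (L * (n%:R ^+ 3 - 3 * m * n%:R ^+ 2)) =
    L * n%:R ^+ 3 - L * (tau ^+ 2 / 4 * n%:R ^+ 3) -
    (1 - tau ^+ 2 / 4) * L * (3 * m * n%:R ^+ 2) by ring.
  move: Hbig h4 h5; rewrite mul1r => Hbig h4 h5.
  have -> : (L - tau ^+ 2 / 2) * n%:R ^+ 3 = L * n%:R ^+ 3 -
    2 * (tau ^+ 2 / 4 * n%:R ^+ 3) by field.
  have -> : (1 - tau ^+ 2 / 4) * (6 * (ex_number n M)%:R) =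
     6 * ((1 - tau ^+ 2 / 4) * (ex_number n M)%:R) by ring.
  by lra.
have hT := htriples_system H; have hL := free_triples t_gt0 gP Hfree.
have big' : (L - tau ^+ 2 / 2) * #|'I_n|%:R ^+ 3 <= size3 R (htriples H).
  by rewrite card_ord size3_htriples.
have [||i [phi col]] := hrich tau 'I_n (htriples H) _ _ hT hL big'.
- by rewrite tau0.
- by rewrite card_ord.
have few := few_poor gP hT hL tau0 big'; rewrite card_ord in few.
set W := rich L (htriples H) tau in col few.
have n0' : 0 < #|'I_n|%:R :> R by rewrite card_ord.
have cw a : `|class_weight R W phi a - xs i a| <= eta.
  apply: mod; [exact: class_weight_ge0 | exact: class_weight_sum |].
  apply: (@le_trans _ _ (L - 4 * tau)); first by rewrite lerD2l lerN2.
  apply: (class_weight_opt gP n0' tau0 _ _ col).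
    by move=> u; rewrite inE.
  rewrite card_ord; apply: le_trans few _; rewrite ler_wpM2r // ?(ltW n0) //; lra.
have phi_near a : push phi (fun=> 1) a <= push (chi n i) (fun=> 1) a + (eta + 2 * tau) * n%:R.
  have := cw a; rewrite ler_norml => /andP[_].
  rewrite /class_weight card_ord lerBlDl mulrC ler_pdivrMr // => h1.
  have h2 : push phi (fun=> 1) a <= push phi (indic R W) a + #|~: W|%:R.
    rewrite -sum_indic /push.
    apply: (@le_trans _ _ (\sum_(u | phi u == a) (indic R W u + indic R (~: W) u))).
      by apply: ler_sum => u _; rewrite /indic finset.in_setC; case: (u \in W); rewrite /= ?addr0 ?add0r.
    rewrite big_split lerD2l /= [leRHS](bigID (fun u => phi u == a)) /= lerDl.
    by apply: sumr_ge0.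
  have := near n i a; rewrite ler_norml => /andP[h3 _].
  by move: h1; rewrite mulrDl [(eta + _) * _]mulrDl -mulrA; lra.
have zeta0 : 0 <= eta + 2 * tau by rewrite addr_ge0 ?mulr_ge0 // ltW.
have [K isoK dK] := dist_to_blowup col big few zeta0 phi_near.
exists i, K; split=> //.
have : (tau ^+ 2 / 2 + 6 * (tau / 3 + k%:R * (eta + 2 * tau))) * n%:R ^+ 3 <=
    6 * (delta * n%:R ^+ 3); last by lra.
rewrite mulrA ler_wpM2r ?exprn_ge0 ?(ltW n0) //.
have tt : tau ^+ 2 <= tau by rewrite expr2 ler_piMl // ltW.
have kt : 0 <= k%:R * tau by rewrite mulr_ge0 // ltW.
have ke : 0 <= k%:R * eta by rewrite mulr_ge0 // ltW.
by move: etaE tau_d; rewrite mulrDl mul1r mulrDl mul1r mulrDr mulrCA; lra.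
Qed.
End StabilityNumber.

(** * The lower bound on the stability number *)

Section StabilityLower.
Variables (R : realType) (t k : nat) (G : 'I_t -> hypergraph 3 k).
Variables (L : R) (xs : 'I_t -> 'I_k -> R).
Hypothesis t_gt0 : (0 < t)%N.
Hypothesis gP : extremal_patterns (fun i => htriples (G i)) L xs.

Let M := forbidden (local_size 'I_k) G.

(** A transversal of the parts of the first blowup that avoids all edited triples
    maps homomorphically to pattern j through the identification of both
    3-graphs with S. *)
Lemma close_blowups_eq n (i j : 'I_t) (chi_i chi_j : 'I_n -> 'I_k)
    (S Ki Kj : hypergraph 3 n) (c delta : R) : (0 < n)%N -> 0 <= c -> 0 <= delta ->
  (forall a, c * n%:R <= push chi_i (fun=> 1) a) ->
  isomorphic S Ki -> isomorphic S Kj ->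
  (edit_distance (blowup G i chi_i) Ki)%:R <= delta * n%:R ^+ 3 ->
  (edit_distance (blowup G j chi_j) Kj)%:R <= delta * n%:R ^+ 3 ->
  k%:R ^+ 3 * (12 * delta) < c ^+ k -> i = j.
Proof.
move=> n0 c0 d0 parts /isomorphic_triplesP[p [q pq qp] pE] /isomorphic_triplesP[r rb rE] di dj small.
pose s u := r (q u).
have sb : bijective s by apply: bij_comp => //; exists p.
have sE u v w : htriples Kj (s u) (s v) (s w) = htriples Ki u v w.
  by rewrite rE -[in RHS](qp u) -[in RHS](qp v) -[in RHS](qp w) pE.
pose B1 u v w := htriples (blowup G i chi_i) u v w && ~~ htriples Ki u v w.
pose B2 u v w := htriples Kj u v w && ~~ htriples (blowup G j chi_j) u v w.
have b1 : \sum_u \sum_v \sum_w (B1 u v w)%:R <= 6 * delta * n%:R ^+ 3.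
  rewrite sum_diff -mulrA ler_wpM2l //; apply: le_trans di.
  by rewrite ler_nat leq_addr.
have b2 : \sum_u \sum_v \sum_w (B2 (s u) (s v) (s w))%:R <= 6 * delta * n%:R ^+ 3.
  have -> : \sum_u \sum_v \sum_w (B2 (s u) (s v) (s w))%:R =
      \sum_u \sum_v \sum_w (B2 u v w)%:R :> R.
    rewrite [RHS](reindex s) /=; last exact: onW_bij.
    apply: eq_bigr => u _; rewrite [RHS](reindex s) /=; last exact: onW_bij.
    by apply: eq_bigr => v _; rewrite [RHS](reindex s) //; exact: onW_bij.
  rewrite sum_diff -mulrA ler_wpM2l //; apply: le_trans dj.
  by rewrite ler_nat leq_addl.
have [||||||f [fA fB]] := @transversal R 'I_n 'I_k (fun a => [set u | chi_i u == a])
  (fun _ _ _ u v w => B1 u v w || B2 (s u) (s v) (s w)) c (12 * delta).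
- by rewrite card_ord.
- by [].
- by rewrite mulr_ge0.
- by move=> a; rewrite card_ord -push1E.
- move=> _ _ _ _ _ _; rewrite card_ord.
  apply: (@le_trans _ _ (\sum_u \sum_v \sum_w (B1 u v w)%:R +
     \sum_u \sum_v \sum_w (B2 (s u) (s v) (s w))%:R)); last by lra.
  rewrite -!big_split; apply: ler_sum => u _ /=.
  rewrite -!big_split; apply: ler_sum => v _ /=.
  rewrite -!big_split; apply: ler_sum => w _ /=.
  by case: (B1 u v w); case: (B2 _ _ _); rewrite ?lerDl ?lerDr ?addr0 ?add0r.
- by rewrite card_ord.
have ff a : chi_i (f a) = a by have := fA a; rewrite inE => /eqP.
apply: (ep_hom gP (s := fun a => chi_j (s (f a)))) => a b d gabd.
have [ab ad bd] := ts_neq (htriples_system (G i)) gabd.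
have := fB a b d ab ad bd; rewrite negb_or /B1 /B2 !htriples_blowup /pull !ff gabd /=.
by rewrite negbK => /andP[hK]; rewrite sE hK /= negbK.
Qed.

(** By the pigeonhole principle one reference 3-graph serves two patterns. *)
Lemma not_stable s : (s < t)%N -> ~ s_stable R s M.
Proof.
move=> st [S HS].
have /andP[L0 L1] := ep_L gP; have [c c0 cx] := ep_pos gP.
have [chi near] := balanced_blowups gP.
have [m m0 low] := blowup_edges gP.
have kp : 0 < k%:R + 1 :> R by rewrite ltr_wpDl.
have [delta delta0 deltaE] : exists2 delta : R, 0 < delta &
    (k%:R + 1) ^+ 3 * (12 * delta) < (c / 2) ^+ k.
  have p0 : 0 < (c / 2) ^+ k by rewrite exprn_gt0 // divr_gt0.
  exists ((c / 2) ^+ k / 24 / (k%:R + 1) ^+ 3); first by rewrite divr_gt0 ?(exprn_gt0 _ kp) // divr_gt0.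
  rewrite [ltLHS](_ : _ = (c / 2) ^+ k / 2); first by lra.
  by field; rewrite gt_eqF.
have [eps eps0 [N0 HN]] := HS delta delta0.
pose b : R := 3 * m / eps + 2 * k%:R / c + m + 1.
have b1 : 0 <= 3 * m / eps by rewrite divr_ge0 ?mulr_ge0 // ltW.
have b2 : 0 <= 2 * k%:R / c by rewrite divr_ge0 ?mulr_ge0 // ltW.
have b0 : 0 <= b by rewrite /b !addr_ge0.
pose n := maxn N0 (Num.bound b).
have nN0 : (N0 <= n)%N by exact: leq_maxl.
have nb : b < n%:R.
  by apply: lt_le_trans (archi_boundP b0) _; rewrite ler_nat leq_maxr.
have n0 : 0 < n%:R :> R by exact: le_lt_trans nb.
have n1 : 3 * m < eps * n%:R.
  by rewrite [ltRHS]mulrC -ltr_pdivrMr //; move: nb; rewrite /b; lra.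
have n2 : 2 * k%:R <= c * n%:R.
  by rewrite [leRHS]mulrC -ler_pdivrMr //; move: nb; rewrite /b; lra.
have nm' : m < n%:R by move: nb; rewrite /b; lra.
have nm := ltW nm'.
have large i : (1 - eps) * (ex_number n M)%:R < #|edges (blowup G i (chi n i))|%:R.
  have h1 := low n i (chi n i) (near n i) nm.
  have h2 := ex_number_le t_gt0 gP n; rewrite -/M in h2.
  have h3 := cube_lower m0 nm.
  have h4 : L * (n%:R ^+ 3 - 3 * m * n%:R ^+ 2) <= L * (n%:R - m) ^+ 3.
    by rewrite ler_wpM2l // ltW.
  have h5 : L * (3 * m * n%:R ^+ 2) < L * (eps * n%:R ^+ 3).
    have -> : eps * n%:R ^+ 3 = eps * n%:R * n%:R ^+ 2 by ring.
    by rewrite ltr_pM2l // ltr_pM2r ?exprn_gt0.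
  have [neg|pos] := lerP (1 - eps) 0.
    apply: (@le_lt_trans _ _ 0); first by rewrite mulr_le0_ge0.
    have : 0 < L * (n%:R - m) ^+ 3 by rewrite mulr_gt0 // exprn_gt0 // subr_gt0.
    by lra.
  have h6 : (1 - eps) * (6 * (ex_number n M)%:R) <= (1 - eps) * (L * n%:R ^+ 3).
    by rewrite ler_wpM2l // ltW.
  have -> : (1 - eps) * (ex_number n M)%:R = (1 - eps) * (6 * (ex_number n M)%:R) / 6 by field.
  move: h6; have -> : (1 - eps) * (L * n%:R ^+ 3) = L * n%:R ^+ 3 - L * (eps * n%:R ^+ 3) by ring.
  by lra.
have HNi i : exists p : 'I_s * hypergraph 3 n, isomorphic (S n p.1) p.2 /\
    (edit_distance (blowup G i (chi n i)) p.2)%:R <= delta * n%:R ^+ 3.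
  have free_i : hfamily_free M (blowup G i (chi n i)) by exact: blowup_free.
  have [i' [K [h1 h2]]] := HN n nN0 _ free_i (large i).
  by exists (i', K).
have {HNi} /boolp.choice[F HF] := HNi.
have inj : injective (fun i => (F i).1).
  move=> i j eij; have [iso_i di] := HF i; have [iso_j dj] := HF j.
  rewrite -eij in iso_j.
  apply: (close_blowups_eq (c := c / 2) (delta := delta) _ _ _ _ iso_i iso_j di dj).
  - by rewrite -(ltr_nat R).
  - by rewrite divr_ge0 // ltW.
  - exact: ltW.
  - move=> a; have := near n i a; rewrite ler_norml => /andP[+ _].
    have : c * n%:R <= xs i a * n%:R by rewrite ler_pM2r.
    by lra.
  - apply: le_lt_trans deltaE; rewrite ler_pM2r ?mulr_gt0 //.
    by apply: lerXn2r; rewrite ?nnegrE ?lerDl // (ltW kp).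
have := leq_card _ inj; by rewrite !card_ord leqNgt st.
Qed.

Lemma stability_numberE : stability_number R M = Some t.
Proof.
have tM : `[< (1 <= t)%N /\ s_stable R t M >].
  by apply/asboolP; split=> //; exact: (t_stable t_gt0 gP).
rewrite /stability_number; case: pselect => [ex|]; last by case; exists t.
congr Some; case: ex_minnP => s /asboolP[s1 sM] smin.
apply/eqP; rewrite eqn_leq smin //= leqNgt; apply/negP => st.
exact: not_stable st sM.
Qed.

End StabilityLower.

(** * Quantitative uniqueness of the maximizer *)

Lemma common_lower_bound (R : realType) (I : finType) (e : I -> R) :
  (forall i, 0 < e i) -> exists2 eps, 0 < eps & forall i, eps <= e i.
Proof.
move=> e0; exists (\big[Num.min/1]_i e i); first exact: lt_bigmin.
by move=> i; exact: bigmin_le_cond.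
Qed.

Section Modulus.
Variables (R : realType) (k : nat) (g : 'I_k -> 'I_k -> 'I_k -> bool).
Variables (L : R) (xs : 'I_k -> R).
Hypothesis opt_unique : forall x : 'I_k -> R, (forall a, 0 <= x a) ->
  \sum_a x a <= 1 -> L <= lagrangian g x -> x =1 xs.

Let f (v : 'rV[R]_k) : R := lagrangian g (v ord0).

Lemma sum_continuous_rV (I : finType) (F : I -> 'rV[R]_k -> R) :
  (forall i, continuous (F i)) -> continuous (fun v => \sum_i F i v).
Proof. by move=> cF; apply: continuous_big => [|i _]; [exact: (@add_continuous R^o)|exact: cF]. Qed.

Lemma mul_continuous_rV (p q : 'rV[R]_k -> R) :
  continuous p -> continuous q -> continuous (fun v => p v * q v).
Proof. by move=> cp cq v; exact: continuousM (cp v) (cq v). Qed.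

Lemma lagrangian_continuous : continuous f.
Proof.
have c0 u : continuous (fun x : 'rV[R]_k => x ord0 u) by exact: coord_continuous.
have c1 u v : continuous (fun x : 'rV[R]_k => codeg_form g (x ord0) u v).
  apply: sum_continuous_rV => w; apply: mul_continuous_rV; first exact: c0.
  exact: cst_continuous.
have c2 u : continuous (fun x : 'rV[R]_k => link_form g (x ord0) u).
  by apply: sum_continuous_rV => v; apply: mul_continuous_rV; [exact: c0|exact: c1].
by apply: sum_continuous_rV => u; apply: mul_continuous_rV; [exact: c0|exact: c2].
Qed.

(** On the compact set of weightings whose coordinate a is at least eta off, the
    form attains its maximum, which is below L by uniqueness. *)
Lemma modulus_coord a eta : 0 < eta -> exists2 eps, 0 < eps &
  forall x : 'I_k -> R, (forall b, 0 <= x b) -> \sum_b x b <= 1 ->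
  L - eps <= lagrangian g x -> `|x a - xs a| <= eta.
Proof.
move=> eta0.
pose A : set 'rV[R]_k := ([set v | forall i, `[0, 1]%classic (v ord0 i)] `&`
  ([set v | \sum_b v ord0 b <= 1] `&` [set v | eta <= `|v ord0 a - xs a|]))%classic.
have cN : continuous (fun v : 'rV[R]_k => `|v ord0 a - xs a|).
  have cB : continuous (fun v : 'rV[R]_k => v ord0 a - xs a).
    move=> v; apply: (@continuousB _ R^o); first exact: coord_continuous.
    exact: cst_continuous.
  by move=> v; exact: (continuous_comp (cB v) (@norm_continuous R R^o _)).
have cP : closed [set v : 'rV[R]_k | forall i, `[0, 1]%classic (v ord0 i)]%classic.
  have -> : [set v : 'rV[R]_k | forall i, `[0, 1]%classic (v ord0 i)]%classic =
     (\bigcap_i [set v : 'rV[R]_k | `[0, 1]%classic (v ord0 i)])%classic.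
    by apply/seteqP; split=> [v hv i _|v hv i]; [exact: hv|exact: hv].
  apply: closed_bigI => i _; apply: preimage_closed.
    by apply: in1W; exact: coord_continuous.
  exact: itv_closed.
have cA : compact A.
  apply: (@subclosed_compact _ _ [set v : 'rV[R]_k | forall i, `[0, 1]%classic (v ord0 i)]%classic).
  - apply: closedI.
      exact: cP.
    apply: closedI.
      apply: (@preimage_closed _ _ (fun v : 'rV[R]_k => \sum_b v ord0 b) [set y | y <= 1]%classic).
        by apply: in1W; apply: sum_continuous_rV => b; exact: coord_continuous.
      exact: closed_le.
    apply: (@preimage_closed _ _ (fun v : 'rV[R]_k => `|v ord0 a - xs a|) [set y | eta <= y]%classic).
      by apply: in1W; exact: cN.
    exact: closed_ge.
  - exact: (@rV_compact R k (fun=> `[0, 1]%classic) (fun=> @segment_compact R 0 1)).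
  - by move=> v [].
have inA (x : 'I_k -> R) : (forall b, 0 <= x b) -> \sum_b x b <= 1 ->
    ~ `|x a - xs a| <= eta -> A (\row_b x b).
  move=> x0 x1 far; split; last split => /=.
  - move=> i; rewrite mxE /= in_itv /= x0 /=; apply: le_trans x1.
    exact: le_total.
  - by under eq_bigr do rewrite mxE.
  - by rewrite mxE ltW // ltNge; apply/negP.
have fE (x : 'I_k -> R) : f (\row_b x b) = lagrangian g x.
  by apply: eq_lagrangian => b; rewrite mxE.
have [A0|/set0P/negP] := pselect (A !=set0)%classic; last first.
  rewrite negbK => /eqP A0; exists 1 => // x x0 x1 _.
  by apply: contrapT => /(inA _ x0 x1); rewrite A0.
have [v vA vmax] := EVT_max_rV A0 cA (continuous_subspaceT lagrangian_continuous).
move: vA; rewrite inE => -[v01 [v1 vfar]].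
have v0 b : 0 <= v ord0 b by have := v01 b; rewrite /= in_itv /= => /andP[].
have fvL : f v < L.
  rewrite ltNge; apply/negP => /(opt_unique v0 v1) e.
  by move: vfar; rewrite /= e subrr normr0 leNgt eta0.
exists ((L - f v) / 2); first by rewrite divr_gt0 // subr_gt0.
move=> x x0 x1 big; apply: contrapT => /(inA _ x0 x1) xA.
by have := vmax _ (mem_set xA); rewrite fE; lra.
Qed.

Lemma modulus eta : 0 < eta -> exists2 eps, 0 < eps &
  forall x : 'I_k -> R, (forall b, 0 <= x b) -> \sum_b x b <= 1 ->
  L - eps <= lagrangian g x -> forall a, `|x a - xs a| <= eta.
Proof.
move=> eta0.
have /boolp.choice[e he] : forall a, exists e, 0 < e /\
  forall x : 'I_k -> R, (forall b, 0 <= x b) -> \sum_b x b <= 1 ->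
  L - e <= lagrangian g x -> `|x a - xs a| <= eta.
  by move=> a; have [e e0 H] := modulus_coord a eta0; exists e.
have [eps eps0 le_eps] := common_lower_bound (fun a => (he a).1).
exists eps => // x x0 x1 big a; apply: (he a).2 => //.
by apply: le_trans big; rewrite lerD2l lerN2.
Qed.

End Modulus.

(** * The patterns *)

Section Graph.
Variables (m i : nat).

(** The two perfect matchings of 'I_4: {0,1},{2,3} for true and {0,2},{1,3} for
    false; two elements are matched when they lie on the same side. *)
Definition side (b : bool) (y : 'I_4) : nat := if b then y./2 else odd y.

Definition removed (u v w : 'I_m + 'I_4) : bool :=
  match u, v, w with
  | inl a, inr y, inr z => side (a <= i)%N y == side (a <= i)%N z
  | _, _, _ => false
  end.

(** The vertices a <= i of the first part use the matching true, the others the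
    matching false. *)
Definition pattern (u v w : 'I_m + 'I_4) : bool :=
  [&& u != v, u != w, v != w &
      ~~ [|| removed u v w, removed v u w | removed w u v]].

Lemma removedC u v w : removed u v w = removed u w v.
Proof. by case: u v w => [a|x] [b|y] [c|z] //=; rewrite eq_sym. Qed.

Lemma pattern_system : triple_system pattern.
Proof.
rewrite /pattern; split=> [u v w|u v w|u v]; last by rewrite eqxx.
  rewrite [v == u]eq_sym (removedC w v u); case: (u == v); case: (u == w); case: (v == w) => //=.
  by rewrite orbCA.
rewrite [w == v]eq_sym (removedC u w v); case: (u == v); case: (u == w); case: (v == w) => //=.
by rewrite (orbC (removed w u v)) (removedC v) (removedC w).
Qed.

Lemma pattern_cover u v : (1 < m)%N -> u != v -> adjacent pattern u v.
Proof.
move=> m1; wlog: u v / match u, v with inr _, inl _ => false | _, _ => true end.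
  move=> H uv; case: u v uv (H u v) => [a|y] [b|z] // uv; try by apply.
  by move=> _; rewrite (adjacentC _ _ pattern_system); apply: H => //; rewrite eq_sym.
case: u v => [a|y] [b|z] // _ uv; apply/existsP.
- by exists (inr ord0); rewrite /pattern uv.
- have [c ca] : exists c : 'I_m, c != a.
    have : ~~ (finset.setT \subset [set a]).
      by apply/negP => /subset_leq_card; rewrite cardsT card_ord cards1 leqNgt m1.
    by move/subsetPn => [c _]; rewrite inE; exists c.
  exists (inl c); rewrite /pattern /= andbT.
  by apply: contra ca => /eqP[->].
- have [c /andP[cy cz]] : exists c : 'I_4, (c != y) && (c != z).
    have : ~~ (finset.setT \subset [set y; z]).
      by apply/negP => /subset_leq_card; rewrite cardsT card_ord cards2; case: (y != z).
    by move/subsetPn => [c _]; rewrite !inE negb_or; exists c.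
  exists (inr c); rewrite /pattern uv /=.
  by apply/andP; split; [apply: contra cy|rewrite andbT; apply: contra cz] => /eqP[->].
Qed.

Section Value.
Variables (R : realType) (x : 'I_m + 'I_4 -> R).

Let S := \sum_u x u.
Let p2 := \sum_u x u ^+ 2.
Let p3 := \sum_u x u ^+ 3.
Let y (b : 'I_4) := x (inr b).

Lemma pattern_natr u v w : (pattern u v w)%:R =
  1 - (u == v)%:R - (u == w)%:R - (v == w)%:R + 2 * ((u == v)%:R * (u == w)%:R)
  - (removed u v w && (v != w))%:R - (removed v u w && (u != w))%:R
  - (removed w u v && (u != v))%:R :> R.
Proof.
have r1 p q : removed p p q = false by case: p.
have r2 p q : removed p q p = false by rewrite removedC r1.
rewrite /pattern; have [<-|uv] := eqVneq u v; have [<-|uw] := eqVneq u w.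
- by rewrite !r1 /=; ring.
- by rewrite !r1 /= ?andbF ?andbT /=; ring.
- by rewrite [v == u]eq_sym (negPf uv) !r1 r2 /= ?andbF ?andbT /=; ring.
have [<-|vw] := eqVneq v w.
  by rewrite !r2 /= ?andbF ?andbT /=; ring.
by case: (u) (v) (w) => [a|b] [a'|b'] [a''|b''] //=; try case: eqP => _ /=; ring.
Qed.

Lemma sum_delta (I : finType) (F : I -> R) a : \sum_u F u * (a == u)%:R = F a.
Proof.
by rewrite (bigD1 a) //= eqxx mulr1 big1 ?addr0 // => b /negPf; rewrite eq_sym => ->; rewrite mulr0.
Qed.

Lemma sum_side (b : bool) : \sum_(c < 4) \sum_(d < 4) y c * y d *
    ((side b c == side b d) && (c != d))%:R =
  2 * (if b then y 0 * y 1 + y 2 * y 3 else y 0 * y 2 + y 1 * y 3).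
Proof.
rewrite !big_ord_recl !big_ord0.
have -> : lift ord0 (lift ord0 (lift ord0 ord0)) = 3 :> 'I_4 by exact: val_inj.
have -> : lift ord0 (lift ord0 ord0) = 2 :> 'I_4 by exact: val_inj.
have -> : lift ord0 ord0 = 1 :> 'I_4 by exact: val_inj.
have -> : ord0 = 0 :> 'I_4 by exact: val_inj.
by case: b; rewrite /side /=; ring.
Qed.

Definition pair_weight (b : bool) :=
  if b then y 0 * y 1 + y 2 * y 3 else y 0 * y 2 + y 1 * y 3.

(** The first three terms are the form of the complete 3-graph, written with power
    sums by inclusion and exclusion over coincidences of the indices. *)
Lemma lagrangian_pattern : lagrangian pattern x =
  S ^+ 3 - 3 * S * p2 + 2 * p3 -
  6 * \sum_(a < m) x (inl a) * pair_weight (a <= i)%N.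
Proof.
rewrite lagrangianE.
pose M u v w : R := x u * x v * x w * (removed u v w && (v != w))%:R.
have M1 : \sum_u \sum_v \sum_w M u v w =
    2 * \sum_(a < m) x (inl a) * pair_weight (a <= i)%N.
  rewrite big_sumType /= [X in _ + X]big1 ?addr0; last first.
    by move=> b _; rewrite big1 // => v _; rewrite big1 // => w _; rewrite /M /= mulr0.
  rewrite mulr_sumr; apply: eq_bigr => a _.
  rewrite big_sumType /= [X in X + _]big1 ?add0r; last first.
    by move=> b _; rewrite big1 // => w _; rewrite /M /= mulr0.
  rewrite mulrCA -sum_side mulr_sumr; apply: eq_bigr => c _.
  rewrite big_sumType /= [X in X + _]big1 ?add0r; last first.
    by move=> b _; rewrite /M /= mulr0.
  rewrite mulr_sumr; apply: eq_bigr => d _; rewrite /M /= !mulrA.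
  by congr (_ * (_ && _)%:R).
have M2 : \sum_u \sum_v \sum_w M v u w = \sum_u \sum_v \sum_w M u v w.
  by rewrite exchange_big.
have M3 : \sum_u \sum_v \sum_w M w u v = \sum_u \sum_v \sum_w M u v w.
  by rewrite -M2; apply: eq_bigr => u _; rewrite exchange_big.
have T0 : \sum_u \sum_v \sum_w x u * x v * x w = S ^+ 3.
  under eq_bigr do under eq_bigr do rewrite -mulr_sumr.
  under eq_bigr do rewrite -mulr_suml -mulr_sumr.
  by rewrite -mulr_suml -mulr_suml -/S; ring.
have T1 : \sum_u \sum_v \sum_w x u * x v * x w * (u == v)%:R = S * p2.
  under eq_bigr do under eq_bigr do rewrite -mulr_suml -mulr_sumr -/S.
  rewrite mulr_sumr; apply: eq_bigr => u _.
  by rewrite (sum_delta (fun v => x u * x v * S)); ring.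
have T2 : \sum_u \sum_v \sum_w x u * x v * x w * (u == w)%:R = S * p2.
  by rewrite -T1; apply: eq_bigr => u _; rewrite exchange_big /=; do 2!apply: eq_bigr => ? _; ring.
have T3 : \sum_u \sum_v \sum_w x u * x v * x w * (v == w)%:R = S * p2.
  rewrite mulr_suml; apply: eq_bigr => u _; rewrite mulr_sumr; apply: eq_bigr => v _.
  by rewrite (sum_delta (fun w => x u * x v * x w)); ring.
have T4 : \sum_u \sum_v \sum_w x u * x v * x w * ((u == v)%:R * (u == w)%:R) = p3.
  apply: eq_bigr => u _.
  under eq_bigr do under eq_bigr do rewrite mulrA.
  under eq_bigr do rewrite (sum_delta (fun w => x u * x _ * x w * _)).
  by rewrite (sum_delta (fun v => x u * x v * x u)); ring.
rewrite [RHS](_ : _ = S ^+ 3 - S * p2 - S * p2 - S * p2 + 2 * p3 -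
   \sum_u \sum_v \sum_w M u v w - \sum_u \sum_v \sum_w M v u w -
   \sum_u \sum_v \sum_w M w u v); last by rewrite M2 M3 M1; ring.
rewrite -T0 -{1}T1 -{1}T2 -T3 -T4.
rewrite mulr_sumr -!sumrB -big_split -!sumrB /=; apply: eq_bigr => u _.
rewrite mulr_sumr -!sumrB -big_split -!sumrB /=; apply: eq_bigr => v _.
rewrite mulr_sumr -!sumrB -big_split -!sumrB /=; apply: eq_bigr => w _.
by rewrite pattern_natr /M; ring.
Qed.

End Value.
End Graph.

(** * The common Lagrangian of the patterns *)

Section Optimum.
Variables (R : realType) (m : nat).
Hypothesis m4 : (4 <= m)%N.

Let M : R := m%:R.
Let M4 : 4 <= M. Proof. by rewrite /M ler_nat. Qed.
Let M0 : 0 < M. Proof. by apply: lt_le_trans M4. Qed.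

Definition root_disc : R := Num.sqrt (m%:R ^+ 2 - 3 * m%:R + 3).

(** The positive root of the derivative of [profile], with the radical in the
    denominator. *)
Definition opt_alpha : R := m%:R / (4 * root_disc - 3 * m%:R + 8).

(** The value of the form when the weight a is spread evenly over the first part
    and 1 - a evenly over the second one. *)
Definition profile (a : R) : R :=
  3 / 8 + 3 / 8 * a + (9 / 8 - 3 / m%:R) * a ^+ 2 + (2 / m%:R ^+ 2 - 7 / 8) * a ^+ 3.

Definition opt_value : R := profile opt_alpha.

Lemma root_disc_sqr : root_disc ^+ 2 = M ^+ 2 - 3 * M + 3.
Proof.
rewrite sqr_sqrtr // -/M.
have : 0 <= M * (M - 4) by rewrite mulr_ge0 ?subr_ge0 // ltW.
by have := M4; rewrite expr2; lra.
Qed.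

Lemma root_disc_gt : M - 2 < root_disc.
Proof.
have r0 : 0 <= root_disc by exact: sqrtr_ge0.
rewrite ltNge; apply/negP => le.
have : root_disc ^+ 2 <= (M - 2) ^+ 2 by rewrite lerXn2r ?nnegrE // subr_ge0; have := M4; lra.
by rewrite root_disc_sqr; have := M4; lra.
Qed.

Let omega_gt : M < 4 * root_disc - 3 * M + 8.
Proof. by have := root_disc_gt; lra. Qed.

Let omega0 : 0 < 4 * root_disc - 3 * M + 8.
Proof. by apply: lt_trans omega_gt. Qed.

Lemma opt_alpha_gt0 : 0 < opt_alpha.
Proof. by rewrite divr_gt0. Qed.

Lemma opt_alpha_lt1 : opt_alpha < 1.
Proof. by rewrite ltr_pdivrMr // mul1r. Qed.

Lemma opt_alpha_crit : 3 / 8 + 2 * (9 / 8 - 3 / M) * opt_alpha +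
  3 * (2 / M ^+ 2 - 7 / 8) * opt_alpha ^+ 2 = 0.
Proof.
have w0 : 4 * root_disc - 3 * M + 8 != 0 by rewrite gt_eqF.
have M1 : M != 0 by rewrite gt_eqF.
rewrite /opt_alpha -/M.
have -> : 3 / 8 + 2 * (9 / 8 - 3 / M) * (M / (4 * root_disc - 3 * M + 8)) +
  3 * (2 / M ^+ 2 - 7 / 8) * (M / (4 * root_disc - 3 * M + 8)) ^+ 2 =
  6 * (root_disc ^+ 2 - (M ^+ 2 - 3 * M + 3)) / (4 * root_disc - 3 * M + 8) ^+ 2.
  by field; rewrite w0 M1.
by rewrite root_disc_sqr subrr mulr0 mul0r.
Qed.

Lemma lead_neg : 2 / M ^+ 2 - 7 / 8 < 0.
Proof.
rewrite subr_lt0 ltr_pdivrMr ?exprn_gt0 //.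
have : 4 * 4 <= M ^+ 2 by rewrite expr2 ler_pM.
lra.
Qed.

(** The difference of a cubic and its value at a critical point has a double root
    there. *)
Lemma profileB a : opt_value - profile a =
  - ((a - opt_alpha) ^+ 2 * ((2 / M ^+ 2 - 7 / 8) * (a + 2 * opt_alpha) + (9 / 8 - 3 / M))).
Proof.
have := opt_alpha_crit; rewrite /opt_value /profile -/M.
move: (9 / 8 - 3 / M) (2 / M ^+ 2 - 7 / 8) opt_alpha => c2 c3 b crit.
have c1 : 3 / 8 = - (2 * c2 * b + 3 * c3 * b ^+ 2) by lra.
by rewrite c1; ring.
Qed.

Lemma bracket_neg a : 0 <= a ->
  (2 / M ^+ 2 - 7 / 8) * (a + 2 * opt_alpha) + (9 / 8 - 3 / M) < 0.
Proof.
move=> a0; have := opt_alpha_crit; have := lead_neg; have := opt_alpha_gt0.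
move: (9 / 8 - 3 / M) (2 / M ^+ 2 - 7 / 8) opt_alpha => c2 c3 b b0 c3n crit.
have h1 : b * (2 * c2 + 3 * c3 * b) < 0.
  have -> : b * (2 * c2 + 3 * c3 * b) = - (3 / 8) by rewrite expr2 in crit; lra.
  by rewrite oppr_lt0 divr_gt0.
have h2 : 2 * c2 + 3 * c3 * b < 0 by move: h1; rewrite pmulr_rlt0.
have h3 : c3 * b < 0 by rewrite nmulr_rlt0.
have h4 : c3 * a <= 0 by rewrite nmulr_rle0.
by rewrite mulrDr; lra.
Qed.

Lemma profile_le a : 0 <= a -> profile a <= opt_value.
Proof.
move=> a0; rewrite -subr_ge0 profileB oppr_ge0 mulr_ge0_le0 ?sqr_ge0 //.
by rewrite ltW // bracket_neg.
Qed.

Lemma profile_eq a : 0 <= a -> opt_value <= profile a -> a = opt_alpha.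
Proof.
move=> a0 le; apply/eqP; rewrite -subr_eq0 -sqrf_eq0 eq_le sqr_ge0 andbT.
have : opt_value - profile a <= 0 by rewrite subr_le0.
by rewrite profileB oppr_le0 nmulr_lge0 // bracket_neg.
Qed.

Section Bound.
Variables (i : nat) (x : 'I_m + 'I_4 -> R).
Hypothesis x0 : forall u, 0 <= x u.
Hypothesis x1 : \sum_u x u = 1.

Let A (a : 'I_m) := x (inl a).
Let y (b : 'I_4) := x (inr b).
Let al := \sum_a A a.
Let mu := al / M.
Let X1 := \sum_(a < m | (a <= i)%N) A a.
Let X2 := \sum_(a < m | ~~ (a <= i)%N) A a.

Definition deficit_A := \sum_(a < m) (x (inl a) - mu) ^+ 2 * (3 - 4 * mu - 2 * x (inl a)).
Definition deficit_AB := 3 / 2 * X1 * (y 0 + y 1 - y 2 - y 3) ^+ 2 +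
  3 / 2 * X2 * (y 0 + y 2 - y 1 - y 3) ^+ 2.
Definition deficit_B := 6 * ((y 2 + y 3) * (y 0 - y 1) ^+ 2 / 4 +
   (y 0 + y 1) * (y 2 - y 3) ^+ 2 / 4 +
   (y 0 + y 1 + y 2 + y 3) * (y 0 + y 1 - y 2 - y 3) ^+ 2 / 16).

Lemma sum4 (F : 'I_4 -> R) : \sum_b F b = F 0 + F 1 + F 2 + F 3.
Proof.
rewrite !big_ord_recl big_ord0.
have -> : lift ord0 (lift ord0 (lift ord0 ord0)) = 3 :> 'I_4 by exact: val_inj.
have -> : lift ord0 (lift ord0 ord0) = 2 :> 'I_4 by exact: val_inj.
have -> : lift ord0 ord0 = 1 :> 'I_4 by exact: val_inj.
have -> : ord0 = 0 :> 'I_4 by exact: val_inj.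
by ring.
Qed.

Lemma al_split : al = X1 + X2.
Proof. by rewrite /al (bigID (fun a : 'I_m => (a <= i)%N)). Qed.

Lemma beta_al : y 0 + y 1 + y 2 + y 3 = 1 - al.
Proof. by rewrite -(sum4 y) -x1 big_sumType /= /al /A addrAC subrr add0r. Qed.

Lemma deficit_AE : deficit_A =
  3 * (\sum_a A a ^+ 2) - 2 * (\sum_a A a ^+ 3) - 3 * al ^+ 2 / M + 2 * al ^+ 3 / M ^+ 2.
Proof.
have M1 : M != 0 by rewrite gt_eqF.
transitivity (\sum_(a < m) (3 * A a ^+ 2 - 2 * A a ^+ 3 +
   (- 6 * mu + 6 * mu ^+ 2) * A a + (3 * mu ^+ 2 - 4 * mu ^+ 3))).
  by apply: eq_bigr => a _; rewrite /A; ring.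
have ec c : \sum_(a < m) c = c * M :> R by rewrite sumr_const card_ord mulr_natr.
rewrite big_split /= ec 2!big_split /= sumrN -!mulr_sumr -/al.
by rewrite /mu; field.
Qed.

(** The three deficits measure how uneven the weights are in the first part, between
    the two edges of the assigned matchings, and inside the second part. *)
Lemma deficitE : lagrangian (pattern i) x + (deficit_A + deficit_AB + deficit_B) = profile al.
Proof.
have M1 : M != 0 by rewrite gt_eqF.
rewrite lagrangian_pattern x1 deficit_AE !big_sumType /= !sum4.
have -> : \sum_(a < m) x (inl a) * pair_weight x (a <= i)%N =
   X1 * (y 0 * y 1 + y 2 * y 3) + X2 * (y 0 * y 2 + y 1 * y 3).
  rewrite (bigID (fun a : 'I_m => (a <= i)%N)) /= /X1 /X2 !mulr_suml.
  by congr (_ + _); apply: eq_bigr => a h; rewrite /pair_weight ?h // (negPf h).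
rewrite -/(y 0) -/(y 1) -/(y 2) -/(y 3).
have e3 : y 3 = 1 - al - y 0 - y 1 - y 2 by have := beta_al; lra.
have eX : X2 = al - X1 by rewrite al_split; ring.
rewrite /deficit_AB /deficit_B eX e3 /profile -/M.
move: (\sum_i0 x (inl i0) ^+ 2) (\sum_i0 x (inl i0) ^+ 3) => P2 P3.
by field.
Qed.

Lemma al_ge0 : 0 <= al.
Proof. by apply: sumr_ge0 => a _; exact: x0. Qed.

Lemma al_le1 : al <= 1.
Proof.
by rewrite -subr_ge0 -beta_al !addr_ge0 // /y x0.
Qed.

Lemma A_le_al a : A a <= al.
Proof. by rewrite /al (bigD1 a) //= lerDl sumr_ge0 // => b _; exact: x0. Qed.

Lemma mu_le : 4 * mu <= al.
Proof.
by rewrite /mu mulrA ler_pdivrMr // mulrC ler_wpM2l // al_ge0.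
Qed.

Lemma deficit_A_ge0 a : 0 <= (x (inl a) - mu) ^+ 2 * (3 - 4 * mu - 2 * x (inl a)).
Proof.
rewrite mulr_ge0 ?sqr_ge0 //; have := mu_le; have := A_le_al a; have := al_le1.
by rewrite /A; lra.
Qed.

Lemma deficit_AB_ge0 : 0 <= deficit_AB.
Proof.
have X10 : 0 <= X1 by apply: sumr_ge0 => a _; exact: x0.
have X20 : 0 <= X2 by apply: sumr_ge0 => a _; exact: x0.
by rewrite /deficit_AB addr_ge0 //; apply: mulr_ge0; rewrite ?sqr_ge0 // mulr_ge0.
Qed.

Let y0 b : 0 <= y b. Proof. exact: x0. Qed.

Let d1 := (y 2 + y 3) * (y 0 - y 1) ^+ 2.
Let d2 := (y 0 + y 1) * (y 2 - y 3) ^+ 2.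
Let d3 := (y 0 + y 1 + y 2 + y 3) * (y 0 + y 1 - y 2 - y 3) ^+ 2.

Lemma deficit_B_parts : [/\ 0 <= d1, 0 <= d2, 0 <= d3 &
  deficit_B = 6 * d1 / 4 + 6 * d2 / 4 + 6 * d3 / 16].
Proof.
split; last by rewrite /deficit_B /d1 /d2 /d3; field.
all: by apply: mulr_ge0; rewrite ?sqr_ge0 ?addr_ge0.
Qed.

Lemma pattern_le1 : lagrangian (pattern i) x <= opt_value.
Proof.
apply: le_trans (profile_le al_ge0); rewrite -deficitE lerDl.
have dA : 0 <= deficit_A by apply: sumr_ge0 => a _; exact: deficit_A_ge0.
by have [? ? ? ->] := deficit_B_parts; have := deficit_AB_ge0; lra.
Qed.

Lemma pattern_eq1 : opt_value <= lagrangian (pattern i) x ->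
  [/\ forall a, x (inl a) = opt_alpha / M & forall b, x (inr b) = (1 - opt_alpha) / 4].
Proof.
move=> le.
have dA : 0 <= deficit_A by apply: sumr_ge0 => a _; exact: deficit_A_ge0.
have dAB := deficit_AB_ge0.
have [n1 n2 n3 dB] := deficit_B_parts.
have dE := deficitE; have pl := profile_le al_ge0.
have alE : al = opt_alpha by apply: profile_eq al_ge0 _; lra.
have al1 : al < 1 by rewrite alE opt_alpha_lt1.
have z3 : d3 = 0 by lra.
have z2 : d2 = 0 by lra.
have z1 : d1 = 0 by lra.
have zA : deficit_A = 0 by lra.
have be := beta_al.
have be0 : 0 < y 0 + y 1 + y 2 + y 3 by rewrite be subr_gt0.
move/eqP: z3; rewrite mulf_eq0 gt_eqF //= sqrf_eq0 => /eqP z3.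
move/eqP: z2; rewrite mulf_eq0 gt_eqF /=; last by lra.
rewrite sqrf_eq0 => /eqP z2.
move/eqP: z1; rewrite mulf_eq0 gt_eqF /=; last by lra.
rewrite sqrf_eq0 => /eqP z1.
split=> [a|b].
  have := @psumr_eq0P _ _ _ _ (fun a _ => deficit_A_ge0 a) zA a isT.
  move/eqP; rewrite mulf_eq0 [X in _ || X]gt_eqF ?orbF; last first.
    by have := mu_le; have := A_le_al a; rewrite /A; lra.
  by rewrite sqrf_eq0 subr_eq0 -alE => /eqP.
rewrite -alE -be -/(y b).
have [e0 e1 e2 e3] : [/\ y 0 = (y 0 + y 1 + y 2 + y 3) / 4,
  y 1 = (y 0 + y 1 + y 2 + y 3) / 4, y 2 = (y 0 + y 1 + y 2 + y 3) / 4 &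
  y 3 = (y 0 + y 1 + y 2 + y 3) / 4] by split; lra.
case: b => [[|[|[|[|//]]]] lt]; set b := Ordinal lt.
- by rewrite (_ : b = 0) //; exact: val_inj.
- by rewrite (_ : b = 1) //; exact: val_inj.
- by rewrite (_ : b = 2) //; exact: val_inj.
- by rewrite (_ : b = 3) //; exact: val_inj.
Qed.

End Bound.

Definition opt_weight (u : 'I_m + 'I_4) : R :=
  if u is inl _ then opt_alpha / M else (1 - opt_alpha) / 4.

Lemma opt_weight_gt0 u : 0 < opt_weight u.
Proof.
by case: u => [a|b]; rewrite /= divr_gt0 ?opt_alpha_gt0 // subr_gt0 opt_alpha_lt1.
Qed.

Lemma opt_weight_sum : \sum_u opt_weight u = 1.
Proof.
have M1 : M != 0 by rewrite gt_eqF.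
rewrite big_sumType /= !sumr_const !card_ord -[_ *+ m]mulr_natr -[_ *+ 4]mulr_natr.
by rewrite -/M !divfK // addrC subrK.
Qed.

Lemma pattern_opt i : lagrangian (pattern i) opt_weight = opt_value.
Proof.
have M1 : M != 0 by rewrite gt_eqF.
have alE : \sum_(a < m) opt_weight (inl a) = opt_alpha.
  by rewrite sumr_const card_ord -[LHS]mulr_natr -/M divfK.
rewrite /opt_value -[in RHS]alE -(deficitE i opt_weight_sum).
rewrite [deficit_A _]big1; last by move=> a _; rewrite alE subrr expr0n mul0r.
by rewrite /deficit_AB /deficit_B /=; field.
Qed.

Lemma opt_value_gt0 : 0 < opt_value.
Proof.
apply: lt_le_trans (profile_le (lexx 0)).
by rewrite /profile !expr0n /= !mulr0 !addr0 divr_gt0.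
Qed.

Lemma opt_value_lt1 : opt_value < 1.
Proof.
have a0 := opt_alpha_gt0; have a1 := opt_alpha_lt1.
have M1 : M != 0 by rewrite gt_eqF.
rewrite /opt_value /profile -/M -subr_gt0.
have -> : 1 - (3 / 8 + 3 / 8 * opt_alpha + (9 / 8 - 3 / M) * opt_alpha ^+ 2 +
   (2 / M ^+ 2 - 7 / 8) * opt_alpha ^+ 3) =
  (1 - opt_alpha) ^+ 2 * (5 / 8 + 7 / 8 * opt_alpha) +
  opt_alpha ^+ 2 / M + 2 * (opt_alpha ^+ 2 / M) * (1 - opt_alpha / M) by field.
have h : opt_alpha / M < 1 by rewrite ltr_pdivrMr // mul1r; have := M4; lra.
have p : 0 < opt_alpha ^+ 2 / M by rewrite divr_gt0 // exprn_gt0.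
rewrite addr_gt0 // ?addr_gt0 // mulr_gt0 ?exprn_gt0 ?subr_gt0 //; first by lra.
by rewrite mulr_gt0.
Qed.

Lemma pattern_le i (x : 'I_m + 'I_4 -> R) : (forall u, 0 <= x u) ->
  lagrangian (pattern i) x <= opt_value * (\sum_u x u) ^+ 3.
Proof.
move=> x0; set S := \sum_u x u.
have S0 : 0 <= S by exact: sumr_ge0.
have [S00|Sn] := eqVneq S 0.
  have xz u : x u = 0 by move: S00; rewrite /S => /psumr_eq0P -> // v _; exact: x0.
  rewrite (@eq_lagrangian _ _ _ x (fun u => 0 * x u)); last by move=> u; rewrite xz mul0r.
  by rewrite lagrangianZ S00 expr0n mul0r mulr0.
have Sp : 0 < S by rewrite lt_def Sn.
rewrite (@eq_lagrangian _ _ _ x (fun u => S * (x u / S))); last first.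
  by move=> u; rewrite mulrC divfK.
rewrite lagrangianZ mulrC ler_pM2r ?exprn_gt0 //; apply: pattern_le1.
  by move=> u; rewrite divr_ge0.
by rewrite -mulr_suml divff.
Qed.

(** Homogeneity excludes total weight below 1; for total weight 1 all deficits
    vanish and the weight of the first part is the maximizer of [profile]. *)
Lemma pattern_unique i (x : 'I_m + 'I_4 -> R) : (forall u, 0 <= x u) ->
  \sum_u x u <= 1 -> opt_value <= lagrangian (pattern i) x -> x =1 opt_weight.
Proof.
move=> x0 xle le; have S0 : 0 <= \sum_u x u by exact: sumr_ge0.
have S1 : \sum_u x u = 1.
  apply/eqP; rewrite eq_le xle /= leNgt; apply/negP => lt.
  have : opt_value <= opt_value * (\sum_u x u) ^+ 3 by apply: le_trans le (pattern_le i x0).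
  rewrite -[leLHS]mulr1 ler_pM2l ?opt_value_gt0 // leNgt => /negP; apply.
  by rewrite exprn_ilt1.
have [eA eB] := pattern_eq1 x0 S1 le.
by case=> [a|b] /=.
Qed.

End Optimum.

(** * Irrationality of the Lagrangian *)

Section Irrational.
Variable R : realType.

Definition israt (x : R) := exists q : rat, x = ratr q.

Lemma isratD x y : israt x -> israt y -> israt (x + y).
Proof. by move=> [p ->] [q ->]; exists (p + q); rewrite rmorphD. Qed.
Lemma isratN x : israt x -> israt (- x).
Proof. by move=> [p ->]; exists (- p); rewrite rmorphN. Qed.
Lemma isratM x y : israt x -> israt y -> israt (x * y).
Proof. by move=> [p ->] [q ->]; exists (p * q); rewrite rmorphM. Qed.
Lemma isratV x : israt x -> israt x^-1.
Proof. by move=> [p ->]; exists p^-1; rewrite fmorphV. Qed.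
Lemma israt_nat n : israt n%:R.
Proof. by exists n%:R; rewrite ratr_nat. Qed.

Lemma israt_sqr_nat (x : R) (D : nat) : israt x -> x ^+ 2 = D%:R ->
  exists n, D = (n ^ 2)%N.
Proof.
move=> [q ->] e.
have {e} : q ^+ 2 = D%:R.
  by apply: (fmorph_inj (ratr : rat -> R)); rewrite /= rmorphXn /= e ratr_nat.
case: (ratP q) => n d cop; rewrite expr_div_n => e; exists `|n|%N.
have e1 : n ^+ 2 = (D * d.+1 ^ 2)%N%:Z.
  apply: (@intr_inj rat); rewrite rmorphXn /= PoszM rmorphM /= -[RHS]/(D%:R * (d.+1 ^ 2)%N%:R).
  by rewrite -e natrX divfK // expf_neq0 // pnatr_eq0.
have {e1} e2 : (`|n| ^ 2 = D * d.+1 ^ 2)%N.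
  by have := congr1 absz e1; rewrite abszX absz_nat.
have cop2 : coprime (d.+1 ^ 2) (`|n| ^ 2).
  by rewrite coprimeXl // coprimeXr // coprime_sym.
have : (d.+1 ^ 2 %| 1 * `|n| ^ 2)%N by rewrite mul1n e2 dvdn_mull.
rewrite Gauss_dvdl // dvdn1 => /eqP d1.
by rewrite e2 d1 muln1.
Qed.

(** Modulo the quadratic equation of its argument, the value of the cubic is an
    affine function, with rational coefficients and positive slope, of the
    maximizer. A rational value would make the maximizer rational, hence also the
    square root of m^2 - 3m + 3, which is no square because it lies strictly
    between (m - 2)^2 and (m - 1)^2. *)
Lemma opt_value_irrational m : (4 <= m)%N -> irrational (opt_value R m / 6).
Proof.
move=> m4 [q _ qE].
have M4 : 4 <= m%:R :> R by rewrite ler_nat.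
have M0 : 0 < m%:R :> R by lra.
have M1 : m%:R != 0 :> R by rewrite gt_eqF.
set a := opt_alpha R m; set M : R := m%:R in M4 M0 M1.
have a0 : 0 < a by exact: opt_alpha_gt0.
have crit := opt_alpha_crit R m4; rewrite -/a -/M in crit.
have lead := lead_neg R m4; rewrite -/M in lead.
have v_rat : israt (opt_value R m).
  have -> : opt_value R m = ratr q * 6%:R by rewrite qE divfK.
  by apply: isratM; [exists q|exact: israt_nat].
have rat_m : israt M by exact: israt_nat.
pose c2 : R := 9%:R / 8%:R - 3%:R / M; pose c3 : R := 2%:R / M ^+ 2 - 7%:R / 8%:R.
have rdiv x y : israt x -> israt y -> israt (x / y).
  by move=> hx hy; apply: isratM => //; exact: isratV.
have c2_rat : israt c2 by apply: isratD; [|apply: isratN]; apply: (rdiv) => //; exact: israt_nat.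
have c3_rat : israt c3.
  apply: isratD; [|apply: isratN]; apply: (rdiv) => //; try exact: israt_nat.
  by rewrite expr2; exact: isratM.
pose slope : R := 1 / 4%:R + 2%:R / 9%:R * (c2 ^+ 2 / (- c3)).
have slope0 : 0 < slope.
  have c30 : 0 < - c3 by rewrite oppr_gt0.
  by rewrite ltr_wpDr ?divr_gt0 // mulr_ge0 ?divr_ge0 ?sqr_ge0 // ltW.
have aE : a = (opt_value R m - 3%:R / 8%:R + c2 / (24%:R * c3)) / slope.
  have c30 : c3 != 0 by rewrite lt_eqF.
  have slopeN : slope != 0 by rewrite gt_eqF.
  apply: (mulIf slopeN); rewrite divfK //.
  rewrite /opt_value /profile -/a -/M -/c2 -/c3 /slope.
  have a2 : a ^+ 2 = - (3 / 8 + 2 * c2 * a) / (3 * c3).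
    apply: (mulIf (x := 3 * c3)); first by rewrite mulf_neq0.
    by rewrite divfK ?mulf_neq0 //; move: crit; rewrite -/c2 -/c3; lra.
  have a3 : c3 * a ^+ 3 = - (3 / 8 * a + 2 * c2 * a ^+ 2) / 3.
    have := congr1 (fun z => a * z) crit; rewrite -/c2 -/c3 mulr0 => e.
    have -> : c3 * a ^+ 3 = a * (3 * c3 * a ^+ 2) / 3 by field.
    by have -> : a * (3 * c3 * a ^+ 2) = - (3 / 8 * a + 2 * c2 * a ^+ 2) by move: e; rewrite !mulrDr expr2; lra.
  by rewrite a3 a2; field.
have slope_rat : israt slope.
  apply: isratD; first by apply: (rdiv); [exact: (israt_nat 1)|exact: israt_nat].
  apply: isratM; first by apply: (rdiv); exact: israt_nat.
  by rewrite expr2; apply: (rdiv); [exact: isratM|exact: isratN].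
have a_rat : israt a.
  rewrite aE; apply: (rdiv) => //; apply: isratD.
    by apply: isratD => //; apply: isratN; apply: (rdiv); exact: israt_nat.
  by apply: (rdiv) => //; apply: isratM => //; exact: israt_nat.
have r_rat : israt (root_disc R m).
  have -> : root_disc R m = (M / a + 3%:R * M - 8%:R) / 4%:R.
    have w0 : 4 * root_disc R m - 3 * M + 8 != 0.
      by apply: contraTneq a0 => e; rewrite /a /opt_alpha e invr0 mulr0 ltxx.
    by rewrite /a /opt_alpha -/M; field; rewrite M1 w0.
  apply: (rdiv); last exact: israt_nat.
  apply: isratD; last by apply: isratN; exact: israt_nat.
  by apply: isratD; [exact: rdiv|apply: isratM => //; exact: israt_nat].
have [n nE] : exists n, (m ^ 2 + 3 - 3 * m = n ^ 2)%N.
  apply: (israt_sqr_nat r_rat); rewrite root_disc_sqr //.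
  rewrite natrB; last by nia.
  by rewrite natrD natrX natrM; ring.
have [le|lt] := leqP n (m - 2)%N.
  have : (n ^ 2 <= (m - 2) ^ 2)%N by rewrite leq_sqr.
  by nia.
have : ((m - 1) ^ 2 <= n ^ 2)%N by rewrite leq_sqr; lia.
by nia.
Qed.

End Irrational.

(** * Rigidity of the patterns *)

Section Rigidity.
Variables (m i j : nat) (s : 'I_m + 'I_4 -> 'I_m + 'I_4).
Hypothesis m5 : (4 < m)%N.
Hypothesis ij : (i.+1 + j.+1 < m)%N.
Hypothesis s_hom : forall u v w, pattern i u v w -> pattern j (s u) (s v) (s w).

Lemma side_separates (y z : 'I_4) : y != z ->
  ~~ ((side true y == side true z) && (side false y == side false z)).
Proof.
rewrite /side; apply: contraNN => /andP[/eqP h /eqP o]; apply/eqP/val_inj => /=.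
by rewrite -[y : nat]odd_double_half -[z : nat]odd_double_half h; congr (nat_of_bool _ + _)%N;
  case: (odd y) (odd z) o => [] [].
Qed.

Lemma side_partner b (y : 'I_4) : exists2 z, y != z & side b y == side b z.
Proof.
pose F b : 'I_4 -> 'I_4 := fun y => if b then (if odd y then inord y.-1 else inord y.+1)
  else (if (y < 2)%N then inord y.+2 else inord (y - 2)%N).
by exists (F b y); rewrite /F /side; case: b; case: y => [[|[|[|[|//]]]] lt] /=;
   rewrite ?inordK // -?(inj_eq val_inj) /= ?inordK.
Qed.

(** A homomorphism is bijective, and its inverse r maps removed triples to removed
    triples. Some vertex of the first part stays in it; its matching edges cover
    B, so r preserves B, hence also A. Since the two matchings
    have no common edge, r maps vertices of A with equal matchings to vertices with
    equal matchings, and the sizes of the two classes decide. *)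
Lemma pattern_hom_index : i = j.
Proof.
have sI : injective s.
  apply: (hom_inj _ _ s_hom) => [a b ab|b d]; first by apply: pattern_cover => //; lia.
  exact: (tsxx (pattern_system _ _)).
have [r rK Kr] := injF_bij sI.
have rI : injective r := can_inj Kr.
have r_hom u v w : u != v -> u != w -> v != w -> ~~ pattern j u v w ->
    ~~ pattern i (r u) (r v) (r w).
  by move=> _ _ _; apply: contra => /s_hom; rewrite !Kr.
have removedE k u v w : u != v -> u != w -> v != w ->
    ~~ pattern k u v w = [|| removed k u v w, removed k v u w | removed k w u v].
  by move=> uv uw vw; rewrite /pattern uv uw vw negbK.
have r_rem (a : 'I_m) (y z : 'I_4) : y != z -> side (a <= j)%N y == side (a <= j)%N z ->
   [|| removed i (r (inl a)) (r (inr y)) (r (inr z)),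
       removed i (r (inr y)) (r (inl a)) (r (inr z))
     | removed i (r (inr z)) (r (inl a)) (r (inr y))].
  move=> yz h; rewrite -removedE ?(inj_eq rI) //.
  by apply: r_hom => //; rewrite removedE //= h.
(* The injection r cannot send all m > 4 vertices of the first part into the
   second one. *)
have [a0 [a0' ra0]] : exists a a', r (inl a) = inl a'.
  apply: contrapT => no.
  pose f (a : 'I_m) : 'I_4 := if r (inl a) is inr y then y else 0.
  have fI : injective f.
    move=> a b; rewrite /f; case ra: (r (inl a)) => [a'|y].
      by case: no; exists a, a'.
    case rb: (r (inl b)) => [b'|z]; first by case: no; exists b, b'.
    by move=> yz; move: rb; rewrite -yz -ra => /rI[].
  by have := leq_card f fI; rewrite !card_ord leqNgt m5.
have rB y : exists y', r (inr y) = inr y'.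
  have [z yz h] := side_partner (a0 <= j)%N y.
  have := r_rem a0 y z yz h; rewrite ra0.
  by case: (r (inr y)) => [b|y']; [case: (r (inr z))|exists y'].
have /boolp.choice[rb rbE] := rB.
have rbI : injective rb by move=> y z e; have := rbE y; rewrite e -rbE => /rI[].
have rA a : exists a', r (inl a) = inl a'.
  case e: (r (inl a)) => [a'|y]; first by exists a'.
  have [q _ Kq] := injF_bij rbI.
  by move: e; rewrite -(Kq y) -rbE => /rI.
have /boolp.choice[ra raE] := rA.
have raI : injective ra by move=> a b e; have := raE a; rewrite e -raE => /rI[].
have ra_side (a : 'I_m) y z : y != z -> side (a <= j)%N y == side (a <= j)%N z ->
    side (ra a <= i)%N (rb y) == side (ra a <= i)%N (rb z).
  by move=> yz h; have := r_rem a y z yz h; rewrite !raE !rbE /= orbF.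
have same_type (a b : 'I_m) : (a <= j)%N = (b <= j)%N -> (ra a <= i)%N = (ra b <= i)%N.
  move=> e; have [z yz h] := side_partner (a <= j)%N 0.
  have ha := ra_side a _ _ yz h; rewrite e in h; have hb := ra_side b _ _ yz h.
  have := side_separates (y := rb 0) (z := rb z); rewrite (inj_eq rbI) => /(_ yz).
  by move: ha hb; case: (ra a <= i)%N; case: (ra b <= i)%N => // -> ->.
have m0 : (0 < m)%N by lia.
have jm : (j.+1 < m)%N by lia.
have card_le k : (k < m)%N -> #|[set a : 'I_m | (a <= k)%N]| = k.+1.
  move=> km; rewrite -sum1_card.
  rewrite (eq_bigl (fun a : 'I_m => (a < k.+1)%N)); last by move=> a; rewrite inE.
  by rewrite (big_ord_narrow km) sum1_card card_ord.
have card_ra : #|[set a : 'I_m | (ra a <= i)%N]| = i.+1.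
  rewrite -(card_le i); last by lia.
  rewrite -[LHS](card_imset _ raI); apply: eq_card => b.
  have [q _ Kq] := injF_bij raI.
  apply/imsetP/idP => [[a]|]; rewrite !inE; first by move=> h ->.
  by move=> h; exists (q b); rewrite ?inE Kq.
pose a1 := Ordinal m0; pose a2 := Ordinal jm.
have typeE a : (ra a <= i)%N = if (a <= j)%N then (ra a1 <= i)%N else (ra a2 <= i)%N.
  case: ifP => h; apply: same_type; rewrite h /=; first by [].
  by rewrite ltnn.
have cardC : #|[set a : 'I_m | ~~ (a <= j)%N]| = (m - j.+1)%N.
  have := cardsC [set a : 'I_m | (a <= j)%N]; rewrite card_ord card_le; last by lia.
  have -> : ~: [set a : 'I_m | (a <= j)%N] = [set a : 'I_m | ~~ (a <= j)%N].
    by apply/setP => a; rewrite !inE.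
  by lia.
have {card_ra} : #|[set a : 'I_m |
    if (a <= j)%N then (ra a1 <= i)%N else (ra a2 <= i)%N]| = i.+1.
  by rewrite -card_ra; apply: eq_card => a; rewrite !inE typeE.
case: (ra a1 <= i)%N; case: (ra a2 <= i)%N => h.
- have : #|[set: 'I_m]| = i.+1.
    by rewrite -h; apply: eq_card => a; rewrite !inE; case: (a <= j)%N.
  by rewrite cardsT card_ord; lia.
- have : #|[set a : 'I_m | (a <= j)%N]| = i.+1.
    by rewrite -h; apply: eq_card => a; rewrite !inE; case: (a <= j)%N.
  by rewrite card_le; lia.
- have : #|[set a : 'I_m | ~~ (a <= j)%N]| = i.+1.
    by rewrite -h; apply: eq_card => a; rewrite !inE; case: (a <= j)%N.
  by rewrite cardC; lia.
- have : #|@finset.set0 'I_m| = i.+1.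
    by rewrite -h; apply: eq_card => a; rewrite !inE; case: (a <= j)%N.
  by rewrite cards0.
Qed.

End Rigidity.

(** * The theorem *)

Section PatternGraphs.
Variables (R : realType) (t : nat).
Hypothesis t_gt0 : (0 < t)%N.

Let m := (3 * t + 1)%N.
Let m4 : (4 <= m)%N. Proof. by rewrite /m; lia. Qed.

Definition pattern_graph (i : 'I_t) : hypergraph 3 (m + 4) :=
  hypergraph_of (pull (@fintype.split m 4) (pattern i)).

Definition pattern_weight (_ : 'I_t) (u : 'I_(m + 4)) : R := opt_weight R (fintype.split u).

Lemma pattern_graphE i : htriples (pattern_graph i) = pull (@fintype.split m 4) (pattern i).
Proof. by apply: hypergraph_ofK; exact/triple_system_pull/pattern_system. Qed.

Lemma push_split (x : 'I_(m + 4) -> R) u : push (@fintype.split m 4) x u = x (unsplit u).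
Proof.
rewrite /push (big_pred1 (unsplit u)) // => v /=.
by apply/eqP/eqP => [<-|->]; rewrite ?splitK ?unsplitK.
Qed.

Lemma lagrangian_pattern_graph i (x : 'I_(m + 4) -> R) :
  lagrangian (htriples (pattern_graph i)) x = lagrangian (pattern i) (push (@fintype.split m 4) x).
Proof. by rewrite pattern_graphE lagrangian_push. Qed.

(** The patterns live on a sum type; splitting the ordinals transports all their
    properties. *)
Lemma patterns_extremal : extremal_patterns (fun i => htriples (pattern_graph i))
  (opt_value R m) pattern_weight.
Proof.
have split_inj : injective (@fintype.split m 4) := can_inj (@splitK m 4).
split.
- by move=> i; exact: htriples_system.
- move=> i a b ab; rewrite pattern_graphE.
  have /existsP[w hw] : adjacent (pattern i) (fintype.split a) (fintype.split b).
    by apply: pattern_cover; [rewrite /m; lia|rewrite (inj_eq split_inj)].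
  by apply/existsP; exists (unsplit w); rewrite /pull unsplitK.
- move=> i j s hs; apply: val_inj => /=.
  have [i_lt j_lt] := (ltn_ord i, ltn_ord j).
  have [t1|t1] := leqP t 1; first by lia.
  apply: (@pattern_hom_index m i j (fun u => fintype.split (s (unsplit u)))).
  + by rewrite /m; lia.
  + by rewrite /m; lia.
  + move=> u v w huvw; have := hs (unsplit u) (unsplit v) (unsplit w).
    by rewrite !pattern_graphE /pull !unsplitK; exact.
- by rewrite opt_value_gt0 // ltW // opt_value_lt1.
- move=> i x x0; rewrite lagrangian_pattern_graph -(total_push (@fintype.split m 4)).
  by apply: pattern_le => // u; exact: push_ge0.
- have [c c0 hc] := common_lower_bound (opt_weight_gt0 R m4).
  by exists c => // i u; exact: hc.
- move=> i; rewrite -(opt_weight_sum R m4) big_split_ord big_sumType /=.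
  congr (_ + _); apply: eq_bigr => a _; rewrite /pattern_weight.
    by rewrite -[lshift 4 a]/(unsplit (inl a)) unsplitK.
  by rewrite -[rshift m a]/(unsplit (inr a)) unsplitK.
- move=> i; rewrite lagrangian_pattern_graph -(pattern_opt R m4 i).
  by apply: eq_lagrangian => u; rewrite push_split /pattern_weight unsplitK.
move=> eta eta0.
have /boolp.choice[e he] : forall i : 'I_t, exists e : R, 0 < e /\
  forall x : 'I_(m + 4) -> R, (forall b, 0 <= x b) -> \sum_b x b <= 1 ->
  opt_value R m - e <= lagrangian (htriples (pattern_graph i)) x ->
  forall a, `|x a - pattern_weight i a| <= eta.
  move=> i; have uniq (x : 'I_(m + 4) -> R) : (forall b, 0 <= x b) -> \sum_b x b <= 1 ->
      opt_value R m <= lagrangian (htriples (pattern_graph i)) x -> x =1 pattern_weight i.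
    move=> x0 x1; rewrite lagrangian_pattern_graph => le u.
    have p0 v : 0 <= push (@fintype.split m 4) x v by exact: push_ge0.
    have := pattern_unique m4 p0 _ le (fintype.split u).
    by rewrite total_push push_split splitK; apply.
  by have [e e0 he] := modulus uniq eta0; exists e.
have [eps eps0 hle] := common_lower_bound (fun i => (he i).1).
exists eps => // i x x0 x1 big; apply: (he i).2 => //.
by apply: le_trans big; rewrite lerD2l lerN2.
Qed.

End PatternGraphs.

Theorem theorem1p2 (R : realType) (t : nat) (t_gt0 : (0 < t)%N) :
  exists (lambda : R) (G : 'I_t -> hypergraph 3 (3 * t + 5)%N) (M : hfamily 3),
    [/\ irrational lambda, 0 < lambda < 1 / 6 & finite_set M] /\
    [/\ is_turan_density M (6 * lambda),
        exists (eps : R) (N0 : nat), 0 < eps /\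
          forall n : nat, (N0 <= n)%N ->
          forall H : hypergraph 3 n, hfamily_free M H ->
            (3 * lambda - eps) * n%:R ^+ 2 <= (min_degree H)%:R ->
            exists i : 'I_t, colorable (G i) H
      & stability_number R M = Some t].
Proof.
have m4 : (4 <= 3 * t + 1)%N by lia.
have -> : (3 * t + 5 = 3 * t + 1 + 4)%N by rewrite -addnA.
have gP := patterns_extremal R t_gt0.
pose L := opt_value R (3 * t + 1).
exists (L / 6), (@pattern_graph t), (forbidden (local_size 'I_(3 * t + 1 + 4)) (@pattern_graph t)).
split; split.
- exact: opt_value_irrational.
- by rewrite divr_gt0 ?opt_value_gt0 //= ltr_pM2r ?invr_gt0 // opt_value_lt1.
- exact: forbidden_finite.
- rewrite mulrC divfK //; exact: turan_density gP.
- have -> : 3 * (L / 6) = L / 2 by field.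
  exact: degree_stability gP.
- exact: stability_numberE gP.
Qed.
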